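(* The operator $$\widetilde P^{ij}=\eta^{ij}\frac{d}{dx}+\sum_{m=1}^L\sum_{n=1}^L\mu^{mn}(\widetilde w_m)^i_k(u(x))\,u^k_x\left(\frac{d}{dx}\right)^{-1}\circ(\widetilde w_n)^j_s(u(x))\,u^s_x,$$ where $\eta^{ij}$ and $\mu^{mn}$ are arbitrary nondegenerate symmetric constant matrices, is Hamiltonian if and only if there (locally) exist functions $\psi_n(u)$, $1\le n\le L$, such that $$(\widetilde w_n)^i_j(u)=\eta^{is}\frac{\partial^2\psi_n}{\partial u^s\partial u^j},$$ and the following integrable system of nonlinear equations (describing all flat torsionless submanifolds in pseudo-Euclidean spaces) is satisfied: $$\sum_{\alpha,\beta=1}^L\mu^{\alpha\beta}\left(\frac{\partial^2\psi_\alpha}{\partial u^i\partial u^k}\frac{\partial^2\psi_\beta}{\partial u^j\partial u^l}-\frac{\partial^2\psi_\alpha}{\partial u^i\partial u^l}\frac{\partial^2\psi_\beta}{\partial u^j\partial u^k}\right)=0,\qquad \sum_{i,j=1}^N\eta^{ij}\left(\frac{\partial^2\psi_\alpha}{\partial u^i\partial u^k}\frac{\partial^2\psi_\beta}{\partial u^j\partial u^l}-\frac{\partial^2\psi_\alpha}{\partial u^i\partial u^l}\frac{\partial^2\psi_\beta}{\partial u^j\partial u^k}\right)=0$$ for all values of the free indices.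
   Context: Here $u=(u^1,\dots,u^N)$, $u^i(x)$ are functions (fields) of one variable $x$, and $(\widetilde w_n)^i_j(u)$, $1\le n\le L$, are smooth functions of $u$ (components of affinors, i.e. $(1,1)$-tensors); repeated upper and lower indices are summed. An operator $M^{ij}$ is Hamiltonian if $\{I,J\}=\int\frac{\delta I}{\delta u^i(x)}M^{ij}\frac{\delta J}{\delta u^j(x)}\,dx$ defines a Poisson bracket on arbitrary functionals of the fields, i.e. is skew-symmetric and satisfies the Jacobi identity. ''Integrable'' refers to the fact that the nonlinear system is the consistency condition of a linear problem with parameters: $\partial^2a/\partial u^i\partial u^j=\lambda\mu^{\alpha\beta}\omega_{\alpha,ij}b_\beta$, $\partial b_\alpha/\partial u^i=\rho\,\eta^{kj}\omega_{\alpha,ij}\,\partial a/\partial u^k$, with $\omega_{\alpha,ij}=\partial^2\psi_\alpha/\partial u^i\partial u^j$.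
   Formalization: ''Only if'' is proved for affinors w_n linearly independent over constants on a connected domain; it fails otherwise: L=2, mu=diag(1,-1), w_1=w_2 non-potential gives eta d/dx. Dependent cases with nondegenerate induced mu reduce to this. ''Integrable'' is read as descriptive. *)

(* Defs.v *)
From HB Require Import structures.
From mathcomp Require Import all_boot all_order all_algebra.
From mathcomp Require Import all_classical all_reals all_analysis.

Set Implicit Arguments.
Unset Strict Implicit.
Unset Printing Implicit Defensive.

Import Order.TTheory GRing.Theory Num.Theory.
Import numFieldNormedType.Exports.

Local Open Scope classical_set_scope.
Local Open Scope ring_scope.

Section Smooth.
Context {R : realType} {V : normedModType R}.

Fixpoint iter_derive (vs : seq V) (f : V -> R) : V -> R :=
  if vs is v :: vs' then iter_derive vs' (fun x => 'D_v f x) else f.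

(* C^oo on A (used for open A only): all iterated directional derivatives
   exist and are Frechet differentiable, hence continuous, on A. *)
Definition smooth_on (A : set V) (f : V -> R) : Prop :=
  forall (vs : seq V) (x : V), A x -> differentiable (iter_derive vs f) x.

End Smooth.

Definition partial {R : realType} {N : nat} (i : 'I_N) (f : 'rV[R]_N -> R) :
    'rV[R]_N -> R :=
  fun u => 'D_(delta_mx 0 i) f u.

Definition dx {R : realType} {N : nat} (u : R -> 'rV[R]_N) (i : 'I_N) (x : R) :
    R :=
  derive1 (fun y => u y 0 i) x.

(* (d/dx)^-1 is the skew-symmetric antiderivative, i.e. convolution with
   sgn(x) / 2. *)
Definition dinv {R : realType} (f : R -> R) (x : R) : R :=
  2^-1 * (\int[lebesgue_measure]_(y in `]-oo, x]) f y
          - \int[lebesgue_measure]_(y in `[x, +oo[) f y).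

Section Functionals.
Context {R : realType} {N : nat}.

(* Fields: smooth curves in the domain U of the (u^1, ..., u^N), with u_x of
   compact support, so that all integrals below converge. *)
Definition is_field (U : set 'rV[R]_N) (u : R -> 'rV[R]_N) : Prop :=
  [/\ forall i, smooth_on setT (fun x => u x 0 i),
      forall x, U (u x)
    & exists A : R, forall i x, A <= `|x| -> dx u i x = 0].

Definition is_test (phi : R -> 'rV[R]_N) : Prop :=
  (forall i, smooth_on setT (fun x => phi x 0 i)) /\
  (exists A : R, forall x, A <= `|x| -> phi x = 0).

(* Smooth k-parameter families of fields, parameterized by S (open), whose
   variation is locally uniformly compactly supported in x. *)
Definition is_family (U : set 'rV[R]_N) (k : nat) (S : set 'rV[R]_k)
    (u : 'rV[R]_k -> R -> 'rV[R]_N) : Prop :=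
  [/\ forall s, S s -> is_field U (u s),
      forall i, smooth_on (S `*` setT) (fun p : 'rV[R]_k * R => u p.1 p.2 0 i)
    & forall s0, S s0 -> exists A : R, \forall s \near s0,
        forall x, A <= `|x| -> u s x = u s0 x].

(* Covector fields u |-> xi[u] on the space of fields, with components
   xi_i[u](x), smooth along every smooth family of fields. *)
Definition is_covector (U : set 'rV[R]_N)
    (xi : (R -> 'rV[R]_N) -> R -> 'rV[R]_N) : Prop :=
  forall (k : nat) (S : set 'rV[R]_k) (u : 'rV[R]_k -> R -> 'rV[R]_N),
    open S -> is_family U S u ->
    (forall i, smooth_on (S `*` setT)
                 (fun p : 'rV[R]_k * R => xi (u p.1) p.2 0 i)) /\
    (forall s0, S s0 -> exists A : R, \forall s \near s0,
        forall x, A <= `|x| -> xi (u s) x = 0).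

(* Functionals are plain functions of u; only their values on fields matter. *)
Definition is_var_deriv (U : set 'rV[R]_N) (I : (R -> 'rV[R]_N) -> R)
    (xi : (R -> 'rV[R]_N) -> R -> 'rV[R]_N) : Prop :=
  is_covector U xi /\
  forall u phi, is_field U u -> is_test phi ->
    is_derive (0 : R) (1 : R) (fun e : R => I (fun x => u x + e *: phi x))
      (\int[lebesgue_measure]_x \sum_(i < N) xi u x 0 i * phi x 0 i).

Definition is_functional (U : set 'rV[R]_N) (I : (R -> 'rV[R]_N) -> R) : Prop :=
  exists xi, is_var_deriv U I xi.

(* delta I / delta u^i (x); it is determined by I on the fields. *)
Definition var_deriv (U : set 'rV[R]_N) (I : (R -> 'rV[R]_N) -> R) :
    (R -> 'rV[R]_N) -> R -> 'rV[R]_N :=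
  xget (fun _ _ => 0) [set xi | is_var_deriv U I xi].

(* An operator M^{ij} depending on the field u maps zeta_j to M^{ij} zeta_j. *)
Definition bracket (U : set 'rV[R]_N)
    (M : (R -> 'rV[R]_N) -> (R -> 'rV[R]_N) -> R -> 'rV[R]_N)
    (I J : (R -> 'rV[R]_N) -> R) (u : R -> 'rV[R]_N) : R :=
  \int[lebesgue_measure]_x
    \sum_(i < N) var_deriv U I u x 0 i * M u (var_deriv U J u) x 0 i.

(* The bracket is a Lie bracket on functionals; bilinearity and the Leibniz
   rule are automatic from its form. *)
Definition hamiltonian (U : set 'rV[R]_N)
    (M : (R -> 'rV[R]_N) -> (R -> 'rV[R]_N) -> R -> 'rV[R]_N) : Prop :=
  [/\ forall I J, is_functional U I -> is_functional U J ->
        is_functional U (bracket U M I J),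
      forall I J u, is_functional U I -> is_functional U J -> is_field U u ->
        bracket U M I J u = - bracket U M J I u
    & forall I J K u, is_functional U I -> is_functional U J ->
        is_functional U K -> is_field U u ->
        bracket U M (bracket U M I J) K u
        + bracket U M (bracket U M J K) I u
        + bracket U M (bracket U M K I) J u = 0].

End Functionals.

Section NonlocalOperator.
Context {R : realType} {N L : nat}.

Definition nonlocal_op (eta : 'M[R]_N) (mu : 'M[R]_L)
    (w : 'I_L -> 'rV[R]_N -> 'M[R]_N)
    (u zeta : R -> 'rV[R]_N) (x : R) : 'rV[R]_N :=
  \row_(i < N)
    (\sum_(j < N) eta i j * dx zeta j x
     + \sum_(m < L) \sum_(n < L)
         mu m n * (\sum_(k < N) w m (u x) i k * dx u k x)
         * dinv (fun y => \sum_(j < N) \sum_(s < N)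
                            w n (u y) j s * dx u s y * zeta y 0 j) x).

(* Needed for "Hamiltonian => potential": for mu = diag(1, -1) and
   w_1 = w_2 arbitrary, the nonlocal terms cancel and the operator is just
   eta d/dx, which is Hamiltonian whatever w_1 is. *)
Definition affinors_independent (U : set 'rV[R]_N)
    (w : 'I_L -> 'rV[R]_N -> 'M[R]_N) : Prop :=
  forall c : 'I_L -> R,
    (forall u, U u -> \sum_(n < L) c n *: w n u = 0) -> forall n, c n = 0.

Definition hess (f : 'rV[R]_N -> R) (i j : 'I_N) (u : 'rV[R]_N) : R :=
  partial i (partial j f) u.

Definition locally_potential_flat (eta : 'M[R]_N) (mu : 'M[R]_L)
    (U : set 'rV[R]_N) (w : 'I_L -> 'rV[R]_N -> 'M[R]_N) : Prop :=
  forall p, U p -> exists (V : set 'rV[R]_N) (psi : 'I_L -> 'rV[R]_N -> R),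
    [/\ [/\ open V, V p & V `<=` U],
        forall n, smooth_on V (psi n),
        forall u, V u -> forall n i j,
          w n u i j = \sum_(s < N) eta i s * hess (psi n) s j u,
        forall u, V u -> forall i j k l,
          \sum_(a < L) \sum_(b < L)
            mu a b * (hess (psi a) i k u * hess (psi b) j l u
                      - hess (psi a) i l u * hess (psi b) j k u) = 0
      & forall u, V u -> forall a b k l,
          \sum_(i < N) \sum_(j < N)
            eta i j * (hess (psi a) i k u * hess (psi b) j l u
                       - hess (psi a) i l u * hess (psi b) j k u) = 0].

End NonlocalOperator.

(* Main.v *)
(* Write W_n = w_n(u) u_x, b_n = (d/dx)^-1 <W_n, b>, and M for the operator.
   The bracket is always skew and always maps functionals to functionals. In
   the Jacobi sum of I, J, K the terms with second variations cancel, because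
   these are symmetric, and what remains is trilinear in the variational
   derivatives a, b, c: the cyclic sum over (a, b, c) of
     mu^{mn} int (<dW_m[M c], a> b_n - <dW_m[M c], b> a_n),
   where dW_m[phi] is the variation of W_m along phi. The functionals int a.u
   realize all test functions a, so "Hamiltonian" means that this cyclic sum
   vanishes for all fields u and all test functions a, b, c.

   If the w_n are symmetric, closed (d_l w_k = d_k w_l), commute and satisfy
   the Gauss equation, then dW_m[phi] = (w_m phi)', and after one integration
   by parts the integrand of the cyclic sum is zero pointwise.

   Conversely the cyclic sum is int a.F(b, c), hence F = 0. Evaluate F at a
   point where u = p, u_x = 0 and u_xx = e e_r: it depends only on b, b'', b_n
   and c, c'', c_n there. When the affinors are independent, the field can be
   led through points of U at which all of them are seen, so that the nonlocal
   values b_n can be prescribed independently of b and b''. Separating the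
   coefficients of b_n c_q, b_n c'', b_n c and b c gives commutation, symmetry,
   closedness and the Gauss equation. Closedness and symmetry of w_n eta yield
   the potentials psi_n by applying the Poincare lemma twice. *)
Require Import Defs.
From HB Require Import structures.
From mathcomp Require Import all_boot all_order all_algebra.
From mathcomp Require Import all_classical all_reals all_analysis.
From mathcomp Require Import ring lra.

Set Implicit Arguments.
Unset Strict Implicit.
Unset Printing Implicit Defensive.

Import Order.TTheory GRing.Theory Num.Theory.
Import numFieldNormedType.Exports.

Local Open Scope classical_set_scope.
Local Open Scope ring_scope.

(** * Smooth functions on normed spaces *)

(** Covectors are smooth only along finite-dimensional families of fields, and functionals have
    directional derivatives only; there is no calculus on the space of fields. Every variation is
    taken along a family u + s phi + t psi, for the parameters that keep it in U, and the symmetry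
    of second variations is Schwarz's theorem for two real variables. Integrals over the line and
    (d/dx)^-1 become, locally in the parameters, values of x int_0^1 f(tx) dt, so differentiation
    under an integral is needed on [0,1] only.

    In the converse, F(b, c) contains terms (d/dx)^-1 <dW_m[M c], b>, which no local choice of b and
    c controls. They are multiplied by W_n, which vanishes where u_x = 0; u_xx = e e_r then brings
    the affinors back in. Jets and nonlocal values are prescribed at different places: for x < -2
    the field visits finitely many points, enough because R^L has finite dimension, and b is tuned
    on x < -1 to give b_n; around 0, b gets its value and second derivative. The tuned part
    contributes half of its integral to b_n(0), so tuning is a linear system with a Gram matrix. *)

Section SmoothCalculus.
Context {R : realType}.
Implicit Types V W : normedModType R.

(** [smooth_on] runs over lists of directions and gives no induction for products or compositions,
    whose derivatives are sums of terms of another shape. At a finite order, with all functions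
    treated at once, the induction goes through. [Cn n] asks the derivatives up to order [n] to be
    differentiable, so [Cn 0] is already differentiability. *)
Fixpoint Cn {V} (n : nat) (A : set V) (f : V -> R) : Prop :=
  (forall x, A x -> differentiable f x) /\
  (if n is m.+1 then forall v, Cn m A ('D_v f) else True).

Lemma Cn_diff V n (A : set V) f x : Cn n A f -> A x -> differentiable f x.
Proof. by case: n => [|n] [h _]; apply: h. Qed.

Lemma Cn_derive V n (A : set V) f v : Cn n.+1 A f -> Cn n A ('D_v f).
Proof. by case=> _; apply. Qed.

Lemma smooth_onP V (A : set V) f : smooth_on A f <-> forall n, Cn n A f.
Proof.
split=> [sf n|cf vs].
  elim: n f sf => [|n ih] f sf; split=> //; try exact: (sf [::]).
  by move=> v; apply: ih => vs x; exact: (sf (v :: vs)).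
elim: vs f cf => [|v vs ih] f cf /=; first by move=> x; exact: Cn_diff (cf 0%N).
by apply: ih => n; exact: Cn_derive (cf n.+1).
Qed.

Lemma smooth_on_diff V (A : set V) f x :
  smooth_on A f -> A x -> differentiable f x.
Proof. by move=> sf; exact: (sf [::]). Qed.

Lemma smooth_on_derive V (A : set V) f v :
  smooth_on A f -> smooth_on A ('D_v f).
Proof. by move=> /smooth_onP sf; apply/smooth_onP => n; apply: Cn_derive. Qed.

Lemma smooth_onS V (A B : set V) f : A `<=` B -> smooth_on B f -> smooth_on A f.
Proof. by move=> AB sf vs x /AB; exact: sf. Qed.

(** The epsilon form of Frechet differentiability, for cases where the differential is a known
    linear form and only an estimate is at hand: integrals with parameters, and [flatexp] at 0. *)
Lemma diff_eps V (f : V -> R) (x : V) (L : {linear V -> R}) : continuous L ->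
  (forall e : R, 0 < e -> \forall h \near (0 : V),
     `|f (h + x) - f x - L h| <= e * `|h|) ->
  differentiable f x /\ 'd f x = L :> (V -> R).
Proof.
move=> cL H.
have E : f \o shift x = cst (f x) + L +o_ (0 : V) id.
  apply/eqaddoP => e e0; have := H e e0; apply: filterS => h.
  by rewrite /= opprD addrA.
have dE := diff_unique cL E; split=> //.
by apply/diff_locallyP; rewrite dE.
Qed.

Lemma diff_epsE V (f : V -> R) (x : V) : differentiable f x ->
  forall e : R, 0 < e -> \forall h \near (0 : V),
     `|f (h + x) - f x - 'd f x h| <= e * `|h|.
Proof.
move=> /diff_locally /eqaddoP H e e0; have := H e e0; apply: filterS => h.
by rewrite /= opprD addrA.
Qed.

Lemma near_eq_differentiable V (f g : V -> R) (a : V) :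
  {near a, f =1 g} -> differentiable f a -> differentiable g a.
Proof.
move=> fg df; have fga : f a = g a by exact: (nbhs_singleton fg).
apply: (proj1 (diff_eps (L := 'd f a) _ _)) => [|e e0]; first exact: diff_continuous.
have fg0 : \forall h \near (0 : V), f (h + a) = g (h + a).
  by move: fg; rewrite (near_shift (0 : V)) /= subr0.
have := diff_epsE df e0; apply: filter_app; near=> h.
by rewrite -fga (near fg0 h).
Unshelve. all: by end_near. Qed.

Lemma open_near V (A : set V) x : open A -> A x -> \forall y \near x, A y.
Proof. by move=> oA Ax; apply: open_nbhs_nbhs. Qed.

Lemma eq_on_derive V (A : set V) (f g : V -> R) v x : open A -> A x ->
  (forall y, A y -> f y = g y) -> 'D_v f x = 'D_v g x.
Proof.
move=> oA Ax fg; apply: near_eq_derive.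
by apply: filterS (open_near oA Ax).
Qed.

Lemma Cn_ext V n (A : set V) (f g : V -> R) : open A ->
  (forall y, A y -> f y = g y) -> Cn n A f -> Cn n A g.
Proof.
move=> oA; elim: n f g => [|n ih] f g fg [df cf]; split=> //.
- move=> x Ax; apply: near_eq_differentiable (df x Ax).
  by apply: filterS (open_near oA Ax).
- move=> x Ax; apply: near_eq_differentiable (df x Ax).
  by apply: filterS (open_near oA Ax).
- move=> v; apply: ih (cf v) => y Ay; exact: eq_on_derive fg.
Qed.

Lemma Cn_pred V n (A : set V) (f : V -> R) : Cn n.+1 A f -> Cn n A f.
Proof. by elim: n f => [|n ih] f [df cf]; split=> // v; exact: ih. Qed.

Lemma CnW V m n (A : set V) (f : V -> R) : (m <= n)%N -> Cn n A f -> Cn m A f.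
Proof.
move=> /subnK <-; elim: (n - m)%N => // k ih; rewrite addSn => /Cn_pred; exact: ih.
Qed.

Lemma derive_add V (f g : V -> R) v x :
  differentiable f x -> differentiable g x ->
  'D_v (fun y => f y + g y) x = 'D_v f x + 'D_v g x.
Proof. by move=> df dg; apply: deriveD; exact: diff_derivable. Qed.

Lemma derive_mul V (f g : V -> R) v x :
  differentiable f x -> differentiable g x ->
  'D_v (fun y => f y * g y) x = 'D_v f x * g x + f x * 'D_v g x.
Proof.
move=> df dg; rewrite [LHS](@deriveM _ _ f g); try exact: diff_derivable.
by rewrite addrC; congr (_ + _); exact: mulrC.
Qed.

Lemma differentiable_add V (f g : V -> R) x :
  differentiable f x -> differentiable g x ->
  differentiable (fun y => f y + g y) x.
Proof. exact: differentiableD. Qed.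

Lemma differentiable_mul V (f g : V -> R) x :
  differentiable f x -> differentiable g x ->
  differentiable (fun y => f y * g y) x.
Proof. exact: differentiableM. Qed.

Lemma Cn_cst V n (A : set V) (c : R) : Cn n A (fun=> c).
Proof.
elim: n c => [|n ih] c; split=> //; try by move=> x _; exact: (differentiable_cst c).
move=> v; rewrite (_ : 'D_v _ = fun=> 0); first exact: ih.
by apply/funext => x; exact: derive_cst.
Qed.

Lemma CnD V n (A : set V) (f g : V -> R) : open A ->
  Cn n A f -> Cn n A g -> Cn n A (fun x => f x + g x).
Proof.
move=> oA; elim: n f g => [|n ih] f g [df cf] [dg cg]; split=> //;
  try by move=> x Ax; apply: differentiable_add; [exact: df | exact: dg].
move=> v; apply: (Cn_ext (f := fun x => 'D_v f x + 'D_v g x)) => //.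
  by move=> y Ay; rewrite derive_add //; [exact: df | exact: dg].
by apply: ih; [exact: cf | exact: cg].
Qed.

Lemma CnM V n (A : set V) (f g : V -> R) : open A ->
  Cn n A f -> Cn n A g -> Cn n A (fun x => f x * g x).
Proof.
move=> oA; elim: n f g => [|n ih] f g cf cg; have [df cf'] := cf;
  have [dg cg'] := cg; split=> //;
  try by move=> x Ax; apply: differentiable_mul; [exact: df | exact: dg].
move=> v.
apply: (Cn_ext (f := fun x => 'D_v f x * g x + f x * 'D_v g x)) => //.
  by move=> y Ay; rewrite derive_mul //; [exact: df | exact: dg].
by apply: CnD => //; apply: ih => //; first [exact: Cn_pred | exact: (Cn_derive v)].
Qed.

Lemma Cn_sum V n (A : set V) (I : Type) (r : seq I) (P : pred I)
    (f : I -> V -> R) : open A -> (forall i, P i -> Cn n A (f i)) ->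
  Cn n A (fun x => \sum_(i <- r | P i) f i x).
Proof.
move=> oA cf; elim: r => [|i r ih].
  by apply: Cn_ext (@Cn_cst _ _ _ 0) => // x _; rewrite big_nil.
case: (boolP (P i)) => Pi.
  apply: Cn_ext (CnD oA (cf i Pi) ih) => // x _; by rewrite big_cons Pi.
by apply: Cn_ext ih => // x _; rewrite big_cons (negbTE Pi).
Qed.

Lemma Cn_linear V n (A : set V) (f : {linear V -> R}) : continuous f -> Cn n A f.
Proof.
move=> cf; case: n => [|n]; split=> //;
  try by move=> x _; exact: linear_differentiable.
move=> v; rewrite (_ : 'D_v f = fun=> f v); first exact: Cn_cst.
apply/funext => x; rewrite deriveE; last exact: linear_differentiable.
by rewrite diff_lin.
Qed.

(* Finite-dimensional coordinates carried as data: V * R is not of the form 'rV_n. *)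
Record frame (W : normedModType R) := Frame {
  fdim : nat;
  fvec : 'I_fdim -> W;
  fco : 'I_fdim -> {linear W -> R};
  fco_cont : forall i, continuous (fco i);
  frameE : forall w, w = \sum_i fco i w *: fvec i }.
Arguments fvec {W} f i.
Arguments fco {W} f i.
Arguments fco_cont {W} f i.
Arguments frameE {W} f w.

Lemma differentiable_frame V W (fr : frame W) (g : V -> W) x :
  (forall i, differentiable (fun y => fco fr i (g y)) x) -> differentiable g x.
Proof.
move=> dg.
have -> : g = \sum_i (fun y => fco fr i (g y) *: fvec fr i).
  by apply/funext => y; rewrite fct_sumE [LHS](frameE fr).
apply: differentiable_sum => i; exact: differentiableZl.
Qed.

(** The chain rule in the coordinates of the middle space: [f] is differentiated only along the
    fixed vectors [fvec fr i], so the induction of [Cn_comp] stays within [Cn]. *)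
Lemma derive_comp V W (fr : frame W) (f : W -> R) (g : V -> W) v x :
  (forall i, differentiable (fun y => fco fr i (g y)) x) ->
  differentiable f (g x) ->
  'D_v (fun y => f (g y)) x =
  \sum_i 'D_v (fun y => fco fr i (g y)) x * 'D_(fvec fr i) f (g x).
Proof.
move=> dgi df; have dg := differentiable_frame dgi.
have -> : 'D_v (fun y => f (g y)) x = 'd f (g x) ('d g x v).
  rewrite deriveE; last exact: (differentiable_comp (f := g)).
  by rewrite -[fun y => _]/(f \o g) (diff_comp dg df).
rewrite [X in 'd f _ X](frameE fr) linear_sum /=.
apply: eq_bigr => i _; rewrite linearZ /= -(deriveE _ df); congr (_ * _).
have dfc : differentiable (fco fr i) (g x).
  by apply: linear_differentiable; exact: fco_cont.
have -> : 'D_v (fun y => fco fr i (g y)) x = 'd (fco fr i \o g) x v.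
  by rewrite -deriveE //; exact: dgi.
by rewrite (diff_comp dg dfc) /= (diff_lin (g x) (fco_cont fr i)).
Qed.

Lemma Cn_comp V W n (fr : frame W) (A : set V) (B : set W) (f : W -> R)
    (g : V -> W) : open A -> (forall x, A x -> B (g x)) -> Cn n B f ->
  (forall i, Cn n A (fun y => fco fr i (g y))) -> Cn n A (fun y => f (g y)).
Proof.
move=> oA AB; elim: n f => [|n ih] f cf cg; split=> //.
- move=> x Ax; apply: (differentiable_comp (f := g)).
    by apply: (differentiable_frame (fr := fr)) => i; exact: Cn_diff (cg i) Ax.
  exact: Cn_diff cf (AB x Ax).
- move=> x Ax; apply: (differentiable_comp (f := g)).
    by apply: (differentiable_frame (fr := fr)) => i; exact: Cn_diff (cg i) Ax.
  exact: Cn_diff cf (AB x Ax).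
move=> v; apply: (Cn_ext (f := fun x => \sum_i 'D_v (fun y => fco fr i (g y)) x
    * 'D_(fvec fr i) f (g x))) => //.
  move=> y Ay; rewrite (derive_comp (fr := fr)) //.
    by move=> i; exact: Cn_diff (cg i) Ay.
  exact: Cn_diff cf (AB y Ay).
apply: Cn_sum => // i _; apply: CnM => //; first exact: Cn_derive (cg i).
apply: (ih ('D_(fvec fr i) f)); first exact: Cn_derive.
by move=> j; exact: Cn_pred.
Qed.

Lemma is_derive_line V (f : V -> R) (y v : V) (s : R) :
  derivable f (y + s *: v) v ->
  is_derive s 1 (fun t => f (y + t *: v)) ('D_v f (y + s *: v)).
Proof.
have E : (fun h : R => h^-1 *: (((fun t => f (y + t *: v)) \o shift s) (h *: 1)
      - f (y + s *: v)))
    = (fun h : R => h^-1 *: ((f \o shift (y + s *: v)) (h *: v) - f (y + s *: v))).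
  apply/funext => h /=; congr (_ *: (f _ - _)).
  by rewrite scalerDl addrCA [h *: 1]mulr1.
by move=> df; split; rewrite /derivable /derive E.
Qed.

(** The mean value theorem twice: for s |-> F s h - F s 0, then for t |-> Fs c t. *)
Lemma double_difference (F Fs Fst : R -> R -> R) (h : R) : 0 < h ->
  (forall s t, 0 <= s <= h -> 0 <= t <= h -> is_derive s 1 (F^~ t) (Fs s t)) ->
  (forall s t, 0 <= s <= h -> 0 <= t <= h -> is_derive t 1 (Fs s) (Fst s t)) ->
  exists c d, [/\ 0 <= c <= h, 0 <= d <= h &
    F h h - F 0 h - F h 0 + F 0 0 = h * h * Fst c d].
Proof.
move=> h0 dF dFs.
have h00 : 0 <= (0:R) <= h by rewrite lexx ltW.
have hhh : 0 <= h <= h by rewrite lexx ltW.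
have in_itvh x : x \in `]0, h[ -> 0 <= x <= h.
  by rewrite in_itv /= => /andP[a b]; rewrite !ltW.
have in_itvc x : x \in `[0, h] -> 0 <= x <= h by rewrite in_itv.
have dphi s : 0 <= s <= h ->
    is_derive s 1 (fun s => F s h - F s 0) (Fs s h - Fs s 0).
  move=> hs; have d1 := dF s h hs hhh; have d2 := dF s 0 hs h00.
  exact: is_deriveB.
have [c /in_itvh hc Ec] : exists2 c, c \in `]0, h[ &
    (F h h - F h 0) - (F 0 h - F 0 0) = (Fs c h - Fs c 0) * (h - 0).
  apply: (@MVT R (fun s => F s h - F s 0) (fun s => Fs s h - Fs s 0)) => //.
    by move=> x /in_itvh; exact: dphi.
  apply: derivable_within_continuous => x /in_itvc hx.
  exact: (@ex_derive _ _ _ _ _ _ _ (dphi _ hx)).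
have [d /in_itvh hd Ed] : exists2 d, d \in `]0, h[ &
    Fs c h - Fs c 0 = Fst c d * (h - 0).
  apply: (@MVT R (Fs c)) => //.
    by move=> x /in_itvh; exact: dFs.
  apply: derivable_within_continuous => x /in_itvc hx.
  exact: (@ex_derive _ _ _ _ _ _ _ (dFs _ _ hc hx)).
exists c, d; split=> //; move: Ec; rewrite Ed => Ec; lra.
Qed.

(** Either order of differentiation writes one double difference as h^2 times a mixed derivative
    near the origin, and continuity there concludes. The form with two real variables also serves
    functionals along a two-parameter family, of which only directional derivatives are given. *)
Lemma mixed_partials (F Fs Ft Fst Fts : R -> R -> R) (r : R) : 0 < r ->
  (forall s t : R, `|s| < r -> `|t| < r ->
    [/\ is_derive s (1 : R) (F^~ t) (Fs s t), is_derive t (1 : R) (F s) (Ft s t),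
        is_derive t (1 : R) (Fs s) (Fst s t) & is_derive s (1 : R) (Ft^~ t) (Fts s t)]) ->
  {for ((0, 0) : R * R), continuous (fun p : R * R => Fst p.1 p.2)} ->
  {for ((0, 0) : R * R), continuous (fun p : R * R => Fts p.1 p.2)} ->
  Fst 0 0 = Fts 0 0.
Proof.
move=> r0 dF cst cts; apply/eqP; rewrite -subr_eq0 -normr_le0.
apply/ler_addgt0Pr => e e0; rewrite add0r.
have e20 : 0 < e / 2 by lra.
move/cvgrPdist_lt: cst => /(_ _ e20) /nbhs_ballP[d1 /= d10 H1].
move/cvgrPdist_lt: cts => /(_ _ e20) /nbhs_ballP[d2 /= d20 H2].
pose h := Num.min r (Num.min d1 d2) / 2.
have m0 : 0 < Num.min r (Num.min d1 d2) by rewrite !lt_min r0 d10 d20.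
have hh : [/\ 0 < h, h < r, h < d1 & h < d2].
  have /andP[? /andP[? ?]] : [&& Num.min r (Num.min d1 d2) <= r,
    Num.min r (Num.min d1 d2) <= d1 & Num.min r (Num.min d1 d2) <= d2].
    by rewrite !ge_min !lexx !orbT.
  by rewrite /h; split; lra.
case: hh => h0 hr h1 h2.
have nrm s d : h < d -> 0 <= s <= h -> `|s| < d.
  by move=> hd /andP[s0 sh]; rewrite ger0_norm //; exact: le_lt_trans hd.
have [c [d [hc hd Ec]]] := @double_difference F Fs Fst h h0
  (fun s t hs ht => let: And4 a b c d := dF s t (nrm _ _ hr hs) (nrm _ _ hr ht) in a)
  (fun s t hs ht => let: And4 a b c d := dF s t (nrm _ _ hr hs) (nrm _ _ hr ht) in c).
(* The same double difference with the two variables exchanged. *)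
have [d' [c' [hd' hc' Ec']]] := @double_difference (fun t s => F s t)
  (fun t s => Ft s t) (fun t s => Fts s t) h h0
  (fun s t hs ht => let: And4 a b c d := dF t s (nrm _ _ hr ht) (nrm _ _ hr hs) in b)
  (fun s t hs ht => let: And4 a b c d := dF t s (nrm _ _ hr ht) (nrm _ _ hr hs) in d).
have E : Fst c d = Fts c' d'.
  have hh0 : h * h != 0 by rewrite mulf_neq0 // gt_eqF.
  by apply: (mulfI hh0); lra.
have B1 : `|Fst 0 0 - Fst c d| < e / 2.
  by apply: (H1 (c, d)); split; rewrite /ball /= sub0r normrN; exact: nrm.
have B2 : `|Fts 0 0 - Fts c' d'| < e / 2.
  by apply: (H2 (c', d')); split; rewrite /ball /= sub0r normrN; exact: nrm.
have -> : Fst 0 0 - Fts 0 0 =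
  (Fst 0 0 - Fst c d) - (Fts 0 0 - Fts c' d') by rewrite E; ring.
apply: (le_trans (ler_normB _ _)); lra.
Qed.

(** Schwarz on the plane x + s v + t w, which stays in the open set [A] for small s and t. *)
Lemma derive_derive V (A : set V) (f : V -> R) v w x : open A -> A x ->
  Cn 2 A f -> 'D_v ('D_w f) x = 'D_w ('D_v f) x.
Proof.
move=> oA Ax cf.
pose y (p : R * R) := x + p.1 *: v + p.2 *: w.
have cy : continuous y.
  move=> p; apply: cvgD; first apply: cvgD; first exact: cvg_cst.
  - by apply: cvgZr_tmp; exact: cvg_fst.
  - by apply: cvgZr_tmp; exact: cvg_snd.
have y0 : y (0, 0) = x by rewrite /y /= !scale0r !addr0.
have : \forall p \near ((0, 0) : R * R), A (y p).
  by apply: (cy (0, 0)); rewrite y0; exact: open_near.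
move=> /nbhs_ballP[r /= r0 H].
have Ay s t : `|s| < r -> `|t| < r -> A (x + s *: v + t *: w).
  by move=> hs ht; apply: (H (s, t)); split; rewrite /ball /= sub0r normrN.
have cvw u u' : {for ((0, 0) : R * R), continuous (fun p : R * R =>
    'D_u ('D_u' f) (x + p.1 *: v + p.2 *: w))}.
  have dD : {for y (0, 0), continuous ('D_u ('D_u' f))}.
    rewrite y0; apply: differentiable_continuous.
    exact: (Cn_diff (Cn_derive u (Cn_derive u' cf)) Ax).
  exact: (cvg_comp y ('D_u ('D_u' f)) (cy (0, 0)) dD).
have at0 (g : V -> R) : g (x + 0 *: v + 0 *: w) = g x.
  by apply: (congr1 g); exact: y0.
rewrite -(at0 ('D_v ('D_w f))) -(at0 ('D_w ('D_v f))).
apply: esym; apply: (@mixed_partials (fun s t => f (x + s *: v + t *: w))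
 (fun s t => 'D_v f (x + s *: v + t *: w))
 (fun s t => 'D_w f (x + s *: v + t *: w))
 (fun s t => 'D_w ('D_v f) (x + s *: v + t *: w))
 (fun s t => 'D_v ('D_w f) (x + s *: v + t *: w)) r r0 _ (cvw _ _) (cvw _ _)) => s t hs ht.
have a := Ay s t hs ht.
have E z : x + z *: v + t *: w = (x + t *: w) + z *: v by rewrite addrAC.
have dd u : differentiable ('D_u f) (x + s *: v + t *: w).
  exact: (Cn_diff (Cn_derive u cf) a).
have d0 := Cn_diff cf a.
split.
- under eq_fun do rewrite E.
  by rewrite E; apply: is_derive_line; rewrite -E; exact: diff_derivable.
- by apply: is_derive_line; exact: diff_derivable.
- by apply: is_derive_line; exact: diff_derivable.
- under eq_fun do rewrite E.
  by rewrite E; apply: is_derive_line; rewrite -E; exact: diff_derivable.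
Qed.

End SmoothCalculus.
Arguments fvec {R W} f i.
Arguments fco {R W} f i.
Arguments fco_cont {R W} f i.
Arguments frameE {R W} f w.

(** * Algebra of smooth functions and coordinate frames *)

Section SmoothOn.
Context {R : realType}.
Implicit Types V W : normedModType R.

Lemma smooth_on_ext V (A : set V) (f g : V -> R) : open A ->
  (forall y, A y -> f y = g y) -> smooth_on A f -> smooth_on A g.
Proof.
move=> oA fg /smooth_onP cf; apply/smooth_onP => n; exact: Cn_ext (cf n).
Qed.

Lemma smooth_on_cst V (A : set V) (c : R) : smooth_on A (fun=> c).
Proof. by apply/smooth_onP => n; exact: Cn_cst. Qed.

Lemma smooth_onD V (A : set V) (f g : V -> R) : open A ->
  smooth_on A f -> smooth_on A g -> smooth_on A (fun x => f x + g x).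
Proof.
by move=> oA /smooth_onP cf /smooth_onP cg; apply/smooth_onP => n; exact: CnD.
Qed.

Lemma smooth_onM V (A : set V) (f g : V -> R) : open A ->
  smooth_on A f -> smooth_on A g -> smooth_on A (fun x => f x * g x).
Proof.
by move=> oA /smooth_onP cf /smooth_onP cg; apply/smooth_onP => n; exact: CnM.
Qed.

Lemma smooth_onN V (A : set V) (f : V -> R) : open A ->
  smooth_on A f -> smooth_on A (fun x => - f x).
Proof.
move=> oA sf; have := smooth_onM oA (@smooth_on_cst _ A (-1)) sf.
by apply: smooth_on_ext => // y _; rewrite mulN1r.
Qed.

Lemma smooth_onB V (A : set V) (f g : V -> R) : open A ->
  smooth_on A f -> smooth_on A g -> smooth_on A (fun x => f x - g x).
Proof. by move=> oA sf sg; apply: smooth_onD => //; exact: smooth_onN. Qed.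

Lemma smooth_on_sum V (A : set V) (I : Type) (r : seq I) (P : pred I)
    (f : I -> V -> R) : open A -> (forall i, P i -> smooth_on A (f i)) ->
  smooth_on A (fun x => \sum_(i <- r | P i) f i x).
Proof.
move=> oA cf; apply/smooth_onP => n; apply: Cn_sum => // i Pi.
exact: (proj1 (smooth_onP _ _) (cf i Pi)).
Qed.

Lemma smooth_on_linear V (A : set V) (f : {linear V -> R}) :
  continuous f -> smooth_on A f.
Proof. by move=> cf; apply/smooth_onP => n; exact: Cn_linear. Qed.

Lemma smooth_on_comp V W (fr : frame W) (A : set V) (B : set W) (f : W -> R)
    (g : V -> W) : open A -> (forall x, A x -> B (g x)) -> smooth_on B f ->
  (forall i, smooth_on A (fun y => fco fr i (g y))) ->
  smooth_on A (fun y => f (g y)).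
Proof.
move=> oA AB /smooth_onP cf cg; apply/smooth_onP => n.
by apply: (Cn_comp oA AB (cf n)) => i; exact: (proj1 (smooth_onP _ _) (cg i)).
Qed.

Lemma smooth_on_derive_derive V (A : set V) (f : V -> R) v w x :
  open A -> A x -> smooth_on A f -> 'D_v ('D_w f) x = 'D_w ('D_v f) x.
Proof. by move=> oA Ax /smooth_onP cf; exact: derive_derive (cf 2%N). Qed.

Lemma smooth_on_continuous V (A : set V) (f : V -> R) x :
  smooth_on A f -> A x -> {for x, continuous f}.
Proof. by move=> sf Ax; apply/differentiable_continuous; exact: smooth_on_diff Ax. Qed.

Definition rvco n (i : 'I_n) (v : 'rV[R]_n) : R := v 0 i.

Lemma rvco_linear n (i : 'I_n) : linear (rvco i).
Proof. by move=> a u v; rewrite /rvco !mxE. Qed.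

HB.instance Definition _ n (i : 'I_n) :=
  GRing.isLinear.Build R 'rV[R]_n R *:%R (rvco i) (rvco_linear i).

Lemma rvco_continuous n (i : 'I_n) : continuous (rvco i).
Proof. exact: coord_continuous. Qed.

Lemma rv_frameE n (w : 'rV[R]_n) : w = \sum_i rvco i w *: delta_mx 0 i.
Proof. exact: row_sum_delta. Qed.

Definition rv_frame n : frame 'rV[R]_n :=
  Frame (@rvco_continuous n) (@rv_frameE n).

Lemma idfun_continuous : continuous (idfun : R -> R).
Proof. by move=> x; exact: cvg_id. Qed.

Lemma real_frameE (w : R) : w = \sum_(i < 1) (idfun w : R) *: (1 : R).
Proof. by rewrite big_ord1 [RHS]mulr1. Qed.

Definition real_frame : frame R :=
  Frame (fun=> idfun_continuous) real_frameE.

Section Prod.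
Variables (V W : normedModType R) (fV : frame V) (fW : frame W).

Definition pair_vec (i : 'I_(fdim fV + fdim fW)) : V * W :=
  match fintype.split i with inl j => (fvec fV j, 0) | inr j => (0, fvec fW j) end.

Definition pair_co (i : 'I_(fdim fV + fdim fW)) : {linear (V * W)%type -> R} :=
  match fintype.split i with
  | inl j => fco fV j \o fst | inr j => fco fW j \o snd
  end.

Lemma pair_co_continuous i : continuous (pair_co i).
Proof.
rewrite /pair_co; case: fintype.split => j x.
  apply: (@continuous_comp _ _ _ (@fst V W)); first exact: cvg_fst.
  exact: fco_cont.
apply: (@continuous_comp _ _ _ (@snd V W)); first exact: cvg_snd.
exact: fco_cont.
Qed.

Lemma pair_frameE w : w = \sum_i pair_co i w *: pair_vec i.
Proof.
case: w => v w; rewrite big_split_ord /=.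
under eq_bigr do rewrite /pair_co /pair_vec (unsplitK (inl _)).
under [X in _ + X]eq_bigr do rewrite /pair_co /pair_vec (unsplitK (inr _)).
apply/eqP; rewrite xpair_eqE /= !raddf_sum /=; apply/andP; split; apply/eqP.
  rewrite [X in _ + X]big1 ?addr0; last by move=> i _; exact: scaler0.
  exact: frameE.
rewrite big1 ?add0r; last by move=> i _; exact: scaler0.
exact: frameE.
Qed.

Definition pair_frame : frame (V * W)%type := Frame pair_co_continuous pair_frameE.

End Prod.

Lemma frame_bound W (fr : frame W) :
  exists2 k : R, 0 < k & forall i h, `|fco fr i h| <= k * `|h|.
Proof.
have H i : exists2 k : R, 0 < k & forall h, `|fco fr i h| <= k * `|h|.
  exact: linear_lipschitz (fco_cont fr i).
have /choice[k Hk] : forall i, exists k : R, 0 < k /\ forall h, `|fco fr i h| <= k * `|h|.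
  by move=> i; have [k k0 hk] := H i; exists k.
exists (1 + \sum_i k i).
  by apply: ltr_wpDr => //; apply: sumr_ge0 => i _; have [/ltW] := Hk i.
move=> i h; have [_ /(_ h)/le_trans] := Hk i; apply; apply: ler_wpM2r => //.
rewrite (bigD1 i) //= addrCA lerDl; apply: addr_ge0 => //.
by apply: sumr_ge0 => j _; have [/ltW] := Hk j.
Qed.

(** A bundled continuous linear form with free coefficients: the candidate for the differential of
    an integral with parameters. *)
Definition lincomb W (fr : frame W) (a : 'I_(fdim fr) -> R) (w : W) : R :=
  \sum_i fco fr i w * a i.

Lemma lincomb_linear W (fr : frame W) a : linear (@lincomb W fr a).
Proof.
move=> c u v; rewrite /lincomb [_ *: _ in RHS]mulr_sumr -big_split.
by apply: eq_bigr => i _; rewrite linearP /= mulrDl mulrA.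
Qed.

HB.instance Definition _ W (fr : frame W) a :=
  GRing.isLinear.Build R W R *:%R (@lincomb W fr a) (lincomb_linear a).

Lemma lincomb_continuous W (fr : frame W) a : continuous (@lincomb W fr a).
Proof.
rewrite /lincomb; elim: (index_enum _) => [|i r ih] x.
  by under eq_fun do rewrite big_nil; exact: cvg_cst.
under eq_fun do rewrite big_cons.
by apply: cvgD; [apply: cvgM; [exact: fco_cont | exact: cvg_cst] | exact: ih].
Qed.

End SmoothOn.

(** * Integrals of continuous functions over a segment *)

Section UnitIntegral.
Context {R : realType}.

(** Two-sided continuity at each point, ends included: it implies continuity within the segment and
    is closed under pointwise operations without subspace topologies. *)
Definition contin (a b : R) (f : R -> R) :=
  forall t, a <= t <= b -> {for t, continuous f}.

Lemma contin_within a b f : contin a b f -> {within `[a, b], continuous f}.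
Proof.
move=> cf; apply: continuous_in_subspaceT => t; rewrite inE /= in_itv /=.
exact: cf.
Qed.

Lemma contin_integrable a b f : contin a b f ->
  lebesgue_measure.-integrable `[a, b] (EFin \o f).
Proof.
by move=> /contin_within cf; apply: continuous_compact_integrable => //;
  exact: segment_compact.
Qed.

Lemma continD a b f g : contin a b f -> contin a b g ->
  contin a b (fun t => f t + g t).
Proof. by move=> cf cg t ht; apply: cvgD; [exact: cf | exact: cg]. Qed.

Lemma continM a b f g : contin a b f -> contin a b g ->
  contin a b (fun t => f t * g t).
Proof. by move=> cf cg t ht; apply: cvgM; [exact: cf | exact: cg]. Qed.

Lemma contin_cst a b c : contin a b (fun=> c).
Proof. by move=> t _; exact: cvg_cst. Qed.

Lemma eq_contin a b f g : f =1 g -> contin a b f -> contin a b g.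
Proof. by move=> /funext ->. Qed.

Lemma contin_sum a b (I : Type) (r : seq I) (P : pred I) (f : I -> R -> R) :
  (forall i, P i -> contin a b (f i)) ->
  contin a b (fun t => \sum_(i <- r | P i) f i t).
Proof.
move=> cf; elim: r => [|i r ih].
  by apply: (@eq_contin _ _ (fun=> 0)) (@contin_cst _ _ 0) => t; rewrite big_nil.
case: (boolP (P i)) => Pi.
  apply: (eq_contin _ (continD (cf i Pi) ih)) => t; by rewrite big_cons Pi.
by apply: (eq_contin _ ih) => t; rewrite big_cons (negbTE Pi).
Qed.

Definition segint (a b : R) (f : R -> R) : R :=
  \int[lebesgue_measure]_(t in `[a, b]) f t.

Lemma segintD a b f g : contin a b f -> contin a b g ->
  segint a b (fun t => f t + g t) = segint a b f + segint a b g.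
Proof. by move=> cf cg; apply: RintegralD => //; exact: contin_integrable. Qed.

Lemma segintZ a b c f : contin a b f ->
  segint a b (fun t => c * f t) = c * segint a b f.
Proof. by move=> cf; apply: RintegralZl => //; exact: contin_integrable. Qed.

Lemma segint_ext a b f g : (forall t, a <= t <= b -> f t = g t) ->
  segint a b f = segint a b g.
Proof.
by move=> fg; apply: eq_Rintegral => t; rewrite inE /= in_itv /=; exact: fg.
Qed.

Lemma segint_sum a b (I : Type) (r : seq I) (P : pred I) (f : I -> R -> R) :
  (forall i, P i -> contin a b (f i)) ->
  segint a b (fun t => \sum_(i <- r | P i) f i t) =
  \sum_(i <- r | P i) segint a b (f i).
Proof.
move=> cf; elim: r => [|i r ih].
  rewrite big_nil (segint_ext (g := fun=> 0 * 0)); last first.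
    by move=> t _; rewrite big_nil mulr0.
  by rewrite segintZ ?mul0r //; exact: contin_cst.
rewrite big_cons (segint_ext (g := fun t => if P i then
   f i t + \sum_(j <- r | P j) f j t else \sum_(j <- r | P j) f j t)); last first.
  by move=> t _; rewrite big_cons.
case: ifP => // Pi; rewrite segintD ?ih //; first exact: cf.
exact: contin_sum.
Qed.

Lemma segint_FTC (F f : R -> R) a b : a < b -> contin a b f ->
  (forall t, a <= t <= b -> is_derive t (1 : R) F (f t)) ->
  segint a b f = F b - F a.
Proof.
move=> ab cf dF.
have dE t : a <= t <= b -> derivable F t 1.
  by move=> ht; apply: (@ex_derive _ _ _ _ _ _ _ (dF t ht)).
have cF t : a <= t <= b -> {for t, continuous F}.
  by move=> ht; apply/differentiable_continuous/derivable1_diffP; exact: dE.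
rewrite /segint /Rintegral (continuous_FTC2 (F := F)) //.
- exact: contin_within.
- split; first by move=> t; rewrite in_itv /= => /andP[? ?]; apply: dE; rewrite !ltW.
  + by apply: cvg_at_right_filter; apply: cF; rewrite lexx ltW.
  + by apply: cvg_at_left_filter; apply: cF; rewrite lexx ltW.
- move=> t; rewrite in_itv /= => /andP[? ?].
  have ht : a <= t <= b by rewrite !ltW.
  by rewrite derive1E; have [_ ->] := dF t ht.
Qed.

Lemma segint01_le (f : R -> R) (M : R) : contin 0 1 f ->
  (forall t : R, 0 <= t <= 1 -> `|f t| <= M) -> `|segint 0 1 f| <= M.
Proof.
move=> cf fM; have mI : measurable `[(0 : R), 1] by exact: measurable_itv.
apply: (le_trans (le_normr_Rintegral _ (contin_integrable cf))) => //.
have m1 : lebesgue_measure `[(0 : R), 1] = 1%E.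
  by rewrite lebesgue_measure_itv /= lte_fin ltr01 sube0.
have <- : \int[lebesgue_measure]_(t in `[(0:R), 1]) (fun=> M) t = M.
  transitivity (M * fine (lebesgue_measure `[(0 : R), 1])).
    have := Rintegral_cst (@lebesgue_measure R) mI M; apply.
  by rewrite m1 /= mulr1.
apply: le_Rintegral => //.
- exact: (integrable_norm (contin_integrable cf)).
- exact: contin_integrable (@contin_cst _ _ M).
Qed.

End UnitIntegral.

(** * Differentiation under an integral over [0,1] *)

Section ParametricIntegral.
Context {R : realType} {V : normedModType R}.
Variables (fr : frame V) (S : set V) (D : set (V * R)).
Hypotheses (oS : open S) (oD : open D).
Hypothesis SD : forall s (t : R), S s -> 0 <= t <= 1 -> D (s, t).

Lemma cvg_pair_nbhs T (F : set_system T) (FF : Filter F) (A B : topologicalType)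
    (f : T -> A) (g : T -> B) (a : A) (b : B) :
  f @ F --> a -> g @ F --> b -> (f x, g x) @[x --> F] --> (a, b).
Proof. by move=> fa gb; exact: (cvg_pair fa gb). Qed.

Lemma continuous_slice (g : V * R -> R) s t :
  {for (s, t), continuous g} -> {for t, continuous (fun t => g (s, t))}.
Proof.
move=> cg; have c : (s, z) @[z --> t] --> (s, t).
  apply: (@cvg_pair_nbhs _ _ _ _ _ (fun=> s) id); [exact: cvg_cst | exact: cvg_id].
exact: (cvg_comp _ _ c cg).
Qed.

Lemma Cn_contin n g s : Cn n D g -> S s -> contin 0 1 (fun t => g (s, t)).
Proof.
move=> cg Ss t ht; apply: (@continuous_slice g).
apply: differentiable_continuous; exact: Cn_diff cg (SD Ss ht).
Qed.

(** The candidate differential integrates the partial derivatives of [g]. The error is governed by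
    the oscillation of these derivatives between s and nearby parameters, which compactness of [0,1]
    makes small uniformly in t. *)
Lemma param_integral_diff g s : Cn 1 D g -> S s ->
  differentiable (fun s => segint 0 1 (fun t => g (s, t))) s /\
  forall v, 'D_v (fun s => segint 0 1 (fun t => g (s, t))) s =
    segint 0 1 (fun t => 'D_(v, 0) g (s, t)).
Proof.
move=> cg Ss.
pose dg i := 'D_(fvec fr i, 0) g.
have cdg i : Cn 0 D (dg i) by exact: Cn_derive cg.
have dgE v p : D p -> 'D_(v, 0) g p = \sum_i fco fr i v * dg i p.
  move=> Dp; have dgp := Cn_diff cg Dp.
  rewrite deriveE //.
  have -> : (v, 0 : R) = \sum_i fco fr i v *: (fvec fr i, 0 : R).
    rewrite [RHS]surjective_pairing !raddf_sum /= -frameE; congr (_, _).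
    by rewrite big1 // => i _; exact: mulr0.
  rewrite linear_sum; apply: eq_bigr => i _.
  by rewrite linearZ /= /dg (deriveE _ dgp).
pose L : {linear V -> R} := lincomb (fun i => segint 0 1 (fun t => dg i (s, t))).
have LE v : L v = segint 0 1 (fun t => \sum_i fco fr i v * dg i (s, t)).
  rewrite segint_sum; last first.
    move=> i _; apply: continM; first exact: contin_cst.
    exact: Cn_contin (cdg i) Ss.
  by apply: eq_bigr => i _; rewrite segintZ //; exact: Cn_contin (cdg i) Ss.
have [k k0 Hk] := frame_bound fr.
have [dG dGE] : differentiable (fun s => segint 0 1 (fun t => g (s, t))) s /\
    'd (fun s => segint 0 1 (fun t => g (s, t))) s = L :> (V -> R).
  apply: diff_eps; first exact: lincomb_continuous.
  move=> e e0.
  pose n := fdim fr.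
  (* There are [n] coordinates, each at most k|h|, so an oscillation of at most e' costs at most e'
     n k |h|; the added 1 keeps the denominator positive. *)
  pose e' := e / (n%:R * k + 1).
  have nk0 : 0 < n%:R * k + 1.
    by rewrite ltr_wpDl // mulr_ge0 // ltW.
  have e'0 : 0 < e' by rewrite divr_gt0.
  have /compact_near_coveringP cov : compact `[(0 : R), 1] by exact: segment_compact.
  (* Tube argument: each t has a neighbourhood on which all small h work, and compactness makes one
     bound on h serve the whole segment. *)
  have H0 : \forall h \near (0 : V), `[(0 : R), 1] `<=` (fun t => D (h + s, t) /\
      forall i, `|dg i (h + s, t) - dg i (s, t)| <= e').
    apply: (cov V (nbhs (0 : V)) (fun h t => D (h + s, t) /\
      forall i, `|dg i (h + s, t) - dg i (s, t)| <= e')) => t; rewrite /= in_itv /= => ht;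
      have Dst := SD Ss ht.
    have c0 : ((p.2 + s, p.1) : V * R) @[p --> ((t, 0) : R * V)] --> (s, t).
      apply: (@cvg_pair_nbhs _ _ _ _ _ (fun p : R * V => p.2 + s) fst); last exact: cvg_fst.
      rewrite -{2}[s]add0r; apply: cvgD; [exact: cvg_snd | exact: cvg_cst].
    have c1 : ((s, p.1) : V * R) @[p --> ((t, 0) : R * V)] --> (s, t).
      by apply: (@cvg_pair_nbhs _ _ _ _ _ (fun=> s) fst); [exact: cvg_cst | exact: cvg_fst].
    have nD : \forall p \near ((t, 0) : R * V), D (p.2 + s, p.1).
      exact: (c0 _ (open_near oD Dst)).
    have ndg i : \forall p \near ((t, 0) : R * V),
        `|dg i (p.2 + s, p.1) - dg i (s, p.1)| <= e'.
      have cc : {for (s, t), continuous (dg i)}.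
        exact/differentiable_continuous/(Cn_diff (cdg i) Dst).
      have c2 := cvg_comp _ _ c0 cc; have c3 := cvg_comp _ _ c1 cc.
      have FF : Filter (nbhs ((t, 0) : R * V)) by exact: nbhs_filter.
      have c4 : (dg i (p.2 + s, p.1) - dg i (s, p.1)) @[p --> ((t, 0) : R * V)] -->
          dg i (s, t) - dg i (s, t) by exact: cvgB.
      have /cvgrPdist_le/(_ _ e'0) := c4.
      apply: filterS => p; rewrite subrr sub0r normrN; exact.
    have FF : Filter (nbhs ((t, 0) : R * V)) by exact: nbhs_filter.
    have nA := @filter_forall _ _ _ _ FF ndg.
    by have := @filterS2 _ _ FF _ _ _ (fun p a b => conj a b) nD nA; apply: filterS => p.
  have /nbhs_ballP[r /= r0 Hr] := H0.
  near=> h.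
  have hr : `|h| < r.
    by near: h; apply/nbhs_ballP; exists r => // h; rewrite /= -ball_normE /= sub0r normrN.
  have Hc (c t : R) : 0 <= c <= 1 -> 0 <= t <= 1 -> D (s + c *: h, t) /\
      forall i, `|dg i (s + c *: h, t) - dg i (s, t)| <= e'.
    move=> /andP[c0 c1] ht; rewrite addrC.
    apply: (Hr (c *: h)); last by rewrite /= in_itv.
    rewrite -ball_normE /= sub0r normrN normrZ ger0_norm //.
    by apply: le_lt_trans hr; rewrite ler_piMl.
  have gh : contin 0 1 (fun t => g (h + s, t)).
    move=> t ht; apply: (@continuous_slice g).
    apply: differentiable_continuous; apply: (Cn_diff cg).
    by have [] := Hc 1 t _ ht; rewrite ?scale1r ?ler01 ?lexx // addrC.
  have cL : contin 0 1 (fun t => \sum_i fco fr i h * dg i (s, t)).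
    apply: contin_sum => i _; apply: continM; first exact: contin_cst.
    exact: Cn_contin (cdg i) Ss.
  have cs : contin 0 1 (fun t => g (s, t)) by exact: Cn_contin cg Ss.
  have E : segint 0 1 (fun t => g (h + s, t)) - segint 0 1 (fun t => g (s, t)) - L h
    = segint 0 1 (fun t => g (h + s, t) + -1 * (g (s, t) +
        \sum_i fco fr i h * dg i (s, t))).
    rewrite LE segintD // ?segintZ ?segintD //; last 2 first.
      exact: continD.
      by apply: continM; [exact: contin_cst | exact: continD].
    by rewrite mulN1r opprD addrA.
  rewrite E; apply: segint01_le.
    by apply: continD => //; apply: continM; [exact: contin_cst | exact: continD].
  move=> t ht.
  (* The intermediate point depends on t in an uncontrolled way; only a pointwise bound on the
     integrand is drawn from it. *)
  have [c hc Ec] : exists2 c, c \in `]0, 1[ &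
      g (s + 1 *: h, t) - g (s + 0 *: h, t) =
      'D_(h, 0) g (s + c *: h, t) * (1 - 0).
    have dl (z : R) : 0 <= z <= 1 -> is_derive z (1 : R) (fun z : R => g (s + z *: h, t))
        ('D_(h, 0) g (s + z *: h, t)).
      move=> hz; have [Dz _] := Hc z t hz ht.
      have pE (y : R) : ((s, t) : V * R) + y *: ((h, 0) : V * R) = (s + y *: h, t).
        by transitivity (s + y *: h, t + y * 0); rewrite // mulr0 addr0.
      have lE : (fun z : R => g (s + z *: h, t)) =
          (fun z : R => g (((s, t) : V * R) + z *: ((h, 0) : V * R))).
        by apply/funext => y; rewrite pE.
      rewrite lE -pE; apply: is_derive_line; apply: diff_derivable; rewrite pE.
      exact: Cn_diff cg Dz.
    apply: (@MVT R (fun z : R => g (s + z *: h, t))) => //.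
      by move=> z; rewrite in_itv /= => /andP[? ?]; apply: dl; rewrite !ltW.
    apply: derivable_within_continuous => z; rewrite in_itv /= => hz.
    exact: (@ex_derive _ _ _ _ _ _ _ (dl z hz)).
  have {}hc : 0 <= c <= 1 by move: hc; rewrite in_itv /= => /andP[? ?]; rewrite !ltW.
  have [Dc Hdg] := Hc c t hc ht.
  have -> : g (h + s, t) + -1 * (g (s, t) + \sum_i fco fr i h * dg i (s, t)) =
      \sum_i fco fr i h * (dg i (s + c *: h, t) - dg i (s, t)).
    move: Ec; rewrite scale1r scale0r addr0 subr0 mulr1 (dgE _ _ Dc) [s + h]addrC.
    move=> /eqP; rewrite subr_eq => /eqP ->.
    transitivity (\sum_i fco fr i h * dg i (s + c *: h, t) -
      \sum_i fco fr i h * dg i (s, t)); first by ring.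
    by rewrite -sumrB; apply: eq_bigr => i _; rewrite mulrBr.
  apply: (le_trans (ler_norm_sum _ _ _)).
  have : \sum_(i < n) `|fco fr i h * (dg i (s + c *: h, t) - dg i (s, t))| <=
      \sum_(i < n) (k * `|h|) * e'.
    by apply: ler_sum => i _; rewrite normrM; apply: ler_pM.
  move/le_trans; apply.
  rewrite sumr_const card_ord -[X in X <= _]mulr_natl.
  have -> : n%:R * (k * `|h| * e') = (e' * (n%:R * k)) * `|h| by ring.
  apply: ler_wpM2r => //; rewrite /e' mulrAC ler_pdivrMr // ler_wpM2l ?ltW //.
  by rewrite ltrDl.
split=> // v; rewrite deriveE // dGE LE; apply: segint_ext => t ht.
by rewrite dgE //; exact: SD.
Unshelve. all: by end_near. Qed.

(** Differentiating under the integral needs continuous derivatives of [g], obtained here from their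
    differentiability; hence the shift from [n.+1] to [n]. *)
Lemma param_integral_Cn n g : Cn n.+1 D g ->
  Cn n S (fun s => segint 0 1 (fun t => g (s, t))).
Proof.
elim: n g => [|n ih] g cg.
  by split=> // s Ss; have [] := param_integral_diff cg Ss.
have c1 : Cn 1 D g by exact: CnW cg.
split=> [s Ss|v]; first by have [] := param_integral_diff c1 Ss.
apply: (Cn_ext (f := fun s => segint 0 1 (fun t => 'D_(v, 0) g (s, t)))) => //.
  by move=> s Ss; have [_ ->] := param_integral_diff c1 Ss.
by apply: (ih ('D_(v, 0) g)); exact: Cn_derive cg.
Qed.

Lemma smooth_on_param_integral g : smooth_on D g ->
  smooth_on S (fun s => segint 0 1 (fun t => g (s, t))).
Proof.
move=> /smooth_onP cg; apply/smooth_onP => n; exact: param_integral_Cn (cg n.+1).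
Qed.

Lemma derive_param_integral g s v : smooth_on D g -> S s ->
  'D_v (fun s => segint 0 1 (fun t => g (s, t))) s =
    segint 0 1 (fun t => 'D_(v, 0) g (s, t)).
Proof. by move=> /smooth_onP cg Ss; have [_ ->] := param_integral_diff (cg 1%N) Ss. Qed.

End ParametricIntegral.

(** * Smooth families of functions of one variable *)

Section Families.
Context {R : realType}.
Implicit Types V W : normedModType R.

Lemma open_setX (T U : topologicalType) (A : set T) (B : set U) :
  open A -> open B -> open (A `*` B).
Proof.
move=> oA oB; rewrite openE => -[a b] [/= Aa Bb].
by exists (A, B) => //; split; exact: open_nbhs_nbhs.
Qed.

Lemma open_setXT (T U : topologicalType) (A : set T) : open A ->
  open (A `*` [set: U]).
Proof. by move=> oA; apply: open_setX => //; exact: openT. Qed.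

Definition sm (f : R -> R) := smooth_on setT f.

Definition sfam V (S : set V) (f : V -> R -> R) :=
  smooth_on (S `*` setT) (fun p : V * R => f p.1 p.2).

(** The iterated derivatives do not depend on the set, so smoothness is a condition at one point at
    a time, and each point may use its own set. *)
Lemma smooth_on_near V (A : set V) (f : V -> R) :
  (forall x, A x -> exists2 B, B x & smooth_on B f) -> smooth_on A f.
Proof. by move=> h vs x /h[B Bx sf]; exact: sf. Qed.

Lemma smooth_on_pair V W1 W2 (f1 : frame W1) (f2 : frame W2) (A : set V)
    (g1 : V -> W1) (g2 : V -> W2) :
  (forall j, smooth_on A (fun y => fco f1 j (g1 y))) ->
  (forall j, smooth_on A (fun y => fco f2 j (g2 y))) ->
  forall i, smooth_on A (fun y => fco (pair_frame f1 f2) i (g1 y, g2 y)).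
Proof.
move=> s1 s2 i; rewrite /= /pair_co; case: fintype.split => j; [exact: s1|exact: s2].
Qed.

Lemma smooth_on_fst V W (fV : frame V) (A : set (V * W)) j :
  smooth_on A (fun p => fco fV j p.1).
Proof.
apply: (@smooth_on_linear _ _ A (fco fV j \o fst)) => x.
apply: (@continuous_comp _ _ _ (@fst V W)); first exact: cvg_fst.
exact: fco_cont.
Qed.

Lemma smooth_on_snd V W (fW : frame W) (A : set (V * W)) j :
  smooth_on A (fun p => fco fW j p.2).
Proof.
apply: (@smooth_on_linear _ _ A (fco fW j \o snd)) => x.
apply: (@continuous_comp _ _ _ (@snd V W)); first exact: cvg_snd.
exact: fco_cont.
Qed.

Lemma smooth_on_sndR V (A : set (V * R)) : smooth_on A (@snd V R).
Proof. exact: (@smooth_on_snd V R real_frame A ord0). Qed.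

Lemma smooth_on_fstR V (A : set (R * V)) : smooth_on A (@fst R V).
Proof. exact: (@smooth_on_fst R V real_frame A ord0). Qed.

Lemma derive1_slice V (f : V -> R -> R) s x :
  derive1 (f s) x = 'D_(0, 1) (fun p : V * R => f p.1 p.2) (s, x).
Proof.
rewrite derive1E /derive; apply: (congr1 (fun f : R -> R => lim (f @ 0^'))); apply/funext => h /=.
by rewrite scaler0 add0r.
Qed.

Lemma derive_slice V (f : V -> R -> R) v s x :
  'D_v (f^~ x) s = 'D_(v, 0) (fun p : V * R => f p.1 p.2) (s, x).
Proof.
rewrite /derive; apply: (congr1 (fun f : R -> R => lim (f @ 0^'))); apply/funext => h /=.
by congr (_ *: (f _ _ - _)); rewrite [_ *: 0]mulr0 add0r.
Qed.

Section Fixed.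
Variables (V : normedModType R) (S : set V) (oS : open S).

Let oST : open (S `*` [set: R]) := open_setXT oS.

Lemma sfam_ext f g : (forall s x, S s -> f s x = g s x) -> sfam S f -> sfam S g.
Proof.
move=> fg; apply: smooth_on_ext => //; by move=> [s x] [/= Ss _]; exact: fg.
Qed.

Lemma sfam_cst c : sfam S (fun _ _ => c).
Proof. exact: smooth_on_cst. Qed.

Lemma sfamD f g : sfam S f -> sfam S g -> sfam S (fun s x => f s x + g s x).
Proof. exact: smooth_onD. Qed.

Lemma sfamM f g : sfam S f -> sfam S g -> sfam S (fun s x => f s x * g s x).
Proof. exact: smooth_onM. Qed.


Lemma sfamB f g : sfam S f -> sfam S g -> sfam S (fun s x => f s x - g s x).
Proof. exact: smooth_onB. Qed.

Lemma sfam_sum (I : Type) (r : seq I) (P : pred I) (f : I -> V -> R -> R) :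
  (forall i, P i -> sfam S (f i)) ->
  sfam S (fun s x => \sum_(i <- r | P i) f i s x).
Proof.
exact: (smooth_on_sum _ (f := fun i (p : V * R) => f i p.1 p.2)).
Qed.

Lemma sfam_derive1 f : sfam S f -> sfam S (fun s x => derive1 (f s) x).
Proof.
move=> sf; have := smooth_on_derive ((0, 1) : V * R) sf; apply: smooth_on_ext => // -[s x] _.
by rewrite -derive1_slice.
Qed.

Lemma sfam_derive v f : sfam S f -> sfam S (fun s x => 'D_v (f^~ x) s).
Proof.
move=> sf; have := smooth_on_derive ((v, 0) : V * R) sf; apply: smooth_on_ext => // -[s x] _.
by rewrite -derive_slice.
Qed.

(** In the joint variable (s, x) these are the derivatives along (v, 0) and (0, 1), which
    commute. *)
Lemma derive_derive1 v f s x : sfam S f -> S s ->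
  'D_v (fun s => derive1 (f s) x) s = derive1 (fun x => 'D_v (f^~ x) s) x.
Proof.
move=> sf Ss; rewrite (derive_slice (fun s x => derive1 (f s) x)).
rewrite (derive1_slice (fun s x => 'D_v (f^~ x) s)).
under eq_fun do rewrite derive1_slice.
under [in RHS]eq_fun do rewrite derive_slice.
rewrite (_ : (fun p : V * R => 'D_(0, 1) (fun p => f p.1 p.2) (p.1, p.2)) =
  'D_(0, 1) (fun p => f p.1 p.2)); last by apply/funext => -[].
rewrite [in RHS](_ : (fun p : V * R => 'D_(v, 0) (fun p => f p.1 p.2) (p.1, p.2)) =
  'D_(v, 0) (fun p => f p.1 p.2)); last by apply/funext => -[].
by apply: (smooth_on_derive_derive _ _ oST _ sf).
Qed.

End Fixed.

Lemma smooth_on_co V (fr : frame V) (A : set V) j : smooth_on A (fco fr j).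
Proof. by apply: smooth_on_linear; exact: fco_cont. Qed.

Lemma sm_id : sm id.
Proof. exact: (@smooth_on_linear _ _ _ idfun idfun_continuous). Qed.

Lemma sfam_slice V (fr : frame V) (S : set V) f s :
  sfam S f -> S s -> sm (f s).
Proof.
move=> sf Ss.
apply: (smooth_on_comp (fr := pair_frame fr real_frame) (g := fun x => (s, x)) openT
  _ sf) => //.
apply: smooth_on_pair => j; first exact: smooth_on_cst.
exact: sm_id.
Qed.

Lemma smooth_slice V (fr : frame V) (S : set V) f x : open S ->
  sfam S f -> smooth_on S (f^~ x).
Proof.
move=> oS sf.
apply: (smooth_on_comp (fr := pair_frame fr real_frame) (g := fun s => (s, x)) oS
  _ sf) => //.
apply: smooth_on_pair => j; first exact: smooth_on_co.
exact: smooth_on_cst.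
Qed.

Lemma sm_diff f x : sm f -> differentiable f x.
Proof. by move=> sf; exact: (smooth_on_diff sf). Qed.

Lemma sm_derivable f x : sm f -> derivable f x 1.
Proof. by move=> sf; apply/derivable1_diffP; exact: sm_diff. Qed.

Lemma sm_continuous f x : sm f -> {for x, continuous f}.
Proof. by move=> sf; exact: (smooth_on_continuous sf). Qed.

Lemma sm_is_derive f x : sm f -> is_derive x (1 : R) f (derive1 f x).
Proof. by move=> sf; rewrite derive1E; apply: derivableP; exact: sm_derivable. Qed.

Lemma sm_derive1 f : sm f -> sm (derive1 f).
Proof.
move=> sf; have := smooth_on_derive (1 : R) sf.
apply: smooth_on_ext => [|x _]; first exact: openT.
by rewrite derive1E.
Qed.

Lemma smD f g : sm f -> sm g -> sm (fun x => f x + g x).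
Proof. by apply: smooth_onD; exact: openT. Qed.

Lemma smM f g : sm f -> sm g -> sm (fun x => f x * g x).
Proof. by apply: smooth_onM; exact: openT. Qed.

Lemma smN f : sm f -> sm (fun x => - f x).
Proof. by apply: smooth_onN; exact: openT. Qed.

Lemma sm_cst (c : R) : sm (fun=> c).
Proof. exact: smooth_on_cst. Qed.

Lemma sm_sum (I : Type) (r : seq I) (P : pred I) (f : I -> R -> R) :
  (forall i, P i -> sm (f i)) -> sm (fun x => \sum_(i <- r | P i) f i x).
Proof. by apply: smooth_on_sum; exact: openT. Qed.

Lemma derive1D f g x : sm f -> sm g ->
  derive1 (fun x => f x + g x) x = derive1 f x + derive1 g x.
Proof.
by move=> sf sg; rewrite !derive1E derive_add //; exact: sm_diff.
Qed.

Lemma derive1M f g x : sm f -> sm g ->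
  derive1 (fun x => f x * g x) x = derive1 f x * g x + f x * derive1 g x.
Proof.
by move=> sf sg; rewrite !derive1E derive_mul //; exact: sm_diff.
Qed.

Lemma derive_big V (I : Type) (r : seq I) (P : pred I) (f : I -> V -> R) v x :
  (forall i, P i -> differentiable (f i) x) ->
  'D_v (fun x => \sum_(i <- r | P i) f i x) x = \sum_(i <- r | P i) 'D_v (f i) x
  /\ differentiable (fun x => \sum_(i <- r | P i) f i x) x.
Proof.
move=> df; elim: r => [|i r [ih1 ih2]].
  have -> : (fun x => \sum_(i <- [::] | P i) f i x) = cst 0.
    by apply/funext => y; rewrite big_nil.
  by rewrite big_nil derive_cst; split=> //; exact: differentiable_cst.
have E : (fun x => \sum_(i <- i :: r | P i) f i x) = (fun x => if P i then
    f i x + \sum_(i <- r | P i) f i x else \sum_(i <- r | P i) f i x).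
  by apply/funext => y; rewrite big_cons.
rewrite E big_cons; case: ifP => // Pi.
by rewrite derive_add ?ih1 //; [split=> //; apply: differentiable_add => //|];
   exact: df.
Qed.

Lemma derive1_sum (I : Type) (r : seq I) (P : pred I) (f : I -> R -> R) x :
  (forall i, P i -> sm (f i)) ->
  derive1 (fun x => \sum_(i <- r | P i) f i x) x =
    \sum_(i <- r | P i) derive1 (f i) x.
Proof.
move=> sf; rewrite derive1E (proj1 (derive_big _ _ _)).
  by apply: eq_bigr => i _; rewrite derive1E.
by move=> i Pi; apply: sm_diff; exact: sf.
Qed.

(* x * int_0^1 f(t x) dt: integrating over a fixed segment makes smoothness in x
   a case of smoothness of parameter integrals. *)
Definition prim (f : R -> R) (x : R) := x * segint 0 1 (fun t => f (t * x)).

Lemma prim0 f : prim f 0 = 0.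
Proof. by rewrite /prim mul0r. Qed.

Lemma scaled_sfam V (fr : frame V) (S : set V) f : open S -> sfam S f ->
  smooth_on ((S `*` [set: R]) `*` [set: R])
    (fun p : (V * R) * R => f p.1.1 (p.2 * p.1.2)).
Proof.
move=> oS sf.
have oSTT : open ((S `*` [set: R]) `*` [set: R]) by do 2 apply: open_setXT.
apply: (smooth_on_comp (fr := pair_frame fr real_frame)
  (g := fun p : (V * R) * R => (p.1.1, p.2 * p.1.2)) oSTT _ sf).
  by move=> [[s x] t] [/= [/= Ss _] _].
apply: smooth_on_pair => j.
  apply: (@smooth_on_linear _ _ _ (fco fr j \o fst \o fst)) => p.
  apply: (@continuous_comp _ _ _ (@fst V R \o @fst (V * R)%type R)).
    by apply: continuous_comp; exact: cvg_fst.
  exact: fco_cont.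
apply: smooth_onM => //.
   exact: smooth_on_sndR.
apply: (@smooth_on_linear _ _ _ ((idfun \o snd) \o fst)) => p.
by apply: (@continuous_comp _ _ _ (@fst (V * R)%type R)); [exact: cvg_fst|exact: cvg_snd].
Qed.

Lemma sfam_prim V (fr : frame V) (S : set V) f : open S -> sfam S f ->
  sfam S (fun s => prim (f s)).
Proof.
move=> oS sf; rewrite /sfam /prim; apply: smooth_onM; first exact: open_setXT.
  exact: smooth_on_sndR.
apply: (smooth_on_param_integral (pair_frame fr real_frame) _ _ _ (scaled_sfam fr oS sf)).
- exact: open_setXT.
- by do 2 apply: open_setXT.
- by move=> [s x] t [/= Ss _] _.
Qed.

Lemma derive_prim V (fr : frame V) (S : set V) f v s x : open S -> sfam S f ->
  S s -> 'D_v (fun s => prim (f s) x) s = prim (fun y => 'D_v (f^~ y) s) x.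
Proof.
move=> oS sf Ss; rewrite /prim.
have sg : smooth_on (S `*` [set: R]) (fun p : V * R => f p.1 (p.2 * x)).
  apply: (smooth_on_comp (fr := pair_frame fr real_frame)
    (g := fun p : V * R => (p.1, p.2 * x)) (open_setXT oS) _ sf).
    by move=> [s' t'] [].
  apply: smooth_on_pair => j; first exact: smooth_on_fst.
  apply: smooth_onM; first exact: open_setXT.
    exact: smooth_on_sndR.
  exact: smooth_on_cst.
have ST s' (t : R) : S s' -> 0 <= t <= 1 -> (S `*` [set: R]) (s', t) by [].
rewrite derive_mul; [|exact: differentiable_cst|]; last first.
  exact: (smooth_on_diff (smooth_on_param_integral fr oS (open_setXT oS) ST sg)).
rewrite derive_cst mul0r add0r; congr (_ * _).
transitivity (segint 0 1 (fun t => 'D_(v, 0) (fun p : V * R => f p.1 (p.2 * x)) (s, t))).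
  exact: (derive_param_integral fr (open_setXT oS) ST v sg Ss).
by apply: segint_ext => t _; rewrite -(derive_slice (fun s t => f s (t * x))).
Qed.

(** Differentiation under the integral gives int_0^1 (f(tx) + t x f'(tx)) dt, whose integrand is the
    t-derivative of t f(tx). *)
Lemma is_derive_prim f x : sm f -> is_derive x (1 : R) (prim f) (f x).
Proof.
move=> sf.
have sF : sfam [set: R] (fun _ : R => f).
  apply: (smooth_on_comp (fr := real_frame) (B := [set: R])
    (g := fun p : R * R => p.2)) => //; first exact: open_setXT openT.
  by move=> j; exact: smooth_on_snd.
have sp : sm (prim f) by exact: (sfam_slice real_frame (sfam_prim real_frame openT sF) (s := 0)).
suff <- : derive1 (prim f) x = f x by exact: sm_is_derive.
have sg : smooth_on [set: R * R] (fun p : R * R => f (p.2 * p.1)).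
  apply: (smooth_on_comp (fr := real_frame) (B := [set: R])
    (g := fun p : R * R => p.2 * p.1)) => //; first exact: openT.
  move=> j; apply: smooth_onM; first exact: openT.
    exact: smooth_on_sndR.
  exact: smooth_on_fstR.
have ST (s' : R) (t : R) : [set: R] s' -> 0 <= t <= 1 -> [set: R * R] (s', t) by [].
have spi := smooth_on_param_integral real_frame openT openT ST sg.
rewrite derive1E /prim derive_mul; [|exact: (sm_diff _ sm_id)|exact: (smooth_on_diff spi)].
rewrite derive_id mul1r.
have lin (c y : R) : is_derive y (1 : R) (fun z => c * z) c.
  have := @is_deriveZ R R R id c y 1 1 (is_derive_id y 1).
  by rewrite [c *: 1]mulr1.
have dE t : 'D_(1, 0) (fun p : R * R => f (p.2 * p.1)) (x, t) = t * derive1 f (t * x).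
  rewrite -(derive_slice (fun s t => f (t * s))) -derive1E.
  have [_ e] := is_derive1_comp (f := f) (sm_is_derive (t * x) sf) (lin t x).
  by rewrite derive1E mulrC -e.
have lt_mul : (fun t => t * x) = (fun t => x * t) by apply/funext => z; rewrite mulrC.
have ct (h : R -> R) : sm h -> contin 0 1 (fun t => h (t * x)).
  move=> sh t _.
  have c1 : z * x @[z --> t] --> t * x by apply: cvgM; [exact: cvg_id | exact: cvg_cst].
  exact: (cvg_comp _ _ c1 (@sm_continuous h (t * x) sh)).
have -> : 'D_1 (fun x => segint 0 1 (fun t => f (t * x))) x =
    segint 0 1 (fun t => t * derive1 f (t * x)).
  rewrite [LHS](derive_param_integral real_frame openT ST 1 sg) //.
  by apply: segint_ext => t _; exact: dE.
have cd : contin 0 1 (fun t => t * derive1 f (t * x)).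
  apply: continM; first by move=> t _; exact: cvg_id.
  by apply: ct; exact: sm_derive1.
have cs : contin 0 1 (fun t => f (t * x)) by exact: ct.
rewrite -segintZ // -segintD //; last first.
  by apply: continM; first exact: contin_cst.
transitivity (1 * f (1 * x) - 0 * f (0 * x)); last by rewrite !mul1r mul0r subr0.
apply: (@segint_FTC R (fun t => t * f (t * x))) => //.
  by apply: continD => //; apply: continM; first exact: contin_cst.
move=> t _.
have dft : is_derive t (1 : R) (fun t => f (t * x)) (derive1 f (t * x) * x).
  by apply: is_derive1_comp; [exact: sm_is_derive | rewrite lt_mul; exact: lin].
have [a b] := @is_deriveM R R id (fun t => f (t * x)) t 1 _ _ (is_derive_id t 1) dft.
split; first exact: a.
rewrite [LHS]b /= [_ *: 1]mulr1 addrC; congr (_ + _).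
by rewrite [RHS]mulrC -mulrA; congr (_ * _); rewrite mulrC.
Qed.

End Families.

(** * Test functions and the antiderivative *)

Section LineIntegral.
Context {R : realType}.
Implicit Types f g F G : R -> R.

Definition supp (A : R) f := forall x, A <= `|x| -> f x = 0.

Definition tst f := sm f /\ exists A, supp A f.

Definition lint f : R := \int[lebesgue_measure]_x f x.

Lemma suppW A B f : A <= B -> supp A f -> supp B f.
Proof. by move=> AB sf x Bx; apply: sf; exact: le_trans Bx. Qed.

Lemma tst_supp f : tst f -> exists2 A, 0 < A & supp A f.
Proof.
case=> _ [A sA]; exists (`|A| + 1); first by rewrite ltr_wpDl.
by apply: suppW sA; apply: (le_trans (ler_norm A)); rewrite lerDl.
Qed.

Section Antiderivative.
Variables (f F : R -> R) (A : R).
Hypotheses (sf : sm f) (A0 : 0 < A) (sA : supp A f).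
Hypothesis dF : forall x, is_derive x (1 : R) F (f x).

Lemma segint_antiderivative a b : a <= b -> segint a b f = F b - F a.
Proof.
rewrite le_eqVlt => /predU1P[->|ab]; last first.
  by apply: segint_FTC => // t _; exact: sm_continuous.
by rewrite subrr /segint set_itv1 Rintegral_set1.
Qed.

Lemma antiderivative_right x : A <= x -> F x = F A.
Proof.
move=> Ax; apply/eqP; rewrite -subr_eq0 -segint_antiderivative //.
rewrite (@segint_ext _ _ _ _ (fun=> 0 * 0)); last first.
  move=> t /andP[At _]; rewrite mulr0 sA //; exact: le_trans (ler_norm _).
by rewrite segintZ ?mul0r //; exact: contin_cst.
Qed.

Lemma antiderivative_left x : x <= - A -> F x = F (- A).
Proof.
move=> Ax; apply/esym/eqP; rewrite -subr_eq0 -segint_antiderivative //.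
rewrite (@segint_ext _ _ _ _ (fun=> 0 * 0)); last first.
  move=> t /andP[_ At]; rewrite mulr0 sA //; rewrite -normrN.
  by apply: le_trans (ler_norm _); rewrite lerNr.
by rewrite segintZ ?mul0r //; exact: contin_cst.
Qed.

(** Where [f] is 0, membership in [D] is irrelevant. This reduces half-lines and the whole line to a
    segment, with no improper limits. *)
Lemma Rintegral_supp (D : set R) a b : a <= b ->
  (forall t, f t != 0 -> D t <-> a <= t <= b) ->
  \int[lebesgue_measure]_(t in D) f t = F b - F a.
Proof.
move=> ab H; rewrite -segint_antiderivative // /segint.
rewrite Rintegral_mkcond [RHS]Rintegral_mkcond; congr Rintegral.
apply/funext => t; rewrite /patch.
have [f0|/H Dt] := eqVneq (f t) 0; first by rewrite f0 !if_same.
by congr (if _ then _ else _); apply/idP/idP; rewrite !inE /= in_itv /= => /Dt.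
Qed.

Lemma lint_antiderivative : lint f = F A - F (- A).
Proof.
apply: Rintegral_supp; first by have := A0; lra.
move=> t ft; split=> // _; have : `|t| < A.
  by rewrite ltNge; apply: contra ft => /sA ->.
by rewrite ltr_norml => /andP[? ?]; rewrite !ltW.
Qed.

(** Subtracting the mean of the two limit values makes the far left and far right values of [dinv f]
    opposite; the skewness of [dinv] rests on this. *)
Lemma dinv_antiderivative x : Defs.dinv f x = F x - 2^-1 * (F A + F (- A)).
Proof.
(* The segment from - B to B contains both x and the support, so both half-lines can be cut at its
   ends. *)
pose B := `|x| + A.
have xB : `|x| <= B by rewrite lerDl ltW.
have AB : A <= B by rewrite lerDr.
have Bx : x <= B by apply: le_trans xB; exact: ler_norm.
have Bx' : - B <= x by rewrite lerNl; apply: le_trans xB; rewrite -normrN ler_norm.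
have ftB t : f t != 0 -> - B <= t <= B.
  move=> ft; have : `|t| < A by rewrite ltNge; apply: contra ft => /sA ->.
  by rewrite ltr_norml => /andP[? ?]; apply/andP; split; lra.
rewrite /Defs.dinv (@Rintegral_supp _ (- B) x) //; last first.
  by move=> t /ftB/andP[h1 h2]; rewrite /= in_itv /= h1.
rewrite (@Rintegral_supp _ x B) //; last first.
  by move=> t /ftB/andP[h1 h2]; rewrite /= in_itv /= h2 andbT.
by rewrite (@antiderivative_right B) // (@antiderivative_left (- B)) ?lerN2 //; field.
Qed.

End Antiderivative.

Lemma tstP f : tst f -> exists A F, [/\ 0 < A, supp A f &
  forall x, is_derive x (1 : R) F (f x)].
Proof.
move=> tf; have [A A0 sA] := tst_supp tf; exists A, (prim f); split=> // x.
by apply: is_derive_prim; case: tf.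
Qed.

Lemma tstD f g : tst f -> tst g -> tst (fun x => f x + g x).
Proof.
move=> [sf [A sA]] [sg [B sB]]; split; first exact: smD.
exists (Num.max A B) => x; rewrite ge_max => /andP[Ax Bx].
by rewrite sA // sB // addr0.
Qed.

Lemma tstMl f g : sm f -> tst g -> tst (fun x => f x * g x).
Proof.
move=> sf [sg [A sA]]; split; first exact: smM.
by exists A => x /sA ->; rewrite mulr0.
Qed.

Lemma tstMr f g : tst f -> sm g -> tst (fun x => f x * g x).
Proof.
move=> [sf [A sA]] sg; split; first exact: smM.
by exists A => x /sA ->; rewrite mul0r.
Qed.

Lemma tst0 : tst (fun=> 0).
Proof. by split; [exact: sm_cst | exists 0]. Qed.

Lemma tstN f : tst f -> tst (fun x => - f x).
Proof.
by move=> [sf [A sA]]; split; [exact: smN | exists A => x /sA ->; rewrite oppr0].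
Qed.

Lemma eq_tst f g : f =1 g -> tst f -> tst g.
Proof. by move=> /funext ->. Qed.

Lemma tst_sum (I : Type) (r : seq I) (P : pred I) (f : I -> R -> R) :
  (forall i, P i -> tst (f i)) -> tst (fun x => \sum_(i <- r | P i) f i x).
Proof.
move=> tf; elim: r => [|i r ih].
  by apply: (eq_tst _ tst0) => x; rewrite big_nil.
case: (boolP (P i)) => Pi.
  by apply: (eq_tst _ (tstD (tf i Pi) ih)) => x; rewrite big_cons Pi.
by apply: (eq_tst _ ih) => x; rewrite big_cons (negbTE Pi).
Qed.

(** The margin of 1 puts x in the open set |y| > A, on which [f] is 0; at |x| = A itself a
    neighbourhood would be missing. *)
Lemma supp_derive1 A f : supp A f -> supp (A + 1) (derive1 f).
Proof.
move=> sA x Ax; rewrite derive1E.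
rewrite (@eq_on_derive _ _ [set y | A < `|y|] _ (fun=> 0)) ?derive_cst //.
- apply: (@open_comp _ _ (fun y : R => `|y|) [set z | A < z]); last exact: open_gt.
  by move=> y _; exact: norm_continuous.
- by apply: lt_le_trans Ax; rewrite ltrDl.
- by move=> y /ltW/sA.
Qed.

Lemma tst_derive1 f : tst f -> tst (derive1 f).
Proof.
move=> tf; have [A A0 sA] := tst_supp tf; have [sf _] := tf.
by split; [exact: sm_derive1 | exists (A + 1); exact: supp_derive1].
Qed.

Lemma lintD f g : tst f -> tst g ->
  lint (fun x => f x + g x) = lint f + lint g.
Proof.
move=> tf tg; have [A [F [A0 sA dF]]] := tstP tf; have [B [G [B0 sB dG]]] := tstP tg.
have [sf _] := tf; have [sg _] := tg.
have mA : A <= Num.max A B by rewrite le_max lexx.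
have mB : B <= Num.max A B by rewrite le_max lexx orbT.
have m0 : 0 < Num.max A B by exact: lt_le_trans mA.
rewrite (@lint_antiderivative f F (Num.max A B)) //; last exact: suppW sA.
rewrite (@lint_antiderivative g G (Num.max A B)) //; last exact: suppW sB.
rewrite (@lint_antiderivative _ (fun x => F x + G x) (Num.max A B)) //.
- by ring.
- exact: smD.
- by move=> x hx; rewrite (suppW mA sA) // (suppW mB sB) // addr0.
Qed.

Lemma lintZ c f : tst f -> lint (fun x => c * f x) = c * lint f.
Proof.
move=> tf; have [A [F [A0 sA dF]]] := tstP tf; have [sf _] := tf.
rewrite (@lint_antiderivative f F A) //.
rewrite (@lint_antiderivative _ (fun x => c * F x) A) //.
- by ring.
- by apply: smM => //; exact: sm_cst.
- by move=> x hx; rewrite sA // mulr0.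
Qed.

Lemma lintN f : tst f -> lint (fun x => - f x) = - lint f.
Proof.
by move=> tf; rewrite -mulN1r -lintZ //; congr lint; apply/funext => x; rewrite mulN1r.
Qed.

Lemma lintB f g : tst f -> tst g ->
  lint (fun x => f x - g x) = lint f - lint g.
Proof. by move=> tf tg; rewrite -lintN // -lintD //; exact: tstN. Qed.

Lemma lint0 : lint (fun=> 0) = 0.
Proof.
rewrite -[RHS](mul0r (lint (fun=> 0))) -lintZ; last exact: tst0.
by congr lint; apply/funext => x; rewrite mul0r.
Qed.

Lemma lint_sum (I : Type) (r : seq I) (P : pred I) (f : I -> R -> R) :
  (forall i, P i -> tst (f i)) ->
  lint (fun x => \sum_(i <- r | P i) f i x) = \sum_(i <- r | P i) lint (f i).
Proof.
move=> tf; elim: r => [|i r ih].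
  by rewrite big_nil -[RHS]lint0; congr lint; apply/funext => x; rewrite big_nil.
rewrite big_cons; case: (boolP (P i)) => Pi.
  rewrite -ih -lintD; [|exact: tf|exact: tst_sum].
  by congr lint; apply/funext => x; rewrite big_cons Pi.
by rewrite -ih; congr lint; apply/funext => x; rewrite big_cons (negbTE Pi).
Qed.

Lemma lint_derive1 f : tst f -> lint (derive1 f) = 0.
Proof.
move=> tf; have [A A0 sA] := tst_supp tf; have [B B0 sB] := tst_supp (tst_derive1 tf).
have [sf _] := tf; have mA : A <= Num.max A B by rewrite le_max lexx.
have mB : B <= Num.max A B by rewrite le_max lexx orbT.
have m0 : 0 < Num.max A B by exact: lt_le_trans mA.
rewrite (@lint_antiderivative _ f (Num.max A B) _ _ _ (fun x => sm_is_derive x sf)) //.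
- rewrite !sA ?subr0 // ?normrN ger0_norm //; exact: ltW.
- exact: sm_derive1.
- exact: suppW sB.
Qed.

Lemma lint_by_parts f g : tst f -> sm g ->
  lint (fun x => f x * derive1 g x) = - lint (fun x => derive1 f x * g x).
Proof.
move=> tf sg; have [sf _] := tf; apply/eqP; rewrite -subr_eq0 opprK addrC -lintD.
- rewrite -(lint_derive1 (tstMr tf sg)); apply/eqP; congr lint.
  by apply/funext => x; rewrite derive1M.
- by apply: tstMr => //; exact: tst_derive1.
- by apply: tstMr => //; exact: sm_derive1.
Qed.

Lemma is_derive_dinv f x : tst f -> is_derive x (1 : R) (Defs.dinv f) (f x).
Proof.
move=> tf; have [A [F [A0 sA dF]]] := tstP tf; have [sf _] := tf.
have -> : Defs.dinv f = fun x => F x - 2^-1 * (F A + F (- A)).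
  by apply/funext => y; exact: dinv_antiderivative.
have := @is_deriveB R R R F (cst (2^-1 * (F A + F (- A)))) x 1 (f x) 0 (dF x)
  (is_derive_cst _ _ _).
by rewrite subr0.
Qed.

(** The first derivative along v is [v * f], so all further ones are those of a smooth function. *)
Lemma sm_dinv f : tst f -> sm (Defs.dinv f).
Proof.
move=> tf; have [sf _] := tf => vs; case: vs => [x _|v vs x _].
  by apply/derivable1_diffP; exact: (@ex_derive _ _ _ _ _ _ _ (is_derive_dinv x tf)).
have -> : iter_derive (v :: vs) (Defs.dinv f) = iter_derive vs (fun x => v * f x).
  rewrite /=; congr (iter_derive vs); apply/funext => y.
  have [d1 d2] := is_derive_dinv y tf.
  rewrite deriveE; last exact/derivable1_diffP.
  rewrite diff1E //; last exact/derivable1_diffP.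
  by rewrite derive1E d2.
have : sm (fun x => v * f x) by apply: smM => //; exact: sm_cst.
exact.
Qed.

Lemma derive1_dinv f x : tst f -> derive1 (Defs.dinv f) x = f x.
Proof. by move=> tf; rewrite derive1E; have [_ ->] := is_derive_dinv x tf. Qed.

Lemma dinvD f g x : tst f -> tst g ->
  Defs.dinv (fun x => f x + g x) x = Defs.dinv f x + Defs.dinv g x.
Proof.
move=> tf tg; have [A [F [A0 sA dF]]] := tstP tf; have [B [G [B0 sB dG]]] := tstP tg.
have [sf _] := tf; have [sg _] := tg.
have mA : A <= Num.max A B by rewrite le_max lexx.
have mB : B <= Num.max A B by rewrite le_max lexx orbT.
have m0 : 0 < Num.max A B by exact: lt_le_trans mA.
rewrite (@dinv_antiderivative f F (Num.max A B)) //; last exact: suppW sA.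
rewrite (@dinv_antiderivative g G (Num.max A B)) //; last exact: suppW sB.
rewrite (@dinv_antiderivative _ (fun x => F x + G x) (Num.max A B)) //.
- by ring.
- exact: smD.
- by move=> y hy; rewrite (suppW mA sA) // (suppW mB sB) // addr0.
Qed.

Lemma dinv_edge f : tst f -> exists2 A, 0 < A & forall B, A <= B ->
  Defs.dinv f (- B) = - Defs.dinv f B.
Proof.
move=> tf; have [A [F [A0 sA dF]]] := tstP tf; have [sf _] := tf.
exists A => // B AB; rewrite !(dinv_antiderivative sf A0 sA dF).
have -> : F B = F A by exact: (antiderivative_right sf sA dF).
have -> : F (- B) = F (- A) by apply: (antiderivative_left sf sA dF); rewrite lerN2.
by field.
Qed.

(** The sum of the two integrands is the derivative of [dinv f * dinv g]. Each factor changes sign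
    between the far ends, so the product takes equal values there. *)
Lemma lint_dinv_skew f g : tst f -> tst g ->
  lint (fun x => f x * Defs.dinv g x) = - lint (fun x => Defs.dinv f x * g x).
Proof.
move=> tf tg; have [sf _] := tf; have [sg _] := tg.
have t1 : tst (fun x => f x * Defs.dinv g x) by apply: tstMr => //; exact: sm_dinv.
have t2 : tst (fun x => Defs.dinv f x * g x) by apply: tstMl => //; exact: sm_dinv.
apply/eqP; rewrite -subr_eq0 opprK -lintD //; apply/eqP.
have [A A0 sA] := tst_supp (tstD t1 t2).
have [B B0 eB] := dinv_edge tf; have [C C0 eC] := dinv_edge tg.
pose M := A + B + C.
have dH x : is_derive x (1 : R) (fun x => Defs.dinv f x * Defs.dinv g x)
    (f x * Defs.dinv g x + Defs.dinv f x * g x).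
  have d1 := is_derive_dinv x tf; have d2 := is_derive_dinv x tg.
  have [a b] := @is_deriveM R R (Defs.dinv f) (Defs.dinv g) x 1 _ _ d1 d2.
  split; first exact: a.
  by rewrite [LHS]b addrC; congr (_ + _); exact: mulrC.
rewrite (@lint_antiderivative _ _ M _ _ _ dH).
- by rewrite eB ?eC; [rewrite /M; ring | rewrite /M; lra | rewrite /M; lra].
- by case: (tstD t1 t2).
- by rewrite /M; lra.
- by apply: suppW sA; rewrite /M; lra.
Qed.

(** An antiderivative is nondecreasing and has equal values at both ends of the support, hence is
    constant, and [f] is its derivative. *)
Lemma lint_eq0 f : tst f -> (forall x, 0 <= f x) -> lint f = 0 -> forall x, f x = 0.
Proof.
move=> tf f0 I0 x; have [A [F [A0 sA dF]]] := tstP tf; have [sf _] := tf.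
have ndF a b : a <= b -> F a <= F b.
  move=> ab; rewrite -subr_ge0 -(segint_antiderivative sf dF ab).
  exact: Rintegral_ge0.
have E : F A = F (- A).
  by apply/eqP; rewrite -subr_eq0 -(lint_antiderivative sf A0 sA dF) I0.
have cF y : F y = F A.
  have [yA|/ltW Ay] := leP y A; last exact: (antiderivative_right sf sA dF).
  have [Ay|/ltW Ay] := leP (- A) y; last by rewrite E; exact: (antiderivative_left sf sA dF).
  by apply/eqP; rewrite eq_le ndF // E ndF.
have [_ <-] := dF x.
have -> : F = cst (F A) by apply/funext.
exact: derive_cst.
Qed.

End LineIntegral.

(** * Smooth families of fields *)

Section CompactFamilies.
Context {R : realType} {V : normedModType R}.
Variables (fr : frame V) (S : set V).
Hypothesis oS : open S.

(** With a support bound uniform near each parameter, one fixed [A] serves in the formulas for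
    [lint] and [dinv] on a whole neighbourhood, and does not enter the differentiation. *)
Definition cfam (S : set V) (f : V -> R -> R) :=
  sfam S f /\ forall s0, S s0 -> exists A : R, \forall s \near s0, supp A (f s).

Lemma cfam_sfam f : cfam S f -> sfam S f. Proof. by case. Qed.

Lemma cfam_ext f g : (forall s x, S s -> f s x = g s x) -> cfam S f -> cfam S g.
Proof.
move=> fg [sf cf]; split; first exact: (sfam_ext oS fg).
move=> s0 Ss0; have [A HA] := cf s0 Ss0; exists A.
have := open_near oS Ss0; move: HA; apply: filterS2 => s sA Ss x Ax.
by rewrite -fg // sA.
Qed.

Lemma cfam_tst f s : cfam S f -> S s -> tst (f s).
Proof.
move=> [sf cf] Ss; split; first exact: (sfam_slice fr sf Ss).
by have [A HA] := cf s Ss; exists A; exact: nbhs_singleton HA.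
Qed.

Lemma cfam0 : cfam S (fun _ _ => 0).
Proof.
split; first exact: sfam_cst.
by move=> s0 _; exists 0; exact: nearW.
Qed.

Lemma cfamD f g : cfam S f -> cfam S g -> cfam S (fun s x => f s x + g s x).
Proof.
move=> [sf cf] [sg cg]; split; first exact: sfamD.
move=> s0 Ss0; have [A HA] := cf s0 Ss0; have [B HB] := cg s0 Ss0.
exists (Num.max A B); move: HA HB; apply: filterS2 => s sA sB x.
by rewrite ge_max => /andP[Ax Bx]; rewrite sA // sB // addr0.
Qed.

Lemma cfamMl f g : sfam S f -> cfam S g -> cfam S (fun s x => f s x * g s x).
Proof.
move=> sf [sg cg]; split; first exact: sfamM.
move=> s0 Ss0; have [A HA] := cg s0 Ss0; exists A.
by apply: filterS HA => s sA x Ax; rewrite sA // mulr0.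
Qed.

Lemma cfamMr f g : cfam S f -> sfam S g -> cfam S (fun s x => f s x * g s x).
Proof.
by move=> cf sg; apply: (cfam_ext _ (cfamMl sg cf)) => s x _; rewrite mulrC.
Qed.

Lemma cfamN f : cfam S f -> cfam S (fun s x => - f s x).
Proof.
move=> cf; apply: (cfam_ext _ (cfamMl (@sfam_cst R V S (-1)) cf)) => s x _.
by rewrite mulN1r.
Qed.

Lemma cfam_sum (I : Type) (r : seq I) (P : pred I) (f : I -> V -> R -> R) :
  (forall i, P i -> cfam S (f i)) ->
  cfam S (fun s x => \sum_(i <- r | P i) f i s x).
Proof.
move=> cf; elim: r => [|i r ih].
  by apply: (cfam_ext _ cfam0) => s x _; rewrite big_nil.
case: (boolP (P i)) => Pi.
  by apply: (cfam_ext _ (cfamD (cf i Pi) ih)) => s x _; rewrite big_cons Pi.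
by apply: (cfam_ext _ ih) => s x _; rewrite big_cons (negbTE Pi).
Qed.

Lemma cfam_derive1 f : cfam S f -> cfam S (fun s x => derive1 (f s) x).
Proof.
move=> [sf cf]; split; first exact: sfam_derive1.
move=> s0 Ss0; have [A HA] := cf s0 Ss0; exists (A + 1).
by apply: filterS HA => s; exact: supp_derive1.
Qed.

(** The derivative at s sees all parameters near s, so the bound must hold around each s close to
    s0; [near_join] provides that. *)
Lemma cfam_derive v f : cfam S f -> cfam S (fun s x => 'D_v (f^~ x) s).
Proof.
move=> [sf cf]; split; first exact: sfam_derive.
move=> s0 Ss0; have [A] := cf s0 Ss0; exists A.
have nn : \forall s \near s0, \forall s' \near s, supp A (f s') by exact: near_join.
apply: filterS nn => s HA x Ax.
rewrite (@near_eq_derive _ _ _ _ (fun=> 0)) ?derive_cst //.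
by apply: filterS HA => s' ->.
Qed.

Lemma cfam_locally f s0 : cfam S f -> S s0 ->
  exists A B, [/\ 0 < A, open B, B s0, B `<=` S & forall s, B s -> supp A (f s)].
Proof.
move=> [_ cf] Ss0; have [A HA] := cf s0 Ss0.
exists (`|A| + 1), (S `&` interior [set s | supp A (f s)]); split.
- by rewrite ltr_wpDl.
- by apply: openI => //; exact: open_interior.
- by split.
- by move=> s [].
- move=> s [_ /interior_subset]; apply: suppW.
  by apply: (le_trans (ler_norm A)); rewrite lerDl.
Qed.

Lemma sfamS (A B : set V) f : A `<=` B -> sfam B f -> sfam A f.
Proof. by move=> AB; apply: smooth_onS => -[s x] [/= /AB]. Qed.

Lemma lint_prim (A : R) (f : R -> R) : sm f -> 0 < A -> supp A f ->
  lint f = prim f A - prim f (- A).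
Proof. by move=> sf A0 sA; apply: lint_antiderivative => // x; exact: is_derive_prim. Qed.

Lemma dinv_prim (A : R) (f : R -> R) x : sm f -> 0 < A -> supp A f ->
  Defs.dinv f x = prim f x - 2^-1 * (prim f A + prim f (- A)).
Proof. by move=> sf A0 sA; apply: dinv_antiderivative => // y; exact: is_derive_prim. Qed.

(** Near s0 the integral is a difference of [prim] at the fixed points A and - A, and [prim] is
    smooth in the parameter. *)
Lemma smooth_lint f : cfam S f -> smooth_on S (fun s => lint (f s)).
Proof.
move=> cf; apply: smooth_on_near => s0 Ss0.
have [A [B [A0 oB Bs0 BS sA]]] := cfam_locally cf Ss0.
exists B => //; have [sf _] := cf.
have sp := sfamS BS (sfam_prim fr oS sf).
apply: (@smooth_on_ext _ _ B (fun s => prim (f s) A - prim (f s) (- A))) => //.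
  move=> s Bs; rewrite (@lint_prim A) //; last exact: sA.
  exact: (sfam_slice fr sf (BS _ Bs)).
by apply: smooth_onB => //; exact: (smooth_slice fr _ oB sp).
Qed.

Lemma derive_lint v f s : cfam S f -> S s ->
  'D_v (fun s => lint (f s)) s = lint (fun x => 'D_v (f^~ x) s).
Proof.
move=> cf Ss; have [A [B [A0 oB Bs BS sA]]] := cfam_locally cf Ss.
have [sf _] := cf.
have sp x : smooth_on S (fun s => prim (f s) x).
  exact: (smooth_slice fr _ oS (sfam_prim fr oS sf)).
rewrite (@eq_on_derive _ _ B _ (fun s => prim (f s) A - prim (f s) (- A))) //; last first.
  move=> s' Bs'; rewrite (@lint_prim A) //; last exact: sA.
  exact: (sfam_slice fr sf (BS _ Bs')).
rewrite derive_add; [|exact: (smooth_on_diff (sp _))|]; last first.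
  by apply: differentiableN; exact: (smooth_on_diff (sp _)).
rewrite deriveN; last by apply: diff_derivable; exact: (smooth_on_diff (sp _)).
rewrite !(derive_prim fr _ _ oS sf Ss) -lint_prim //.
  exact: (sfam_slice fr (sfam_derive oS v sf)).
move=> x Ax; rewrite (@eq_on_derive _ _ B _ (fun=> 0)) ?derive_cst //.
by move=> s' /sA; exact.
Qed.

Lemma sfam_dinv f : cfam S f -> sfam S (fun s => Defs.dinv (f s)).
Proof.
move=> cf; apply: smooth_on_near => -[s0 x0] [/= Ss0 _].
have [A [B [A0 oB Bs0 BS sA]]] := cfam_locally cf Ss0.
exists (B `*` setT) => //; have [sf _] := cf.
have sp := sfamS BS (sfam_prim fr oS sf).
change (sfam B (fun s => Defs.dinv (f s))).
apply: (@sfam_ext _ _ B oB (fun s x => prim (f s) x - 2^-1 * (prim (f s) A + prim (f s) (- A)))).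
  move=> s x Bs; rewrite (@dinv_prim A) //; last exact: sA.
  exact: (sfam_slice fr sf (BS _ Bs)).
have spc c : sfam B (fun s _ => prim (f s) c).
  apply: (smooth_on_comp (fr := pair_frame fr real_frame)
    (g := fun p : V * R => (p.1, c)) (open_setXT oB) _ sp).
    by move=> [s t] [].
  by apply: smooth_on_pair => j; [exact: smooth_on_fst | exact: smooth_on_cst].
apply: sfamB => //; apply: sfamM => //; first exact: sfam_cst.
exact: sfamD.
Qed.

Lemma derive_dinv v f s x : cfam S f -> S s ->
  'D_v (fun s => Defs.dinv (f s) x) s = Defs.dinv (fun x => 'D_v (f^~ x) s) x.
Proof.
move=> cf Ss; have [A [B [A0 oB Bs BS sA]]] := cfam_locally cf Ss.
have [sf _] := cf.
have sp y : smooth_on S (fun s => prim (f s) y).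
  exact: (smooth_slice fr _ oS (sfam_prim fr oS sf)).
have dp y : differentiable (fun s => prim (f s) y) s by exact: (smooth_on_diff (sp _)).
rewrite (@eq_on_derive _ _ B _ (fun s => prim (f s) x +
   (- 2^-1) * (prim (f s) A + prim (f s) (- A)))) //; last first.
  move=> s' Bs'; rewrite mulNr (@dinv_prim A) //; last exact: sA.
  exact: (sfam_slice fr sf (BS _ Bs')).
rewrite derive_add //; last first.
  by apply: differentiable_mul; [exact: differentiable_cst | exact: differentiable_add].
rewrite (@derive_mul _ _ (fun=> - 2^-1) (fun s => prim (f s) A + prim (f s) (- A)));
  [|exact: differentiable_cst|exact: differentiable_add].
rewrite derive_cst mul0r add0r.
rewrite derive_add // !(derive_prim fr _ _ oS sf Ss) mulNr -dinv_prim //.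
  exact: (sfam_slice fr (sfam_derive oS v sf)).
move=> y Ay; rewrite (@eq_on_derive _ _ B _ (fun=> 0)) ?derive_cst //.
by move=> s' /sA; exact.
Qed.

End CompactFamilies.

(** * Families of vector-valued functions and their perturbations *)

Section VectorFamilies.
Context {R : realType} {N : nat}.
Implicit Types (V : normedModType R) (U : set 'rV[R]_N).

Definition vfam V (S : set V) (u : V -> R -> 'rV[R]_N) :=
  forall i, sfam S (fun s x => u s x 0 i).

Definition vcfam V (S : set V) (z : V -> R -> 'rV[R]_N) :=
  forall i, cfam S (fun s x => z s x 0 i).

Definition locally_fixed V (S : set V) (u : V -> R -> 'rV[R]_N) :=
  forall s0, S s0 -> exists A : R, \forall s \near s0,
    forall x, A <= `|x| -> u s x = u s0 x.

Definition field_family V U (S : set V) (u : V -> R -> 'rV[R]_N) : Prop :=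
  [/\ forall s, S s -> is_field U (u s), vfam S u & locally_fixed S u].

Lemma sfam_pull V W (fV : frame V) (fW : frame W) (S : set V) (T : set W)
    (g : V -> W) (f : W -> R -> R) : open S ->
  (forall j, smooth_on S (fun s => fco fW j (g s))) ->
  (forall s, S s -> T (g s)) -> sfam T f -> sfam S (fun s => f (g s)).
Proof.
move=> oS sg ST sf.
apply: (smooth_on_comp (fr := pair_frame fW real_frame)
  (g := fun p : V * R => (g p.1, p.2)) (open_setXT oS) _ sf).
  by move=> [s x] [/= /ST].
apply: smooth_on_pair => j; last exact: smooth_on_sndR.
apply: (smooth_on_comp (fr := fV) (f := fun s => fco fW j (g s)) (open_setXT oS) _ (sg j)).
  by move=> [s x] [].
by move=> i; exact: smooth_on_fst.
Qed.

Lemma smooth_coords_continuous V W (fW : frame W) (S : set V) (g : V -> W) s :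
  (forall j, smooth_on S (fun s => fco fW j (g s))) -> S s ->
  {for s, continuous g}.
Proof.
move=> sg Ss; apply: differentiable_continuous.
apply: (differentiable_frame (fr := fW)) => i; exact: (smooth_on_diff (sg i)).
Qed.

Lemma cfam_pull V W (fV : frame V) (fW : frame W) (S : set V) (T : set W)
    (g : V -> W) (f : W -> R -> R) : open S ->
  (forall j, smooth_on S (fun s => fco fW j (g s))) ->
  (forall s, S s -> T (g s)) -> cfam T f -> cfam S (fun s => f (g s)).
Proof.
move=> oS sg ST [sf cf]; split; first exact: (sfam_pull fV oS sg ST sf).
move=> s0 Ss0; have [A HA] := cf _ (ST _ Ss0); exists A.
exact: (smooth_coords_continuous sg Ss0 HA).
Qed.

Lemma field_family_pull V W (fV : frame V) (fW : frame W) U (S : set V) (T : set W)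
    (g : V -> W) u : open S ->
  (forall j, smooth_on S (fun s => fco fW j (g s))) ->
  (forall s, S s -> T (g s)) -> field_family U T u ->
  field_family U S (fun s => u (g s)).
Proof.
move=> oS sg ST [fu su lu]; split.
- by move=> s Ss; exact: fu (ST _ Ss).
- by move=> i; exact: (sfam_pull fV oS sg ST (su i)).
move=> s0 Ss0; have [A HA] := lu _ (ST _ Ss0); exists A.
exact: (smooth_coords_continuous sg Ss0 HA).
Qed.

Definition toframe V (fr : frame V) (s : V) : 'rV[R]_(fdim fr) := \row_i fco fr i s.

Definition unframe V (fr : frame V) (t : 'rV[R]_(fdim fr)) : V :=
  \sum_i t 0 i *: fvec fr i.

Lemma toframeK V (fr : frame V) : cancel (toframe fr) (@unframe V fr).
Proof.
move=> s; rewrite /unframe [RHS](frameE fr).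
by apply: eq_bigr => i _; rewrite mxE.
Qed.

Lemma smooth_toframe V (fr : frame V) (S : set V) j :
  smooth_on S (fun s => fco (rv_frame (fdim fr)) j (toframe fr s)).
Proof.
rewrite (_ : (fun s => _) = fco fr j); first exact: smooth_on_co.
by apply/funext => s; rewrite /= /rvco mxE.
Qed.

Lemma smooth_unframe V (fr : frame V) (T : set 'rV[R]_(fdim fr)) j : open T ->
  smooth_on T (fun t => fco fr j (@unframe V fr t)).
Proof.
move=> oT.
apply: (@smooth_on_ext _ _ _ (fun t : 'rV[R]_(fdim fr) =>
   \sum_i t 0 i * fco fr j (fvec fr i))) => //.
  move=> t _; rewrite /unframe linear_sum; apply: eq_bigr => i _.
  by rewrite linearZ.
apply: smooth_on_sum => // i _; apply: smooth_onM => //; last exact: smooth_on_cst.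
exact: (@smooth_on_co _ _ (rv_frame (fdim fr))).
Qed.

(** [is_covector] speaks of parameters in ['rV_k] only, while perturbations lead to spaces such as
    [V * R]. The family is pulled back to coordinates along [unframe], and the conclusion is brought
    back along [toframe]. *)
Lemma covector_family V (fr : frame V) U (S : set V) u xi : open S ->
  is_covector U xi -> field_family U S u -> vcfam S (fun s => xi (u s)).
Proof.
move=> oS cxi fu i.
pose T : set 'rV[R]_(fdim fr) := @unframe V fr @^-1` S.
have oT : open T.
  apply: open_comp oS => t _.
  by apply: (@smooth_coords_continuous _ _ fr setT) => // j; apply: smooth_unframe; exact: openT.
have [fu' su' lu'] : field_family U T (fun t => u (@unframe V fr t)).
  apply: (field_family_pull (rv_frame _) oT (T := S)) fu => // j.
  exact: smooth_unframe.
have [sx cx] := cxi _ T (fun t => u (@unframe V fr t)) oT (And3 fu' su' lu').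
have cT : cfam T (fun t x => xi (u (@unframe V fr t)) x 0 i).
  split; first exact: sx.
  move=> t0 /cx[A HA]; exists A; apply: filterS HA => t H x Ax.
  by rewrite H // mxE.
have TS s : S s -> T (toframe fr s) by rewrite /T /= toframeK.
have := cfam_pull fr oS (@smooth_toframe V fr S) TS cT.
by apply: cfam_ext => // s x _; rewrite toframeK.
Qed.


Definition prefamily V (S : set V) (w : V -> R -> 'rV[R]_N) :=
  [/\ vfam S w, locally_fixed S w &
    forall s, S s -> exists A, forall i x, A <= `|x| -> dx (w s) i x = 0].

(* A perturbation of a field may leave U; only these parameters give fields. *)
Definition valued V U (S : set V) (w : V -> R -> 'rV[R]_N) : set V :=
  interior [set s | S s /\ forall x, U (w s x)].

Lemma valued_sub V U (S : set V) w : valued U S w `<=` S.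
Proof. by move=> s /interior_subset[]. Qed.

Lemma prefamily_family V (fr : frame V) U (S : set V) w : open S ->
  prefamily S w -> field_family U (valued U S w) w.
Proof.
move=> oS [sw lw dw]; split.
- move=> s /interior_subset[Ss Us]; split=> //; last exact: dw.
  by move=> i; exact: (sfam_slice fr (sw i) Ss).
- move=> i; apply: sfamS (sw i); exact: valued_sub.
- by move=> s0 /valued_sub/lw.
Qed.

Lemma vfam_continuous V (S : set V) w s x : vfam S w -> S s ->
  {for ((s, x) : V * R), continuous (fun p : V * R => w p.1 p.2)}.
Proof.
move=> sw Ss.
apply: (@smooth_coords_continuous _ _ (rv_frame N) (S `*` setT)) => //.
Qed.

(** Outside a bounded segment the nearby curves coincide with [w s0]; on that compact segment the
    openness of [U] is uniform. *)
Lemma prefamily_valued V U (S : set V) w s0 : open U -> open S ->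
  prefamily S w -> S s0 -> (forall x, U (w s0 x)) -> valued U S w s0.
Proof.
move=> oU oS [sw lw dw] Ss0 Uw; have [A HA] := lw _ Ss0.
have /compact_near_coveringP cov : compact `[- A, A] by exact: segment_compact.
have H0 : \forall s \near s0, `[- A, A] `<=` (fun x => U (w s x)).
  apply: (cov V (nbhs s0) (fun s x => U (w s x))) => x _.
  have c0 : w p.2 p.1 @[p --> ((x, s0) : R * V)] --> w s0 x.
    have c1 : ((p.2, p.1) : V * R) @[p --> ((x, s0) : R * V)] --> (s0, x).
      by apply: cvg_pair_nbhs; [exact: cvg_snd | exact: cvg_fst].
    exact: (cvg_comp _ _ c1 (vfam_continuous (x := x) sw Ss0)).
  exact: (c0 _ (open_near oU (Uw x))).
rewrite /valued /interior /=; near=> s; split; first by near: s; exact: open_near.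
move=> x; have [Ax|xA] := leP A `|x|.
  have -> : w s x = w s0 x by move: x Ax; near: s; exact: HA.
  exact: Uw.
have : `[- A, A] `<=` (fun x => U (w s x)) by near: s; exact: H0.
apply; rewrite /= in_itv /=; move: xA; rewrite ltr_norml => /andP[? ?].
by rewrite !ltW.
Unshelve. all: by end_near. Qed.

Lemma vcfam_covector U xi :
  (forall k (S : set 'rV[R]_k) u, open S -> field_family U S u ->
     vcfam S (fun s => xi (u s))) -> is_covector U xi.
Proof.
move=> H k S u oS fu; have cx := H k S u oS fu; split=> [i|s0 Ss0].
  by have [] := cx i.
have /choice[A HA] : forall i, exists A : R, \forall s \near s0,
    supp A (fun x => xi (u s) x 0 i) by move=> i; have [_ /(_ s0 Ss0)] := cx i.
exists (\sum_i `|A i|).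
have := filter_forall (nbhs_filter s0) HA; apply: filterS => s sA x Ax.
apply/rowP => i; rewrite mxE; apply: sA; apply: le_trans Ax.
rewrite (bigD1 i) //=; apply: (le_trans (ler_norm _)).
by rewrite lerDl; apply: sumr_ge0.
Qed.

(** The linearization of a covector field at u. For the variational derivative of a functional,
    pairing it with a second test function gives the second variation. *)
Definition dcov (xi : (R -> 'rV[R]_N) -> R -> 'rV[R]_N) (u phi : R -> 'rV[R]_N)
    (x : R) : 'rV[R]_N :=
  \row_i derive1 (fun e : R => xi (fun y => u y + e *: phi y) x 0 i) 0.

Lemma vcfam_fixed V (S : set V) phi s0 : vcfam S phi -> S s0 ->
  exists A : R, \forall s \near s0, forall x, A <= `|x| -> phi s x = 0.
Proof.
move=> cx Ss0.
have /choice[A HA] : forall i, exists A : R, \forall s \near s0,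
    supp A (fun x => phi s x 0 i) by move=> i; have [_ /(_ s0 Ss0)] := cx i.
exists (\sum_i `|A i|).
have := filter_forall (nbhs_filter s0) HA; apply: filterS => s sA x Ax.
apply/rowP => i; rewrite mxE; apply: sA; apply: le_trans Ax.
rewrite (bigD1 i) //=; apply: (le_trans (ler_norm _)).
by rewrite lerDl; apply: sumr_ge0.
Qed.

Lemma dx_fixed (u v : R -> 'rV[R]_N) A i x : (forall x, A <= `|x| -> u x = v x) ->
  A + 1 <= `|x| -> dx u i x = dx v i x.
Proof.
move=> uv Ax; rewrite /dx !derive1E.
apply: (@eq_on_derive _ _ [set y | A < `|y|]).
- apply: (@open_comp _ _ (fun y : R => `|y|) [set z | A < z]); last exact: open_gt.
  by move=> y _; exact: norm_continuous.
- by apply: lt_le_trans Ax; rewrite ltrDl.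
- by move=> y /ltW/uv ->.
Qed.

Lemma perturb_prefamily V (fr : frame V) U (S : set V) u phi : open S ->
  field_family U S u -> vcfam S phi ->
  prefamily (S `*` [set: R]) (fun p : V * R => fun x => u p.1 x + p.2 *: phi p.1 x).
Proof.
move=> oS [fu su lu] cphi; have oST := @open_setXT _ R _ oS; split.
- move=> i; apply: (@sfam_ext _ _ _ oST (fun (p : V * R) x =>
    u p.1 x 0 i + p.2 * phi p.1 x 0 i)); first by move=> p x _; rewrite !mxE.
  have sp f : sfam S f -> sfam (S `*` [set: R]) (fun p : V * R => f p.1).
    move=> sf; apply: (sfam_pull (pair_frame fr real_frame) (fW := fr) (T := S)
      (g := fst) oST _ _ sf) => [j|]; first exact: smooth_on_fst.
    by move=> [s e] [].
  apply: sfamD => //; first exact: (sp (fun s x => u s x 0 i) (su i)).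
  apply: sfamM => //; last by apply: (sp (fun s x => phi s x 0 i)); case: (cphi i).
  apply: (smooth_on_comp (fr := pair_frame fr real_frame) (B := S `*` setT)
   (f := snd) (g := fun p : (V * R) * R => p.1)).
  + exact: open_setXT.
  + by move=> [[s e] x] [].
  + exact: smooth_on_sndR.
  + by move=> j; exact: smooth_on_fst.
- move=> [s0 e0] [/= Ss0 _].
  have [A HA] := lu _ Ss0; have [B HB] := vcfam_fixed cphi Ss0.
  exists (Num.max A B).
  have H : \forall s \near s0, forall x, Num.max A B <= `|x| ->
      u s x = u s0 x /\ phi s x = 0.
    move: HA HB; apply: filterS2 => s HA HB x; rewrite ge_max => /andP[Ax Bx].
    by split; [exact: HA | exact: HB].
  have H1 := nbhs_singleton H.
  have : \forall p \near ((s0, e0) : V * R), forall x, Num.max A B <= `|x| ->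
      u p.1 x = u s0 x /\ phi p.1 x = 0 by exact: (cvg_fst H).
  apply: filterS => p Hp x Ax /=.
  have [-> ->] := Hp x Ax; have [_ ->] := H1 x Ax.
  by rewrite !scaler0.
- move=> [s e] [/= Ss _]; have [_ _ [A HA]] := fu _ Ss.
  have [B HB] := vcfam_fixed cphi Ss; have {}HB := nbhs_singleton HB.
  exists (Num.max A (B + 1)) => i x; rewrite ge_max => /andP[Ax Bx].
  rewrite (@dx_fixed _ (u s) B) //; first exact: HA.
  by move=> y /HB ->; rewrite scaler0 addr0.
Qed.

(** The family is perturbed along phi with an extra parameter e, restricted to the parameters that
    keep it in U, and differentiated in e. The points (s, 0) survive the restriction because each
    [u s] is a field. *)
Lemma dcov_family V (fr : frame V) U (S : set V) xi u phi : open U -> open S ->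
  is_covector U xi -> field_family U S u -> vcfam S phi ->
  vcfam S (fun s => dcov xi (u s) (phi s)).
Proof.
move=> oU oS cxi fu cphi i.
have pf := perturb_prefamily fr oS fu cphi.
have oST := @open_setXT _ R _ oS.
set w := (X in prefamily _ X) in pf.
have ff := prefamily_family (pair_frame fr real_frame) U oST pf.
set S1 := valued _ _ _ in ff.
have oS1 : open S1 by exact: open_interior.
have S1P s : S s -> S1 (s, 0).
  move=> Ss; apply: prefamily_valued => // x; rewrite /w /= scale0r addr0.
  by have [fu' _ _] := fu; have [_ + _] := fu' s Ss; apply.
have cx := covector_family (pair_frame fr real_frame) oS1 cxi ff i.
have cdx := cfam_derive oS1 (0, 1) cx.
have sg j : smooth_on S (fun s : V => fco (pair_frame fr real_frame) j (s, 0)).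
  by apply: smooth_on_pair => l; [exact: smooth_on_co | exact: smooth_on_cst].
have := cfam_pull fr oS sg S1P cdx.
apply: cfam_ext => // s x Ss; rewrite mxE.
by rewrite (derive1_slice (fun s e => xi (fun y => u s y + e *: phi s y) x 0 i)).
Qed.

End VectorFamilies.

(** * The operator and its variation *)

Section Operator.
Context {R : realType} {N L : nat}.
Variables (U : set 'rV[R]_N) (eta : 'M[R]_N) (mu : 'M[R]_L).
Variable w : 'I_L -> 'rV[R]_N -> 'M[R]_N.
Hypotheses (openU : open U) (eta_sym : eta^T = eta) (mu_sym : mu^T = mu).
Hypothesis w_smooth : forall n i j, smooth_on U (fun u => w n u i j).
Implicit Types u a b z phi : R -> 'rV[R]_N.

(** In the notation of the overview, [vel] is W_n, [pvel] is <W_n, z>, [dvel] is dW_n[phi], [dpvel]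
    is <dW_n[phi], z>, and b_n is [dinv (pvel n u b)]. *)
Definition vel n u x i : R := \sum_k w n (u x) i k * dx u k x.

Definition pvel n u z x : R := \sum_j vel n u x j * z x 0 j.

Definition dvel n u phi x i : R :=
  \sum_k ((\sum_l phi x 0 l * partial l (fun p => w n p i k) (u x)) * dx u k x
          + w n (u x) i k * dx phi k x).

Definition dpvel n u phi z x : R := \sum_j dvel n u phi x j * z x 0 j.

Definition dot a b x : R := \sum_i a x 0 i * b x 0 i.

Local Notation M := (nonlocal_op eta mu w).

(** The bracket at u as a bilinear form in the two variational derivatives. *)
Definition oform u a b : R := lint (dot a (M u b)).

Lemma nonlocal_opE u z x i : M u z x 0 i = \sum_j eta i j * dx z j x +
  \sum_m \sum_n mu m n * (vel m u x i * Defs.dinv (pvel n u z) x).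
Proof.
have E n : (fun y => \sum_j \sum_s w n (u y) j s * dx u s y * z y 0 j) = pvel n u z.
  by apply/funext => y; apply: eq_bigr => j _; rewrite mulr_suml.
rewrite mxE; congr (_ + _); apply: eq_bigr => m _; apply: eq_bigr => n _.
by rewrite -mulrA E.
Qed.

Section Family.
Variables (V : normedModType R) (fr : frame V) (S : set V).
Hypothesis oS : open S.
Variable u : V -> R -> 'rV[R]_N.
Hypothesis fu : field_family U S u.

Lemma field_family_sfam i : sfam S (fun s x => u s x 0 i).
Proof. by case: fu. Qed.

Lemma field_family_val s x : S s -> U (u s x).
Proof. by case: fu => /(_ s) h _ _ /h[]. Qed.

Lemma field_family_comp f : smooth_on U f -> sfam S (fun s x => f (u s x)).
Proof.
move=> sf; apply: (smooth_on_comp (fr := rv_frame N) (g := fun p : V * R => u p.1 p.2)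
  (open_setXT oS) _ sf).
  by move=> [s x] [/= Ss _]; exact: field_family_val.
by move=> j; exact: field_family_sfam.
Qed.

Lemma cfam_dx k : cfam S (fun s x => dx (u s) k x).
Proof.
split; first exact: (sfam_derive1 oS (field_family_sfam k)).
case: fu => fu' _ lu s0 Ss0; have [A HA] := lu _ Ss0.
have [_ _ [B HB]] := fu' _ Ss0; exists (Num.max (A + 1) B).
apply: filterS HA => s HA x; rewrite ge_max => /andP[Ax Bx].
by rewrite (@dx_fixed _ _ _ (u s0) A) // HB.
Qed.

Lemma cfam_vel n i : cfam S (fun s x => vel n (u s) x i).
Proof.
apply: cfam_sum => // k _; apply: cfamMl => //; last exact: cfam_dx.
exact: (field_family_comp (w_smooth n i k)).
Qed.

Lemma cfam_pvel n (z : V -> R -> 'rV[R]_N) : vcfam S z -> cfam S (fun s x => pvel n (u s) (z s) x).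
Proof.
move=> cz; apply: cfam_sum => // k _; apply: cfamMr => //; first exact: cfam_vel.
exact: cfam_sfam (cz k).
Qed.

Lemma sfam_dinv_pvel n (z : V -> R -> 'rV[R]_N) : vcfam S z ->
  sfam S (fun s x => Defs.dinv (pvel n (u s) (z s)) x).
Proof. by move=> cz; apply: (sfam_dinv fr oS); exact: cfam_pvel. Qed.

Lemma vcfam_op (z : V -> R -> 'rV[R]_N) : vcfam S z -> vcfam S (fun s => M (u s) (z s)).
Proof.
move=> cz i; apply: (@cfam_ext _ _ _ oS (fun s x => \sum_j eta i j * dx (z s) j x +
  \sum_m \sum_n mu m n * (vel m (u s) x i * Defs.dinv (pvel n (u s) (z s)) x))).
  by move=> s x _; rewrite nonlocal_opE.
apply: cfamD => //.
  apply: cfam_sum => // j _; apply: cfamMl => //; first exact: sfam_cst.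
  exact: (cfam_derive1 oS (cz j)).
apply: cfam_sum => // m _; apply: cfam_sum => // n _.
apply: cfamMl => //; first exact: sfam_cst.
by apply: cfamMr => //; [exact: cfam_vel | exact: sfam_dinv_pvel].
Qed.

Lemma cfam_dot (a b : V -> R -> 'rV[R]_N) : vcfam S a -> vcfam S b ->
  cfam S (fun s x => dot (a s) (b s) x).
Proof.
move=> ca cb; apply: cfam_sum => // i _; apply: cfamMr => //.
exact: cfam_sfam (cb i).
Qed.

Lemma smooth_oform (a b : V -> R -> 'rV[R]_N) : vcfam S a -> vcfam S b ->
  smooth_on S (fun s => oform (u s) (a s) (b s)).
Proof.
by move=> ca cb; apply: (smooth_lint fr oS); apply: cfam_dot => //; exact: vcfam_op.
Qed.

Section Direction.
Variable v : V.

Definition vdir (z : V -> R -> 'rV[R]_N) (s : V) (x : R) : 'rV[R]_N :=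
  \row_i 'D_v (fun s => z s x 0 i) s.

Lemma vcfam_vdir (z : V -> R -> 'rV[R]_N) : vcfam S z -> vcfam S (vdir z).
Proof.
move=> cz i; apply: (cfam_ext oS _ (cfam_derive oS v (cz i))) => s x _.
by rewrite mxE.
Qed.


Lemma derive_dx (z : V -> R -> 'rV[R]_N) k s x : vfam S z -> S s ->
  'D_v (fun s => dx (z s) k x) s = dx (vdir z s) k x.
Proof.
move=> sz Ss; rewrite /dx (derive_derive1 oS v x (sz k) Ss).
by congr derive1; apply/funext => y; rewrite mxE.
Qed.

Lemma slice_diff (f : V -> R -> R) s x : sfam S f -> S s -> differentiable (f^~ x) s.
Proof. by move=> sf Ss; exact: (smooth_on_diff (smooth_slice fr x oS sf)). Qed.

Lemma derive_field_comp f s x : smooth_on U f -> S s ->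
  'D_v (fun s => f (u s x)) s = \sum_l vdir u s x 0 l * partial l f (u s x).
Proof.
move=> sf Ss; rewrite (@derive_comp _ _ _ (rv_frame N) f (fun s => u s x)).
- by apply: eq_bigr => l _; rewrite mxE.
- by move=> i; exact: (slice_diff _ (field_family_sfam i)).
- exact: (smooth_on_diff sf (field_family_val _ Ss)).
Qed.

Lemma derive_vel n i s x : S s ->
  'D_v (fun s => vel n (u s) x i) s = dvel n (u s) (vdir u s) x i.
Proof.
move=> Ss; have sw k := field_family_comp (w_smooth n i k).
have sd k := cfam_sfam (cfam_dx k).
rewrite (proj1 (derive_big _ _ _)); last first.
  by move=> k _; exact: (slice_diff _ (sfamM oS (sw k) (sd k))).
apply: eq_bigr => k _.
rewrite (@derive_mul _ _ (fun s => w n (u s x) i k) (fun s => dx (u s) k x)).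
- rewrite (derive_field_comp _ (w_smooth n i k)) // derive_dx //.
  by case: fu.
- exact: (slice_diff _ (sw k)).
- exact: (slice_diff _ (sd k)).
Qed.

Lemma derive_pvel n (z : V -> R -> 'rV[R]_N) s x : vcfam S z -> S s ->
  'D_v (fun s => pvel n (u s) (z s) x) s =
  dpvel n (u s) (vdir u s) (z s) x + pvel n (u s) (vdir z s) x.
Proof.
move=> cz Ss; have sW k := cfam_sfam (cfam_vel n k).
have sz k := cfam_sfam (cz k).
rewrite (proj1 (derive_big _ _ _)); last first.
  by move=> k _; exact: (slice_diff _ (sfamM oS (sW k) (sz k))).
rewrite -big_split; apply: eq_bigr => k _ /=.
rewrite (@derive_mul _ _ (fun s => vel n (u s) x k) (fun s => z s x 0 k)).
- by rewrite derive_vel // mxE.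
- exact: (slice_diff _ (sW k)).
- exact: (slice_diff _ (sz k)).
Qed.

Lemma cfam_dvel n i : cfam S (fun s x => dvel n (u s) (vdir u s) x i).
Proof.
by apply: (cfam_ext oS _ (cfam_derive oS v (cfam_vel n i))) => s x; exact: derive_vel.
Qed.

End Direction.

End Family.

Definition vsm (z : R -> 'rV[R]_N) := forall i, sm (fun x => z x 0 i).
Definition vtst (z : R -> 'rV[R]_N) := forall i, tst (fun x => z x 0 i).

Lemma vtst_vsm z : vtst z -> vsm z. Proof. by move=> tz i; case: (tz i). Qed.

Lemma is_testP z : is_test z <-> vtst z.
Proof.
split=> [[sz [A zA]] i|tz]; first by split; [exact: sz | exists A => x /zA ->; rewrite mxE].
split; first exact: vtst_vsm.
have /choice[A HA] : forall i, exists A, supp A (fun x => z x 0 i).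
  by move=> i; have [] := tz i.
exists (\sum_i `|A i|) => x Ax; apply/rowP => i; rewrite mxE; apply: HA.
apply: le_trans Ax; rewrite (bigD1 i) //=; apply: (le_trans (ler_norm _)).
by rewrite lerDl; apply: sumr_ge0.
Qed.

Lemma sfam_const f : sm f -> sfam [set: R] (fun _ : R => f).
Proof.
move=> sf; apply: (smooth_on_comp (fr := real_frame) (B := [set: R])
    (g := fun p : R * R => p.2)) => //; first exact: open_setXT openT.
by move=> j; exact: smooth_on_sndR.
Qed.

Lemma vcfam_const z : vtst z -> vcfam [set: R] (fun _ : R => z).
Proof.
move=> tz i; have [sz [A sA]] := tz i; split; first exact: sfam_const.
by move=> s0 _; exists A; near=> s; exact: sA.
Unshelve. all: by end_near. Qed.

Lemma field_family_const u : is_field U u -> field_family U [set: R] (fun _ : R => u).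
Proof.
move=> fu; have [su _ _] := fu; split=> //; first by move=> i; exact: (sfam_const (su i)).
by move=> s0 _; exists 0; near=> s.
Unshelve. all: by end_near. Qed.

Section Single.
Variable u : R -> 'rV[R]_N.
Hypothesis fu : is_field U u.

Let ff := field_family_const fu.
Let cst_tst f : cfam [set: R] (fun _ : R => f) -> tst f.
Proof. by move=> cf; exact: (cfam_tst real_frame cf (s := 0)). Qed.

Lemma tst_dx k : tst (dx u k).
Proof. exact: cst_tst (cfam_dx openT ff k). Qed.

Lemma sm_field i : sm (fun x => u x 0 i).
Proof. by have [su _ _] := fu; exact: su. Qed.

Lemma sm_comp f : smooth_on U f -> sm (fun x => f (u x)).
Proof.
by move=> sf; exact: (sfam_slice real_frame (field_family_comp openT ff sf) (s := 0)).
Qed.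

Lemma sm_w n i k : sm (fun x => w n (u x) i k).
Proof. exact: (sm_comp (w_smooth n i k)). Qed.

Lemma sm_partial_w n i k l : sm (fun x => partial l (fun p => w n p i k) (u x)).
Proof. by apply: (sm_comp (f := partial l _)); exact: smooth_on_derive. Qed.

Lemma tst_vel n i : tst (vel n u ^~ i).
Proof. exact: cst_tst (cfam_vel openT ff n i). Qed.

Lemma tst_pvel n z : vtst z -> tst (pvel n u z).
Proof. by move=> tz; exact: cst_tst (cfam_pvel openT ff n (vcfam_const tz)). Qed.

Lemma sm_dinv_pvel n z : vtst z -> sm (Defs.dinv (pvel n u z)).
Proof. by move=> tz; apply: sm_dinv; exact: tst_pvel. Qed.

Lemma vtst_op z : vtst z -> vtst (M u z).
Proof. by move=> tz i; exact: cst_tst (vcfam_op real_frame openT ff (vcfam_const tz) i). Qed.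

Lemma tst_dot a b : vtst a -> vsm b -> tst (dot a b).
Proof. by move=> ta sb; apply: tst_sum => i _; exact: tstMr. Qed.

Lemma oform_expand a b : vtst a -> vtst b -> oform u a b =
  \sum_i \sum_j eta i j * lint (fun x => a x 0 i * dx b j x) +
  \sum_m \sum_n mu m n * lint (fun x => pvel m u a x * Defs.dinv (pvel n u b) x).
Proof.
move=> ta tb.
have t1 i j : tst (fun x => a x 0 i * dx b j x).
  by apply: tstMr => //; apply: sm_derive1; case: (tb j).
have t2 m n : tst (fun x => pvel m u a x * Defs.dinv (pvel n u b) x).
  by apply: tstMr; [exact: tst_pvel | exact: sm_dinv_pvel].
have c1 i j : tst (fun x => eta i j * (a x 0 i * dx b j x)).
  by apply: tstMl => //; exact: sm_cst.
have c2 m n : tst (fun x => mu m n * (pvel m u a x * Defs.dinv (pvel n u b) x)).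
  by apply: tstMl => //; exact: sm_cst.
transitivity (lint (fun x => (\sum_i \sum_j eta i j * (a x 0 i * dx b j x)) +
  \sum_m \sum_n mu m n * (pvel m u a x * Defs.dinv (pvel n u b) x))).
  congr lint; apply/funext => x; rewrite /dot.
  under eq_bigr do rewrite nonlocal_opE mulrDr.
  rewrite big_split; congr (_ + _).
    by apply: eq_bigr => i _; rewrite mulr_sumr; apply: eq_bigr => j _; ring.
  under eq_bigr do rewrite mulr_sumr.
  rewrite exchange_big; apply: eq_bigr => m _.
  under eq_bigr do rewrite mulr_sumr.
  rewrite exchange_big; apply: eq_bigr => n _.
  rewrite /pvel mulr_suml mulr_sumr; apply: eq_bigr => i _; ring.
rewrite lintD; [|by do 2 (apply: tst_sum => ? _)|by do 2 (apply: tst_sum => ? _)].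
congr (_ + _); rewrite lint_sum; try by move=> ? _; apply: tst_sum.
  by apply: eq_bigr => i _; rewrite lint_sum //; apply: eq_bigr => j _; exact: lintZ.
by apply: eq_bigr => m _; rewrite lint_sum //; apply: eq_bigr => n _; exact: lintZ.
Qed.

Lemma sum_skew (I : finType) (F G : I -> I -> R) : (forall i j, F i j = - G j i) ->
  \sum_i \sum_j F i j = - \sum_i \sum_j G i j.
Proof.
move=> FG; rewrite exchange_big -sumrN; apply: eq_bigr => j _.
by rewrite -sumrN; apply: eq_bigr => i _.
Qed.

(** The local part is skew by integration by parts and the symmetry of [eta], the nonlocal part by
    the skewness of [dinv] and the symmetry of [mu]. *)
Lemma oform_skew a b : vtst a -> vtst b -> oform u a b = - oform u b a.
Proof.
move=> ta tb; rewrite !oform_expand // opprD; congr (_ + _); apply: sum_skew => i j.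
  rewrite -[in LHS]eta_sym mxE -mulrN; apply: (congr1 ( *%R (eta j i))).
  rewrite /dx lint_by_parts //; last by case: (tb j).
  by apply: (congr1 -%R); apply: (congr1 lint); apply/funext => x; exact: mulrC.
rewrite -[in LHS]mu_sym mxE -mulrN; apply: (congr1 ( *%R (mu j i))).
rewrite lint_dinv_skew; [|exact: tst_pvel|exact: tst_pvel].
by apply: (congr1 -%R); apply: (congr1 lint); apply/funext => x; exact: mulrC.
Qed.

Lemma tst_dvel n phi i : vtst phi -> tst (dvel n u phi ^~ i).
Proof.
move=> tp; apply: tst_sum => k _; apply: tstD.
  apply: tstMl; last exact: tst_dx.
  apply: sm_sum => l _; apply: smM; first by case: (tp l).
  exact: sm_partial_w.
by apply: tstMl; [exact: sm_w | exact: tst_derive1].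
Qed.

Lemma tst_dpvel n phi z : vtst phi -> vsm z -> tst (dpvel n u phi z).
Proof.
by move=> tp sz; apply: tst_sum => i _; apply: tstMr => //; exact: tst_dvel.
Qed.

(* The L^2 adjoint of phi |-> dvel m u phi. *)
Definition vadj m (g : R -> 'rV[R]_N) x l : R :=
  \sum_i g x 0 i * (\sum_k partial l (fun p => w m p i k) (u x) * dx u k x)
  - derive1 (fun x => \sum_i g x 0 i * w m (u x) i l) x.

(** Only the term with phi' is integrated by parts; the other is a rearrangement of sums. *)
Lemma lint_vadj m g phi : vsm g -> vtst phi ->
  lint (fun x => \sum_i g x 0 i * dvel m u phi x i) =
  lint (fun x => \sum_l vadj m g x l * phi x 0 l).
Proof.
move=> sg tp.
have sG k : sm (fun x => \sum_i g x 0 i * w m (u x) i k).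
  by apply: sm_sum => i _; apply: smM => //; exact: sm_w.
have t1 l : tst (fun x => phi x 0 l *
    \sum_i g x 0 i * (\sum_k partial l (fun p => w m p i k) (u x) * dx u k x)).
  apply: tstMr => //; apply: sm_sum => i _; apply: smM => //; apply: sm_sum => k _.
  by apply: smM; [exact: sm_partial_w | case: (tst_dx k)].
have t2 l : tst (fun x => derive1 (fun x => phi x 0 l) x *
    \sum_i g x 0 i * w m (u x) i l).
  by apply: tstMr => //; exact: tst_derive1.
have t3 l : tst (fun x => phi x 0 l *
    derive1 (fun x => \sum_i g x 0 i * w m (u x) i l) x).
  by apply: tstMr => //; exact: sm_derive1.
transitivity (lint (fun x => \sum_l (phi x 0 l *
    (\sum_i g x 0 i * (\sum_k partial l (fun p => w m p i k) (u x) * dx u k x)) +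
    derive1 (fun x => phi x 0 l) x * \sum_i g x 0 i * w m (u x) i l))).
  congr lint; apply/funext => x; rewrite /dvel.
  under eq_bigr do rewrite big_split mulrDr.
  rewrite big_split [in RHS]big_split /=; congr (_ + _).
    under [in RHS]eq_bigr do rewrite mulr_sumr.
    rewrite exchange_big; apply: eq_bigr => i _.
    under [in RHS]eq_bigr do rewrite mulrCA mulr_sumr.
    rewrite -mulr_sumr exchange_big; congr (_ * _); apply: eq_bigr => k _.
    by rewrite mulr_suml; apply: eq_bigr => l _; ring.
  under eq_bigr do rewrite mulr_sumr.
  under [in RHS]eq_bigr do rewrite mulr_sumr.
  rewrite exchange_big; apply: eq_bigr => k _; apply: eq_bigr => i _.
  by rewrite /dx; ring.
rewrite lint_sum; last by move=> l _; exact: tstD.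
transitivity (\sum_l lint (fun x => phi x 0 l *
    (\sum_i g x 0 i * (\sum_k partial l (fun p => w m p i k) (u x) * dx u k x)) -
     phi x 0 l * derive1 (fun x => \sum_i g x 0 i * w m (u x) i l) x)).
  apply: eq_bigr => l _; rewrite lintD // lintB //; congr (_ + _).
  by rewrite lint_by_parts // opprK.
rewrite -lint_sum; last by move=> l _; apply: tstD => //; exact: tstN.
congr lint; apply/funext => x; apply: eq_bigr => l _.
by rewrite /vadj; ring.
Qed.

(* The derivative, along phi, of the w-dependence of u |-> oform u a b. *)
Definition vform phi a b : R := \sum_m \sum_n mu m n *
  (lint (fun x => dpvel m u phi a x * Defs.dinv (pvel n u b) x) -
   lint (fun x => dpvel m u phi b x * Defs.dinv (pvel n u a) x)).

(** The two halves of [vform] both pair dW_m[phi] with something; this is the combination a b_n - b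
    a_n into which they merge. *)
Definition gap n a b x : 'rV[R]_N :=
  \row_i (a x 0 i * Defs.dinv (pvel n u b) x - b x 0 i * Defs.dinv (pvel n u a) x).

(** The covector that represents phi |-> [vform phi a b]: the share of the operator's dependence on
    u in the variational derivative of a bracket. *)
Definition vcov a b x : 'rV[R]_N :=
  \row_l \sum_m \sum_n mu m n * vadj m (gap n a b) x l.

Lemma vtst_gap n a b : vtst a -> vtst b -> vtst (gap n a b).
Proof.
move=> ta tb i.
apply: (eq_tst (f := fun x => a x 0 i * Defs.dinv (pvel n u b) x +
   - (b x 0 i * Defs.dinv (pvel n u a) x))); first by move=> x; rewrite mxE.
apply: tstD; last apply: tstN; by apply: tstMr => //; exact: sm_dinv_pvel.
Qed.

Lemma tst_vadj m g l : vtst g -> tst (vadj m g ^~ l).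
Proof.
move=> tg; apply: tstD.
  apply: tst_sum => i _; apply: tstMr => //; apply: sm_sum => k _.
  by apply: smM; [exact: sm_partial_w | case: (tst_dx k)].
apply: tstN; apply: tst_derive1; apply: tst_sum => i _; apply: tstMr => //.
exact: sm_w.
Qed.

Lemma vform_adj phi a b : vtst phi -> vtst a -> vtst b ->
  vform phi a b = lint (dot (vcov a b) phi).
Proof.
move=> tp ta tb.
have tA m n l : tst (fun x => vadj m (gap n a b) x l * phi x 0 l).
  by apply: tstMr; [apply: tst_vadj; exact: vtst_gap | exact: vtst_vsm].
transitivity (lint (fun x => \sum_m \sum_n mu m n *
    \sum_l vadj m (gap n a b) x l * phi x 0 l)); last first.
  congr lint; apply/funext => x; rewrite /dot.
  under [in RHS]eq_bigr do rewrite mxE mulr_suml.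
  rewrite [RHS]exchange_big; apply: eq_bigr => m _.
  under [in RHS]eq_bigr do rewrite mulr_suml.
  rewrite [RHS]exchange_big; apply: eq_bigr => n _.
  by rewrite mulr_sumr; apply: eq_bigr => l _; rewrite mulrA.
have tB m n : tst (fun x => \sum_l vadj m (gap n a b) x l * phi x 0 l).
  by apply: tst_sum.
have tC m n : tst (fun x => mu m n * \sum_l vadj m (gap n a b) x l * phi x 0 l).
  by apply: tstMl => //; exact: sm_cst.
rewrite lint_sum; last by move=> m _; apply: tst_sum.
apply: eq_bigr => m _; rewrite lint_sum //; apply: eq_bigr => n _.
rewrite lintZ //; congr (_ * _).
rewrite -lint_vadj //; last exact/vtst_vsm/vtst_gap.
rewrite -lintB; last 2 first.
- by apply: tstMr; [apply: tst_dpvel => //; exact: vtst_vsm | exact: sm_dinv_pvel].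
- by apply: tstMr; [apply: tst_dpvel => //; exact: vtst_vsm | exact: sm_dinv_pvel].
congr lint; apply/funext => x; rewrite /dpvel !mulr_suml -sumrB.
by apply: eq_bigr => i _; rewrite mxE; ring.
Qed.

End Single.

End Operator.

(** * Variation of the bracket along a family of fields *)

Section Bracket.
Context {R : realType} {N L : nat}.
Variables (U : set 'rV[R]_N) (eta : 'M[R]_N) (mu : 'M[R]_L).
Variable w : 'I_L -> 'rV[R]_N -> 'M[R]_N.
Hypotheses (openU : open U) (eta_sym : eta^T = eta) (mu_sym : mu^T = mu).
Hypothesis w_smooth : forall n i j, smooth_on U (fun u => w n u i j).

Local Notation M := (nonlocal_op eta mu w).
Local Notation oform := (oform eta mu w).
Local Notation vform := (vform mu w).
Local Notation vcov := (vcov mu w).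
Local Notation pvel := (pvel w).
Local Notation vel := (vel w).
Local Notation dpvel := (dpvel w).

Section Family.
Variables (V : normedModType R) (fr : frame V) (S : set V).
Hypothesis oS : open S.
Variable u : V -> R -> 'rV[R]_N.
Hypothesis fu : field_family U S u.
Variables a b : V -> R -> 'rV[R]_N.
Hypotheses (ca : vcfam S a) (cb : vcfam S b).

Lemma vcfam_vcov : vcfam S (fun s => vcov (u s) (a s) (b s)).
Proof.
have sp n (z : V -> R -> 'rV[R]_N) : vcfam S z ->
    sfam S (fun s x => Defs.dinv (pvel n (u s) (z s)) x).
  by move=> cz; exact: (sfam_dinv_pvel w_smooth fr oS fu n cz).
have cg n i : cfam S (fun s x => gap w (u s) n (a s) (b s) x 0 i).
  apply: (@cfam_ext _ _ _ oS (fun s x => a s x 0 i * Defs.dinv (pvel n (u s) (b s)) x +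
     - (b s x 0 i * Defs.dinv (pvel n (u s) (a s)) x))).
    by move=> s x _; rewrite mxE.
  apply: cfamD => //; last apply: cfamN => //; apply: cfamMr => //; exact: sp.
move=> l.
have H : cfam S (fun s x => \sum_m \sum_n mu m n *
   vadj w (u s) m (gap w (u s) n (a s) (b s)) x l).
  apply: cfam_sum => // m _; apply: cfam_sum => // n _; apply: cfamMl => //.
    exact: sfam_cst.
  apply: cfamD => //.
    apply: cfam_sum => // i _; apply: cfamMr => //.
    apply: sfam_sum => // k _; apply: sfamM => //.
      apply: (field_family_comp oS fu (f := partial l (fun p => w m p i k))).
      exact: smooth_on_derive.
    exact: cfam_sfam (cfam_dx oS fu k).
  apply: cfamN => //.
  apply: (cfam_derive1 oS (f := fun s x => \sum_i gap w (u s) n (a s) (b s) x 0 i *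
    w m (u s x) i l)).
  apply: cfam_sum => // i _; apply: cfamMr => //.
  exact: (field_family_comp oS fu (w_smooth m i l)).
by apply: (cfam_ext oS _ H) => s x _; rewrite [RHS]mxE.
Qed.

Lemma sum2D (A B : 'I_L -> 'I_L -> R) : \sum_m \sum_n (A m n + B m n) =
  \sum_m \sum_n A m n + \sum_m \sum_n B m n.
Proof. by rewrite -big_split; apply: eq_bigr => m _; rewrite big_split. Qed.

Section Direction.
Variable v : V.

Lemma derive_nonlocal_op i s x : S s ->
  'D_v (fun s => M (u s) (b s) x 0 i) s = M (u s) (vdir v b s) x 0 i +
   \sum_m \sum_n mu m n * (dvel w m (u s) (vdir v u s) x i * Defs.dinv (pvel n (u s) (b s)) x +
     vel m (u s) x i * Defs.dinv (dpvel n (u s) (vdir v u s) (b s)) x).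
Proof.
move=> Ss; have [_ su _] := fu.
have cW m := cfam_vel w_smooth oS fu m i.
have sdb n := sfam_dinv_pvel w_smooth fr oS fu n cb.
have cpb n := cfam_pvel w_smooth oS fu n cb.
have sb j : sfam S (fun s x => dx (b s) j x) by apply: (sfam_derive1 oS); case: (cb j).
have E : (fun s => M (u s) (b s) x 0 i) = (fun s => \sum_j eta i j * dx (b s) j x +
  \sum_m \sum_n mu m n * (vel m (u s) x i * Defs.dinv (pvel n (u s) (b s)) x)).
  by apply/funext => s'; rewrite nonlocal_opE.
have d1 j : differentiable (fun s => eta i j * dx (b s) j x) s.
  by apply: differentiable_mul; [exact: differentiable_cst | exact: (slice_diff fr oS x (sb j))].
have dd m n : differentiable (fun s => vel m (u s) x i * Defs.dinv (pvel n (u s) (b s)) x) s.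
  apply: (slice_diff fr oS x
    (f := fun s x => vel m (u s) x i * Defs.dinv (pvel n (u s) (b s)) x)) => //.
  by apply: sfamM => //; exact: cfam_sfam (cW m).
have d2 m n : differentiable (fun s => mu m n * (vel m (u s) x i *
    Defs.dinv (pvel n (u s) (b s)) x)) s.
  by apply: differentiable_mul; [exact: differentiable_cst | exact: dd].
have d3 m : differentiable (fun s => \sum_n mu m n * (vel m (u s) x i *
    Defs.dinv (pvel n (u s) (b s)) x)) s.
  by have [_] := @derive_big _ _ _ (index_enum _) xpredT _ v s (fun n _ => d2 m n).
have [e1 d1'] := @derive_big _ _ _ (index_enum _) xpredT _ v s (fun j _ => d1 j).
have [e3 d3'] := @derive_big _ _ _ (index_enum _) xpredT _ v s (fun m _ => d3 m).
rewrite E derive_add // e1 e3.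
rewrite nonlocal_opE -addrA; congr (_ + _).
  apply: eq_bigr => j _.
  rewrite (@derive_mul _ _ (fun=> eta i j)); [|exact: differentiable_cst|
    exact: (slice_diff fr oS x (sb j))].
  rewrite derive_cst mul0r add0r (derive_dx oS v j x _ Ss) //.
  by move=> k; case: (cb k).
rewrite -big_split; apply: eq_bigr => m _ /=.
rewrite (proj1 (derive_big _ v (fun n _ => d2 m n))) -big_split.
apply: eq_bigr => n _ /=; rewrite -mulrDr.
rewrite (@derive_mul _ _ (fun=> mu m n)); [|exact: differentiable_cst|exact: dd].
rewrite derive_cst mul0r add0r; congr (_ * _).
rewrite (@derive_mul _ _ (fun s => vel m (u s) x i)
  (fun s => Defs.dinv (pvel n (u s) (b s)) x)); last 2 first.
- exact: (slice_diff fr oS x (cfam_sfam (cW m))).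
- exact: (slice_diff fr oS x (sdb n)).
rewrite (derive_vel w_smooth fr oS fu) // (derive_dinv fr oS v x (cpb n) Ss).
rewrite addrCA; congr (_ + _); rewrite -mulrDr; congr (_ * _).
have cdb := vcfam_vdir oS v cb.
rewrite addrC -dinvD.
- by congr Defs.dinv; apply/funext => y; rewrite (derive_pvel w_smooth fr oS fu).
- apply: (cfam_tst fr _ Ss (f := fun s => dpvel n (u s) (vdir v u s) (b s))).
  apply: cfam_sum => // k _; apply: cfamMr => //; last by case: (cb k).
  exact: (cfam_dvel w_smooth fr oS fu).
- exact: (cfam_tst fr (cfam_pvel w_smooth oS fu n cdb) Ss).
Qed.

(** One contribution each from a, b and the operator. Skewness brings the derivative of b into the
    first slot, where it no longer stands under the operator. *)
Lemma derive_oform s : S s ->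
  'D_v (fun s => oform (u s) (a s) (b s)) s = oform (u s) (vdir v a s) (b s)
   - oform (u s) (vdir v b s) (a s) + vform (u s) (vdir v u s) (a s) (b s).
Proof.
move=> Ss; have [fus su _] := fu.
have cda := vcfam_vdir oS v ca; have cdb := vcfam_vdir oS v cb.
have cM := vcfam_op eta mu w_smooth fr oS fu cb.
have vt (z : V -> R -> 'rV[R]_N) : vcfam S z -> vtst (z s).
  by move=> cz i; exact: (cfam_tst fr (cz i) Ss).
have fs := fus _ Ss.
have tdW m k : tst (dvel w m (u s) (vdir v u s) ^~ k).
  exact: (cfam_tst fr (cfam_dvel w_smooth fr oS fu v m k) Ss).
have tpd m (z : V -> R -> 'rV[R]_N) : vcfam S z ->
    tst (dpvel m (u s) (vdir v u s) (z s)).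
  move=> cz; apply: tst_sum => k _; apply: tstMr => //; exact: vtst_vsm (vt _ cz) k.
have tpvel m (z : V -> R -> 'rV[R]_N) : vcfam S z -> tst (pvel m (u s) (z s)).
  by move=> cz; exact: (tst_pvel w_smooth fs m (vt _ cz)).
rewrite [LHS](derive_lint fr oS v (cfam_dot oS ca cM) Ss).
transitivity (lint (fun x => dot (vdir v a s) (M (u s) (b s)) x +
  dot (a s) (M (u s) (vdir v b s)) x +
  \sum_m \sum_n mu m n * (dpvel m (u s) (vdir v u s) (a s) x *
     Defs.dinv (pvel n (u s) (b s)) x +
    pvel m (u s) (a s) x * Defs.dinv (dpvel n (u s) (vdir v u s) (b s)) x))).
  congr lint; apply/funext => x; rewrite (proj1 (derive_big _ v _)); last first.
    move=> i _; apply: (slice_diff fr oS x (f := fun s x => a s x 0 i * M (u s) (b s) x 0 i)) => //.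
    by apply: sfamM => //; [case: (ca i) | case: (cM i)].
  transitivity (\sum_i (vdir v a s x 0 i * M (u s) (b s) x 0 i + a s x 0 i *
    M (u s) (vdir v b s) x 0 i + \sum_m \sum_n mu m n * (a s x 0 i *
      dvel w m (u s) (vdir v u s) x i * Defs.dinv (pvel n (u s) (b s)) x +
     a s x 0 i * vel m (u s) x i * Defs.dinv (dpvel n (u s) (vdir v u s) (b s)) x))).
    apply: eq_bigr => i _.
    rewrite (@derive_mul _ _ (fun s => a s x 0 i) (fun s => M (u s) (b s) x 0 i)).
    - rewrite derive_nonlocal_op // mulrDr addrA; congr (_ * _ + _ + _).
        by rewrite [RHS]mxE.
      rewrite mulr_sumr; apply: eq_bigr => m _; rewrite mulr_sumr.
      by apply: eq_bigr => n _; ring.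
    - by apply: (slice_diff fr oS x (f := fun s x => a s x 0 i)) => //; case: (ca i).
    - by apply: (slice_diff fr oS x (f := fun s x => M (u s) (b s) x 0 i)) => //; case: (cM i).
  rewrite !big_split /=; congr (_ + _).
  rewrite exchange_big; apply: eq_bigr => m _ /=.
  rewrite exchange_big; apply: eq_bigr => n _ /=.
  rewrite -mulr_sumr big_split /= -!mulr_suml; congr (_ * (_ * _ + _ * _)).
    by apply: eq_bigr => i _; rewrite mulrC.
  by apply: eq_bigr => i _; rewrite mulrC.
have tM (z : V -> R -> 'rV[R]_N) : vcfam S z -> vtst (M (u s) (z s)).
  by move=> cz; apply: (vtst_op eta mu w_smooth fs); exact: vt.
have t1 m n : tst (fun x => dpvel m (u s) (vdir v u s) (a s) x *
     Defs.dinv (pvel n (u s) (b s)) x).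
  by apply: tstMr; [exact: tpd | apply: sm_dinv; exact: tpvel].
have t2 m n : tst (fun x => pvel m (u s) (a s) x *
     Defs.dinv (dpvel n (u s) (vdir v u s) (b s)) x).
  by apply: tstMr; [exact: tpvel | apply: sm_dinv; exact: tpd].
have t3 m n := tstMl (sm_cst (mu m n)) (tstD (t1 m n) (t2 m n)).
have td (y z : V -> R -> 'rV[R]_N) : vcfam S y -> vcfam S z -> tst (dot (y s) (M (u s) (z s))).
  by move=> cy cz; apply: tst_dot; [exact: vt | apply: vtst_vsm; exact: tM].
rewrite lintD; [|apply: tstD; exact: td|by do 2 (apply: tst_sum => ? _)].
rewrite lintD; [|exact: td|exact: td].
rewrite -addrA -[RHS]addrA; congr (_ + _); congr (_ + _).
  by apply: (oform_skew eta_sym mu_sym w_smooth fs); exact: vt.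
rewrite lint_sum; last by move=> ? _; apply: tst_sum.
transitivity (\sum_m \sum_n (mu m n * lint (fun x => dpvel m (u s) (vdir v u s) (a s) x *
     Defs.dinv (pvel n (u s) (b s)) x) +
   mu m n * lint (fun x => pvel m (u s) (a s) x *
     Defs.dinv (dpvel n (u s) (vdir v u s) (b s)) x))).
  apply: eq_bigr => m _; rewrite lint_sum //; apply: eq_bigr => n _.
  by rewrite lintZ ?lintD ?mulrDr //; exact: tstD.
rewrite sum2D /vform.
transitivity (\sum_m \sum_n mu m n * lint (fun x => dpvel m (u s) (vdir v u s) (a s) x *
     Defs.dinv (pvel n (u s) (b s)) x) +
  \sum_m \sum_n - (mu m n * lint (fun x => dpvel m (u s) (vdir v u s) (b s) x *
     Defs.dinv (pvel n (u s) (a s)) x))); last first.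
  rewrite -sum2D; apply: eq_bigr => m _; apply: eq_bigr => n _.
  by rewrite mulrBr.
(* In the variation of b_n the antiderivative is moved to the other factor, at the cost of a sign,
   and m and n trade places; this produces the second half of [vform]. *)
congr (_ + _); rewrite exchange_big; apply: eq_bigr => n _; apply: eq_bigr => m _.
have -> : mu m n = mu n m by rewrite -[in LHS]mu_sym mxE.
rewrite -mulrN; congr (_ * _).
rewrite lint_dinv_skew; [|exact: tpvel|exact: tpd].
by congr (- lint _); apply/funext => x; rewrite mulrC.
Qed.

End Direction.

End Family.

End Bracket.

(** * The Jacobi identity as a trilinear identity *)

Section Jacobi.
Context {R : realType} {N L : nat}.
Variables (U : set 'rV[R]_N) (eta : 'M[R]_N) (mu : 'M[R]_L).
Variable w : 'I_L -> 'rV[R]_N -> 'M[R]_N.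
Hypotheses (openU : open U) (eta_sym : eta^T = eta) (mu_sym : mu^T = mu).
Hypothesis w_smooth : forall n i j, smooth_on U (fun u => w n u i j).

Local Notation M := (nonlocal_op eta mu w).
Local Notation oform := (oform eta mu w).
Local Notation vform := (vform mu w).
Local Notation vcov := (vcov mu w).

Lemma vcfam_cst (V : normedModType R) (S : set V) (z : R -> 'rV[R]_N) : open S ->
  vtst z -> vcfam S (fun=> z).
Proof.
move=> oS tz i; have [sz [A sA]] := tz i; split.
  apply: (smooth_on_comp (fr := real_frame) (B := [set: R])
    (g := fun p : V * R => p.2) (open_setXT oS) _ sz) => // j.
  exact: smooth_on_sndR.
by move=> s0 _; exists A; near=> s; exact: sA.
Unshelve. all: by end_near. Qed.

(** A constant family over an idle real parameter is perturbed along phi; the line is the slice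
    where the idle parameter is 0. *)
Lemma line_family u phi : is_field U u -> vtst phi ->
  exists S : set R, [/\ open S, S 0 &
    field_family U S (fun e x => u x + e *: phi x)].
Proof.
move=> fu tp; have ff := field_family_const fu.
have pf := perturb_prefamily real_frame openT ff (vcfam_const tp).
have oTT := @open_setXT R R _ openT.
have ff2 := prefamily_family (pair_frame real_frame real_frame) U oTT pf.
set S2 := valued _ _ _ in ff2.
have oS2 : open S2 by exact: open_interior.
have sg (S : set R) j :
    smooth_on S (fun e : R => fco (pair_frame real_frame real_frame) j ((0 : R), e)).
  apply: (@smooth_on_pair _ _ _ _ real_frame real_frame S (fun=> (0 : R)) id) => l.
    exact: smooth_on_cst.
  by have := @smooth_on_co R R real_frame S l.
pose S : set R := (fun e : R => ((0 : R), e)) @^-1` S2.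
have oS : open S.
  by apply: open_comp oS2 => e _; apply: (smooth_coords_continuous (S := [set: R]) (sg _)).
exists S; split=> //.
  apply: prefamily_valued => // x /=; rewrite scale0r addr0.
  by have [_ Uu _] := fu.
exact: (field_family_pull real_frame oS (sg S) (T := S2) _ ff2).
Qed.

Lemma plane_family u phi psi : is_field U u -> vtst phi -> vtst psi ->
  exists S : set (R * R), [/\ open S, S (0, 0) &
    field_family U S (fun p x => u x + p.1 *: phi x + p.2 *: psi x)].
Proof.
move=> fu tp ts; have [S1 [oS1 S10 ff]] := line_family fu tp.
have pf := perturb_prefamily real_frame oS1 ff (vcfam_cst oS1 ts).
have oS1T := @open_setXT R R _ oS1.
have ff2 := prefamily_family (pair_frame real_frame real_frame) U oS1T pf.
eexists; split; last exact: ff2; first exact: open_interior.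
apply: prefamily_valued => // x /=; rewrite !scale0r !addr0.
by have [_ Uu _] := fu.
Qed.

(** [is_var_deriv] differentiates at e = 0 only. Applied at the translated field u + a phi, it
    yields the derivative at a. *)
Lemma is_derive_translate (f : R -> R) a d :
  is_derive (0 : R) (1 : R) (fun e => f (a + e)) d -> is_derive a (1 : R) f d.
Proof.
have E : (fun h : R => h^-1 *: (((fun e => f (a + e)) \o shift 0) (h *: 1) - f (a + 0)))
   = (fun h : R => h^-1 *: ((f \o shift a) (h *: 1) - f a)).
  by apply/funext => h /=; rewrite !addr0 [a + _]addrC.
by move=> [d1 d2]; split; [move: d1; rewrite /derivable E | rewrite -d2 /derive E].
Qed.

Section SecondVariation.
Variables (I : (R -> 'rV[R]_N) -> R) (xi : (R -> 'rV[R]_N) -> R -> 'rV[R]_N).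
Hypothesis Ixi : is_var_deriv U I xi.

Lemma var_deriv_vtst u : is_field U u -> vtst (xi u).
Proof.
move=> fu i; have [cxi _] := Ixi.
have := covector_family real_frame openT cxi (field_family_const fu) i.
by move=> cf; exact: (cfam_tst real_frame cf (s := 0)).
Qed.

Lemma dcov_vtst u phi : is_field U u -> vtst phi -> vtst (dcov xi u phi).
Proof.
move=> fu tp i; have [cxi _] := Ixi.
have := dcov_family real_frame openU openT cxi (field_family_const fu) (vcfam_const tp) i.
by move=> cf; exact: (cfam_tst real_frame cf (s := 0)).
Qed.

(* Schwarz for (s, t) |-> I (u + s phi + t psi). *)
Lemma second_variation u phi psi : is_field U u -> vtst phi -> vtst psi ->
  lint (dot (dcov xi u phi) psi) = lint (dot (dcov xi u psi) phi).
Proof.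
move=> fu tp ts; have [cxi dI] := Ixi.
have [S [oS S0 ff]] := plane_family fu tp ts.
set W := (X in field_family _ _ X) in ff.
pose pf := pair_frame (@real_frame R) (@real_frame R).
have cx := covector_family pf oS cxi ff.
have cF z : vtst z -> cfam S (fun p x => dot (xi (W p)) z x).
  by move=> tz; exact: (cfam_dot oS cx (vcfam_cst oS tz)).
(* By [is_var_deriv], [F phi] and [F psi] are the two first partial derivatives of (s, t) |-> I (W
   (s, t)). *)
pose F z p := lint (dot (xi (W p)) z).
have sF z : vtst z -> smooth_on S (F z) by move=> tz; exact: (smooth_lint pf oS (cF z tz)).
have dF z : vtst z -> forall v, 'D_v (F z) (0, 0) =
    lint (fun x => \sum_i 'D_v (fun p => xi (W p) x 0 i) (0, 0) * z x 0 i).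
  move=> tz v; rewrite [LHS](derive_lint pf oS v (cF z tz) S0).
  congr lint; apply/funext => x; rewrite /dot.
  have di i : differentiable (fun p => xi (W p) x 0 i) (0, 0).
    exact: (slice_diff pf oS x (cfam_sfam (cx i)) S0).
  rewrite (proj1 (@derive_big _ _ _ (index_enum _) xpredT
    (fun i p => xi (W p) x 0 i * z x 0 i) v (0, 0) _)).
    apply: eq_bigr => i _.
    rewrite (@derive_mul _ _ (fun p => xi (W p) x 0 i) (fun=> z x 0 i)) //.
      by rewrite derive_cst mulr0 addr0.
  move=> i _; apply: (@differentiable_mul _ _ (fun p => xi (W p) x 0 i) (fun=> z x 0 i)) => //.
have -> : lint (dot (dcov xi u phi) psi) = 'D_(1, 0) (F psi) (0, 0).
  rewrite dF //; congr lint; apply/funext => x; apply: eq_bigr => i _.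
  rewrite mxE; congr (_ * _).
  rewrite derive1E -(derive_slice (fun a b => xi (W (a, b)) x 0 i)).
  apply: (congr1 (fun g : R -> R => 'D_(1 : R) g 0)); apply/funext => e.
  congr (xi _ _ _ _); apply/funext => y.
  by rewrite /W /= scale0r addr0.
have -> : lint (dot (dcov xi u psi) phi) = 'D_(0, 1) (F phi) (0, 0).
  rewrite dF //; congr lint; apply/funext => x; apply: eq_bigr => i _.
  rewrite mxE; congr (_ * _).
  rewrite -(derive1_slice (fun a b => xi (W (a, b)) x 0 i)).
  apply: (congr1 (fun g : R -> R => derive1 g 0)); apply/funext => e.
  congr (xi _ _ _ _); apply/funext => y.
  by rewrite /W /= scale0r addr0.
have /nbhs_ballP[r /= r0 Hr] := open_near oS S0.
have cS z v : vtst z -> {for ((0, 0) : R * R), continuous (fun p : R * R => 'D_v (F z) (p.1, p.2))}.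
  move=> tz; have sD := smooth_on_derive v (sF z tz).
  rewrite (_ : (fun p : R * R => _) = 'D_v (F z)); last by apply/funext => -[].
  exact: (smooth_on_continuous sD S0).
symmetry.
apply: (@mixed_partials _ (fun a b => I (W (a, b))) (fun a b => F phi (a, b))
 (fun a b => F psi (a, b)) (fun a b => 'D_(0, 1) (F phi) (a, b))
 (fun a b => 'D_(1, 0) (F psi) (a, b)) r r0); last 2 first.
- exact: cS.
- exact: cS.
move=> a b ha hb.
have Sab : S (a, b) by apply: Hr; split; rewrite /ball /= sub0r normrN.
have fab : is_field U (W (a, b)) by have [h _ _] := ff; exact: h.
split.
- apply: is_derive_translate.
  have := dI (W (a, b)) phi fab (proj2 (is_testP _) tp).
  congr (is_derive _ _ _ _); apply/funext => e; congr I; apply/funext => x.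
  by rewrite /W /= scalerDl addrA -!addrA; congr (_ + (_ + _)); rewrite addrC.
- apply: is_derive_translate.
  have := dI (W (a, b)) psi fab (proj2 (is_testP _) ts).
  congr (is_derive _ _ _ _); apply/funext => e; congr I; apply/funext => x.
  by rewrite /W /= scalerDl addrA.
- have E t : ((a, 0) : R * R) + t *: ((0, 1) : R * R) = (a, t).
    by transitivity (a + t * 0, 0 + t * 1); rewrite // mulr0 addr0 add0r mulr1.
  have Ef : (fun t => F phi (((a, 0) : R * R) + t *: ((0, 1) : R * R))) =
      (fun t => F phi (a, t)) by apply/funext => t; rewrite E.
  rewrite -Ef -(E b); apply: is_derive_line; rewrite E; apply: diff_derivable.
  exact: (smooth_on_diff (sF _ tp) Sab).
- have E t : ((0, b) : R * R) + t *: ((1, 0) : R * R) = (t, b).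
    by transitivity (0 + t * 1, b + t * 0); rewrite // mulr0 addr0 add0r mulr1.
  have Ef : (fun t => F psi (((0, b) : R * R) + t *: ((1, 0) : R * R))) =
      (fun t => F psi (t, b)) by apply/funext => t; rewrite E.
  rewrite -Ef -(E a); apply: is_derive_line; rewrite E; apply: diff_derivable.
  exact: (smooth_on_diff (sF _ ts) Sab).
Qed.

End SecondVariation.

End Jacobi.

(** * From brackets of functionals to the cyclic sum *)

Section Hamiltonian.
Context {R : realType} {N L : nat}.
Variables (U : set 'rV[R]_N) (eta : 'M[R]_N) (mu : 'M[R]_L).
Variable w : 'I_L -> 'rV[R]_N -> 'M[R]_N.
Hypotheses (openU : open U) (eta_sym : eta^T = eta) (mu_sym : mu^T = mu).
Hypothesis w_smooth : forall n i j, smooth_on U (fun u => w n u i j).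

Local Notation M := (nonlocal_op eta mu w).
Local Notation oform := (oform eta mu w).
Local Notation vform := (vform mu w).
Local Notation vcov := (vcov mu w).
Implicit Types (xi ze : (R -> 'rV[R]_N) -> R -> 'rV[R]_N).

Lemma is_derive_affine (c d : R) : is_derive (0 : R) (1 : R) (fun s => c + s * d) d.
Proof.
have di : differentiable (fun s : R => s) 0 by exact: (sm_diff 0 sm_id).
have dd : differentiable (fun s : R => s * d) 0.
  by apply: (differentiable_mul di); exact: (differentiable_cst d).
have dc : differentiable (fun=> c : R) (0 : R) by exact: (differentiable_cst c).
split; first by apply: diff_derivable; exact: differentiable_add.
rewrite (derive_add _ dc dd) derive_cst add0r (derive_mul _ di (differentiable_cst d _)).
by rewrite derive_cst mulr0 addr0 derive_id mul1r.
Qed.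

Lemma lint_dotD (a b c : R -> 'rV[R]_N) : vtst a -> vtst b -> vsm c ->
  lint (dot (fun x => a x + b x) c) = lint (dot a c) + lint (dot b c).
Proof.
move=> ta tb sc; rewrite -lintD; [|exact: tst_dot|exact: tst_dot].
congr lint; apply/funext => x; rewrite /dot -big_split; apply: eq_bigr => i _.
by rewrite mxE mulrDl.
Qed.

Lemma lint_dotN (a c : R -> 'rV[R]_N) : vtst a -> vsm c ->
  lint (dot (fun x => - a x) c) = - lint (dot a c).
Proof.
move=> ta sc; rewrite -lintN; last exact: tst_dot.
congr lint; apply/funext => x; rewrite /dot -sumrN; apply: eq_bigr => i _.
by rewrite mxE mulNr.
Qed.

Lemma vtstD (a b : R -> 'rV[R]_N) : vtst a -> vtst b -> vtst (fun x => a x + b x).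
Proof.
by move=> ta tb i; apply: (eq_tst _ (tstD (ta i) (tb i))) => x; rewrite mxE.
Qed.

Lemma vtstN (a : R -> 'rV[R]_N) : vtst a -> vtst (fun x => - a x).
Proof. by move=> ta i; apply: (eq_tst _ (tstN (ta i))) => x; rewrite mxE. Qed.

(** What the derivative of the bracket along phi becomes once phi is freed: from the second
    variations by their symmetry, from the operator by [vcov]. *)
Definition brcov xi ze (u : R -> 'rV[R]_N) (x : R) : 'rV[R]_N :=
  dcov xi u (M u (ze u)) x + - dcov ze u (M u (xi u)) x + vcov u (xi u) (ze u) x.

Section Pair.
Variables (I J : (R -> 'rV[R]_N) -> R) (xi ze : (R -> 'rV[R]_N) -> R -> 'rV[R]_N).
Hypotheses (Ixi : is_var_deriv U I xi) (Jze : is_var_deriv U J ze).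

Lemma vcov_vtst u a b : is_field U u -> vtst a -> vtst b -> vtst (vcov u a b).
Proof.
move=> fu ta tb i.
have cf := vcfam_vcov mu w_smooth real_frame openT (field_family_const fu)
  (vcfam_const ta) (vcfam_const tb) i.
exact: (cfam_tst real_frame cf (s := 0)).
Qed.

Lemma lint_brcov u phi : is_field U u -> vtst phi ->
  lint (dot (brcov xi ze u) phi) =
  lint (dot (dcov xi u (M u (ze u))) phi) - lint (dot (dcov ze u (M u (xi u))) phi)
  + vform u phi (xi u) (ze u).
Proof.
move=> fu tp; have tx := var_deriv_vtst Ixi fu; have tz := var_deriv_vtst Jze fu.
have tMx := vtst_op eta mu w_smooth fu tx; have tMz := vtst_op eta mu w_smooth fu tz.
have t1 := dcov_vtst openU Ixi fu tMz; have t2 := dcov_vtst openU Jze fu tMx.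
have t3 := vcov_vtst fu tx tz; have sp := vtst_vsm tp.
rewrite (@lint_dotD (fun x => dcov xi u (M u (ze u)) x + - dcov ze u (M u (xi u)) x)) //;
  last by apply: vtstD => //; exact: vtstN.
rewrite (vform_adj _ w_smooth fu) //; congr (_ + _).
by rewrite (lint_dotD t1 (vtstN t2) sp) lint_dotN.
Qed.

Lemma brcov_covector : is_covector U (brcov xi ze).
Proof.
apply: vcfam_covector => k S u oS fu; have [cxi _] := Ixi; have [cze _] := Jze.
pose fr := rv_frame (R := R) k.
have cx := covector_family fr oS cxi fu; have cz := covector_family fr oS cze fu.
have cMx := vcfam_op eta mu w_smooth fr oS fu cx.
have cMz := vcfam_op eta mu w_smooth fr oS fu cz.
have c1 := dcov_family fr openU oS cxi fu cMz.
have c2 := dcov_family fr openU oS cze fu cMx.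
have c3 := vcfam_vcov mu w_smooth fr oS fu cx cz.
move=> i; apply: (cfam_ext oS _ (cfamD oS (cfamD oS (c1 i) (cfamN oS (c2 i))) (c3 i))).
by move=> s x _; rewrite /brcov !mxE.
Qed.

Lemma brcov_var_deriv : is_var_deriv U (fun u => oform u (xi u) (ze u)) (brcov xi ze).
Proof.
split; first exact: brcov_covector.
move=> u phi fu /is_testP tp; have [cxi _] := Ixi; have [cze _] := Jze.
have [S [oS S0 ff]] := line_family openU fu tp.
have cx := covector_family real_frame oS cxi ff.
have cz := covector_family real_frame oS cze ff.
have sb := smooth_oform eta mu w_smooth real_frame oS ff cx cz.
have u0 : (fun x => u x + 0 *: phi x) = u.
  by apply/funext => x; rewrite scale0r addr0.
have tx := var_deriv_vtst Ixi fu; have tz := var_deriv_vtst Jze fu.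
have tMx := vtst_op eta mu w_smooth fu tx; have tMz := vtst_op eta mu w_smooth fu tz.
have vdE y : vdir (1 : R) (fun s : R => y (fun x => u x + s *: phi x)) 0 = dcov y u phi.
  by apply/funext => x; apply/rowP => i; rewrite !mxE derive1E.
have vdu : vdir (1 : R) (fun (s : R) x => u x + s *: phi x) 0 = phi.
  apply/funext => x; apply/rowP => i; rewrite !mxE.
  have -> : (fun s => (u x + s *: phi x) 0 i) = (fun s => u x 0 i + s * phi x 0 i).
    by apply/funext => s; rewrite !mxE.
  by have [_ ->] := is_derive_affine (u x 0 i) (phi x 0 i).
have := derive_oform eta_sym mu_sym w_smooth real_frame oS ff cx cz 1 S0.
rewrite (vdE xi) (vdE ze) vdu u0 => dE.
have db : derivable (fun e : R => oform (fun x => u x + e *: phi x)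
   (xi (fun x => u x + e *: phi x)) (ze (fun x => u x + e *: phi x))) 0 1.
  by apply: diff_derivable; exact: (smooth_on_diff sb S0).
have -> : \int[lebesgue_measure]_x \sum_(i < N) brcov xi ze u x 0 i * phi x 0 i =
   'D_1 (fun e : R => oform (fun x => u x + e *: phi x)
   (xi (fun x => u x + e *: phi x)) (ze (fun x => u x + e *: phi x))) 0.
  rewrite dE; rewrite -[LHS]/(lint (dot (brcov xi ze u) phi)) lint_brcov //.
  (* The covectors varied along phi and paired with values of the operator are turned into covectors
     varied along those values and paired with phi. *)
  by rewrite (second_variation openU Ixi fu tMz tp) (second_variation openU Jze fu tMx tp).
exact: derivableP.
Qed.

End Pair.

(** The difference of two candidates is itself a test function, and pairing with it gives the
    integral of its square. This identifies the chosen [var_deriv] with any explicit one on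
    fields. *)
Lemma var_deriv_unique I xi xi' u : is_var_deriv U I xi -> is_var_deriv U I xi' ->
  is_field U u -> xi u = xi' u.
Proof.
move=> Ix Ix' fu; have tx := var_deriv_vtst Ix fu; have tx' := var_deriv_vtst Ix' fu.
pose z x := xi u x + - xi' u x.
have tz : vtst z := vtstD tx (vtstN tx').
have E : lint (dot (xi u) z) = lint (dot (xi' u) z).
  have [_ /(_ u z fu (proj2 (is_testP _) tz))[_ d1]] := Ix.
  have [_ /(_ u z fu (proj2 (is_testP _) tz))[_ d2]] := Ix'.
  by rewrite -[LHS]d1 -[RHS]d2.
have z0 : lint (dot z z) = 0.
  have sz := vtst_vsm tz.
  by rewrite (lint_dotD tx (vtstN tx') sz) lint_dotN // E subrr.
have tzz : tst (dot z z) by apply: tst_dot => //; exact: vtst_vsm.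
have pz x : 0 <= dot z z x by apply: sumr_ge0 => i _; exact: sqr_ge0.
apply/funext => x; apply/rowP => i.
have := lint_eq0 tzz pz z0 x => /eqP; rewrite psumr_eq0; last first.
  by move=> j _; exact: sqr_ge0.
move=> /allP/(_ i); rewrite mem_index_enum => /(_ isT) /=.
by rewrite mulf_eq0 orbb /z mxE [X in _ + X]mxE subr_eq0 => /eqP.
Qed.

Lemma functionalP I : is_functional U I -> is_var_deriv U I (var_deriv U I).
Proof. by move=> [xi Ixi]; exact: (xgetPex _ (ex_intro _ xi Ixi)). Qed.

Lemma bracket_functional I J : is_functional U I -> is_functional U J ->
  is_functional U (bracket U M I J).
Proof.
move=> /functionalP dI /functionalP dJ; exists (brcov (var_deriv U I) (var_deriv U J)).
exact: (brcov_var_deriv dI dJ).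
Qed.

Definition jacobiator u a b c : R :=
  vform u (M u c) a b + vform u (M u a) b c + vform u (M u b) c a.

Lemma bracket_bracket I J K u : is_functional U I -> is_functional U J ->
  is_functional U K -> is_field U u ->
  bracket U M (bracket U M I J) K u =
    lint (dot (dcov (var_deriv U I) u (M u (var_deriv U J u))) (M u (var_deriv U K u)))
    - lint (dot (dcov (var_deriv U J) u (M u (var_deriv U I u))) (M u (var_deriv U K u)))
    + vform u (M u (var_deriv U K u)) (var_deriv U I u) (var_deriv U J u).
Proof.
move=> fI fJ fK fu; have dI := functionalP fI; have dJ := functionalP fJ.
have dK := functionalP fK.
have dIJ := functionalP (bracket_functional fI fJ).
rewrite -(lint_brcov dI dJ fu); last first.
  by apply: (vtst_op eta mu w_smooth fu); exact: (var_deriv_vtst dK fu).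
rewrite -(var_deriv_unique dIJ (brcov_var_deriv dI dJ) fu).
by [].
Qed.

(** Each of the three functionals contributes its second variation twice, with the two arguments
    exchanged and with opposite signs. *)
Lemma cyclic_cancel (b1 b2 b3 A A' B B' C C' t1 t2 t3 : R) :
  b1 = A - B + t1 -> b2 = B' - C + t2 -> b3 = C' - A' + t3 ->
  A = A' -> B = B' -> C = C' -> b1 + b2 + b3 = t1 + t2 + t3.
Proof. by move=> -> -> -> -> -> ->; ring. Qed.

Lemma bracket_jacobi I J K u : is_functional U I -> is_functional U J ->
  is_functional U K -> is_field U u ->
  bracket U M (bracket U M I J) K u + bracket U M (bracket U M J K) I u
   + bracket U M (bracket U M K I) J u =
  jacobiator u (var_deriv U I u) (var_deriv U J u) (var_deriv U K u).
Proof.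
move=> fI fJ fK fu.
have dI := functionalP fI; have dJ := functionalP fJ; have dK := functionalP fK.
have tM I' : is_functional U I' -> vtst (M u (var_deriv U I' u)).
  by move=> /functionalP d; apply: (vtst_op eta mu w_smooth fu); exact: (var_deriv_vtst d fu).
exact: (cyclic_cancel (bracket_bracket fI fJ fK fu) (bracket_bracket fJ fK fI fu)
  (bracket_bracket fK fI fJ fu) (second_variation openU dI fu (tM J fJ) (tM K fK))
  (second_variation openU dJ fu (tM I fI) (tM K fK))
  (second_variation openU dK fu (tM J fJ) (tM I fI))).
Qed.

Lemma linear_var_deriv a : vtst a ->
  is_var_deriv U (fun u => lint (dot a u)) (fun _ => a).
Proof.
move=> ta; split.
  by apply: vcfam_covector => k S u oS fu; exact: vcfam_cst.
move=> u phi [su _ _] /is_testP tp.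
have t1 : tst (dot a u) by apply: tst_dot.
have t2 : tst (dot a phi) by apply: tst_dot => //; exact: vtst_vsm.
have E : (fun e : R => lint (dot a (fun x => u x + e *: phi x))) =
    (fun e => lint (dot a u) + e * lint (dot a phi)).
  apply/funext => e; rewrite -lintZ // -lintD //; last by apply: tstMl => //; exact: sm_cst.
  congr lint; apply/funext => x; rewrite /dot mulr_sumr -big_split.
  by apply: eq_bigr => i _; rewrite !mxE mulrDr /= [in RHS]mulrCA.
rewrite E -[X in is_derive _ _ _ X]/(lint (dot a phi)).
exact: is_derive_affine.
Qed.

Lemma hamiltonianP : hamiltonian U M <->
  forall u a b c, is_field U u -> vtst a -> vtst b -> vtst c -> jacobiator u a b c = 0.
Proof.
split=> [[_ _ J] u a b c fu ta tb tc|H].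
  have f z : vtst z -> is_functional U (fun u => lint (dot z u)).
    by move=> tz; exists (fun=> z); exact: linear_var_deriv.
  have vd z : vtst z -> var_deriv U (fun u => lint (dot z u)) u = z.
    move=> tz.
    exact: (var_deriv_unique (functionalP (f _ tz)) (linear_var_deriv tz) fu).
  have := J _ _ _ _ (f _ ta) (f _ tb) (f _ tc) fu.
  by rewrite bracket_jacobi ?vd //; exact: f.
split.
- exact: bracket_functional.
- move=> I J u /functionalP dI /functionalP dJ fu.
  apply: (oform_skew eta_sym mu_sym w_smooth fu); first exact: (var_deriv_vtst dI fu).
  exact: (var_deriv_vtst dJ fu).
- move=> I J K u fI fJ fK fu; rewrite bracket_jacobi //.
  by apply: H => //; apply: var_deriv_vtst fu; exact: functionalP.
Qed.

End Hamiltonian.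

(** * Flatness implies the Jacobi identity *)

Section Conditions.
Context {R : realType} {N L : nat}.
Variables (eta : 'M[R]_N) (mu : 'M[R]_L) (w : 'I_L -> 'rV[R]_N -> 'M[R]_N).

(* The conditions of the theorem in terms of w alone, for w n = eta * hess (psi n). *)
Definition flat_at (p : 'rV[R]_N) : Prop :=
  [/\ forall n, (w n p *m eta)^T = w n p *m eta,
      forall n i k l, partial l (fun q => w n q i k) p = partial k (fun q => w n q i l) p,
      forall m n, w m p *m w n p = w n p *m w m p
    & forall i j k l, \sum_m \sum_n mu m n *
        (w m p i k * w n p j l - w m p j k * w n p i l) = 0].

End Conditions.

(** * Pointwise cancellation in the cyclic sum *)

Section Algebra.
Context {R : realType} {N L : nat}.
Implicit Types (A B : 'M[R]_N) (a v : 'I_N -> R).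

Definition bil A a v : R := \sum_i \sum_k a i * A i k * v k.

Lemma bilD A a v v' : bil A a (fun k => v k + v' k) = bil A a v + bil A a v'.
Proof.
rewrite -big_split; apply: eq_bigr => i _; rewrite -big_split.
by apply: eq_bigr => k _ /=; rewrite mulrDr.
Qed.

Lemma bilZ A a c v : bil A a (fun k => c * v k) = c * bil A a v.
Proof.
rewrite mulr_sumr; apply: eq_bigr => i _; rewrite mulr_sumr.
by apply: eq_bigr => k _; ring.
Qed.

Lemma bil_sum A a (I : finType) (v : I -> 'I_N -> R) :
  bil A a (fun k => \sum_p v p k) = \sum_p bil A a (v p).
Proof.
rewrite exchange_big; apply: eq_bigr => i _; rewrite exchange_big.
by apply: eq_bigr => k _; rewrite mulr_sumr.
Qed.

Lemma bil_mul A B a v : bil A a (fun i => \sum_k B i k * v k) = bil (A *m B) a v.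
Proof.
apply: eq_bigr => i _.
under [RHS]eq_bigr do rewrite mxE mulr_sumr mulr_suml.
rewrite [RHS]exchange_big; apply: eq_bigr => k _.
by rewrite mulr_sumr; apply: eq_bigr => l _; ring.
Qed.

Lemma bil_sym A a v : A^T = A -> bil A a v = bil A v a.
Proof.
move=> sA; rewrite /bil exchange_big; apply: eq_bigr => k _; apply: eq_bigr => i _.
by rewrite -[in LHS]sA mxE; ring.
Qed.

Variables (eta : 'M[R]_N) (mu : 'M[R]_L) (w : 'I_L -> 'M[R]_N).
Hypothesis w_eta : forall n, (w n *m eta)^T = w n *m eta.
Hypothesis w_comm : forall m n, w m *m w n = w n *m w m.
Hypothesis gauss : forall i j k l, \sum_m \sum_n mu m n *
  (w m i k * w n j l - w m j k * w n i l) = 0.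
Variable X : 'I_N -> R.

(** The Gauss equation contracted with a_i b_j v_k X_l. *)
Lemma gauss_bil a b v :
  \sum_m \sum_n mu m n * (bil (w n) b X * bil (w m) a v - bil (w n) a X * bil (w m) b v) = 0.
Proof.
transitivity (\sum_i \sum_j \sum_k \sum_l (a i * b j * v k * X l) *
  \sum_m \sum_n mu m n * (w m i k * w n j l - w m j k * w n i l)); last first.
  apply: big1 => i _; apply: big1 => j _; apply: big1 => k _; apply: big1 => l _.
  by rewrite gauss mulr0.
transitivity (\sum_m \sum_n \sum_i \sum_j \sum_k \sum_l (a i * b j * v k * X l) *
   (mu m n * (w m i k * w n j l - w m j k * w n i l))).
  apply: eq_bigr => m _; apply: eq_bigr => n _.
  have E (c d : 'I_N -> R) : bil (w n) d X * bil (w m) c v =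
     \sum_i \sum_j \sum_k \sum_l c i * w m i k * v k * (d j * w n j l * X l).
    rewrite mulrC /bil mulr_suml; apply: eq_bigr => i _.
    rewrite mulr_sumr; apply: eq_bigr => j _.
    rewrite mulr_suml; apply: eq_bigr => k _.
    by rewrite mulr_sumr.
  rewrite (E a b) (E b a) [X in _ - X]exchange_big -sumrB mulr_sumr.
  apply: eq_bigr => i _; rewrite -sumrB mulr_sumr; apply: eq_bigr => j _.
  rewrite -sumrB mulr_sumr; apply: eq_bigr => k _.
  rewrite -sumrB mulr_sumr; apply: eq_bigr => l _; ring.
have ex4 (F : 'I_N -> 'I_N -> 'I_N -> 'I_N -> 'I_L -> R) :
   \sum_n \sum_i \sum_j \sum_k \sum_l F i j k l n =
   \sum_i \sum_j \sum_k \sum_l \sum_n F i j k l n.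
  rewrite exchange_big; apply: eq_bigr => i _.
  rewrite exchange_big; apply: eq_bigr => j _.
  rewrite exchange_big; apply: eq_bigr => k _.
  by rewrite exchange_big.
under eq_bigr do rewrite ex4.
rewrite ex4; apply: eq_bigr => i _; apply: eq_bigr => j _; apply: eq_bigr => k _.
apply: eq_bigr => l _; rewrite mulr_sumr; apply: eq_bigr => m _.
by rewrite mulr_sumr.
Qed.

(** The value of the operator on c at a point where u_x is [X], in terms of c' and the nonlocal
    values c_n. *)
Let phi dc (cn : 'I_L -> R) i : R := \sum_j eta i j * dc j +
  \sum_p \sum_q mu p q * ((\sum_k w p i k * X k) * cn q).

(** Together with [P], all that is left once the Gauss equation has been used. [Q] is symmetric in a
    and c because w_m eta is symmetric, [P] in n and q because the affinors commute; the cyclic sum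
    cancels by these two symmetries. *)
Let Q n a c : R := \sum_m mu m n * bil (w m *m eta) a c.

Let P n q a : R := \sum_m \sum_p mu m n * mu p q * bil (w m *m w p) a X.

Let Q_sym n a c : Q n a c = Q n c a.
Proof. by apply: eq_bigr => m _; rewrite bil_sym. Qed.

Let P_sym n q a : P n q a = P q n a.
Proof.
rewrite /P exchange_big; apply: eq_bigr => p _; apply: eq_bigr => m _.
by rewrite w_comm; ring.
Qed.

Let bil_phi m da dc cn : bil (w m) da (phi dc cn) = bil (w m *m eta) da dc +
  \sum_p \sum_q mu p q * cn q * bil (w m *m w p) da X.
Proof.
rewrite bilD bil_mul; congr (_ + _); rewrite bil_sum; apply: eq_bigr => p _.
rewrite bil_sum; apply: eq_bigr => q _.
rewrite -bil_mul -bilZ; congr (bil _ _ _); apply/funext => k; ring.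
Qed.

(** Up to sign, the integrand of [vform v a b] after one integration by parts. *)
Definition jterm a da (an : 'I_L -> R) b db (bn : 'I_L -> R) v : R :=
  \sum_m \sum_n mu m n *
   ((bn n * bil (w m) da v + bil (w n) b X * bil (w m) a v) -
    (an n * bil (w m) db v + bil (w n) a X * bil (w m) b v)).

(** The products of two [bil] factors, in which neither a nor b is differentiated, drop out by the
    Gauss equation. *)
Let jtermE a da an b db bn dc cn :
  jterm a da an b db bn (phi dc cn) =
  \sum_n (bn n * Q n da dc - an n * Q n db dc) +
  (\sum_n \sum_q bn n * cn q * P n q da - \sum_n \sum_q an n * cn q * P n q db).
Proof.
transitivity (\sum_m \sum_n mu m n * (bn n * bil (w m) da (phi dc cn) -
  an n * bil (w m) db (phi dc cn))).
  rewrite -[RHS]addr0 -[X in _ = _ + X](gauss_bil a b (phi dc cn)) -big_split.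
  apply: eq_bigr => m _; rewrite -big_split; apply: eq_bigr => n _ /=; ring.
have PE n (x : R) (d : 'I_N -> R) : \sum_q x * cn q * P n q d =
    \sum_m mu m n * (x * \sum_p \sum_q mu p q * cn q * bil (w m *m w p) d X).
  under eq_bigr do rewrite mulr_sumr.
  rewrite exchange_big; apply: eq_bigr => m _.
  rewrite [\sum_p _]exchange_big !mulr_sumr; apply: eq_bigr => q _.
  by rewrite !mulr_sumr; apply: eq_bigr => p _; ring.
rewrite exchange_big -sumrB -big_split; apply: eq_bigr => n _ /=.
rewrite !PE /Q !mulr_sumr -!sumrB -big_split; apply: eq_bigr => m _ /=.
by rewrite !bil_phi; ring.
Qed.

Lemma jterm_cyclic a da an b db bn c dc cn :
  jterm a da an b db bn (phi dc cn) + jterm b db bn c dc cn (phi da an) +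
  jterm c dc cn a da an (phi db bn) = 0.
Proof.
rewrite !jtermE.
have PE (x y : 'I_L -> R) d : \sum_n \sum_q x n * y q * P n q d =
    \sum_n \sum_q y n * x q * P n q d.
  rewrite exchange_big; apply: eq_bigr => n _; apply: eq_bigr => q _.
  by rewrite P_sym; ring.
rewrite (PE bn cn) (PE an cn) (PE bn an).
have QE : \sum_n (bn n * Q n da dc - an n * Q n db dc) +
   \sum_n (cn n * Q n db da - bn n * Q n dc da) +
   \sum_n (an n * Q n dc db - cn n * Q n da db) = 0.
  rewrite -!big_split; apply: big1 => n _ /=.
  by rewrite (Q_sym n db dc) (Q_sym n db da) (Q_sym n dc da); ring.
rewrite -[RHS]QE; ring.
Qed.

End Algebra.

(** * Integration by parts under the closedness condition *)

Section Sufficiency.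
Context {R : realType} {N L : nat}.
Variables (U : set 'rV[R]_N) (eta : 'M[R]_N) (mu : 'M[R]_L).
Variable w : 'I_L -> 'rV[R]_N -> 'M[R]_N.
Hypotheses (openU : open U) (eta_sym : eta^T = eta) (mu_sym : mu^T = mu).
Hypothesis w_smooth : forall n i j, smooth_on U (fun u => w n u i j).

Local Notation M := (nonlocal_op eta mu w).

Variable u : R -> 'rV[R]_N.
Hypothesis fu : is_field U u.

Lemma derive1_field_comp f x : smooth_on U f ->
  derive1 (fun x => f (u x)) x = \sum_l dx u l x * partial l f (u x).
Proof.
move=> sf; rewrite derive1E (@derive_comp _ _ _ (rv_frame N) f u).
- by apply: eq_bigr => l _; rewrite /dx derive1E.
- by move=> i; apply: sm_diff; exact: (sm_field fu i).
- by apply: (smooth_on_diff sf); have [_ + _] := fu; apply.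
Qed.

Hypothesis flat : forall p, U p -> flat_at eta mu w p.

Let fval x : U (u x). Proof. by have [_ + _] := fu; apply. Qed.

Definition wphi m (phi : R -> 'rV[R]_N) i x : R := \sum_k w m (u x) i k * phi x 0 k.

Lemma sm_wphi m phi i : vsm phi -> sm (wphi m phi i).
Proof.
by move=> sp; apply: sm_sum => k _; apply: smM => //; exact: (sm_w w_smooth fu).
Qed.

(** Closedness exchanges the indices in phi^l (d_l w_k) u_x^k and turns it into (w_k)' phi^k, which
    the other term completes to a total derivative. *)
Lemma dvel_closed m phi x i : vsm phi ->
  dvel w m u phi x i = derive1 (wphi m phi i) x.
Proof.
move=> sp; have [_ cl _ _] := flat (fval x).
rewrite derive1_sum; last by move=> k _; apply: smM => //; exact: (sm_w w_smooth fu).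
transitivity (\sum_k ((\sum_l dx u l x * partial l (fun q => w m q i k) (u x)) * phi x 0 k
    + w m (u x) i k * dx phi k x)).
  rewrite /dvel !big_split /=; congr (_ + _).
  under eq_bigr do rewrite mulr_suml.
  rewrite exchange_big; apply: eq_bigr => l _; rewrite mulr_suml.
  by apply: eq_bigr => k _; rewrite cl; ring.
apply: eq_bigr => k _; rewrite derive1M //; last exact: (sm_w w_smooth fu).
by rewrite (derive1_field_comp _ (w_smooth m i k)).
Qed.

Lemma pvel_bil n z x : pvel w n u z x = bil (w n (u x)) (fun i => z x 0 i) (fun k => dx u k x).
Proof.
apply: eq_bigr => j _; rewrite /vel mulr_suml; apply: eq_bigr => k _; ring.
Qed.

Let ev (z : R -> 'rV[R]_N) x := fun i => z x 0 i.
Let dv (z : R -> 'rV[R]_N) x := fun i => dx z i x.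
Let zn (z : R -> 'rV[R]_N) x := fun n => Defs.dinv (pvel w n u z) x.
Let wx x := fun n => w n (u x).

(** The x-derivative moves onto a b_n. Since b_n' = <W_n, b>, no antiderivative other than b_n
    itself remains, so the cancellation can be checked pointwise. *)
Lemma lint_dpvel_closed m n phi a b : vsm phi -> vtst a -> vtst b ->
  lint (fun x => dpvel w m u phi a x * Defs.dinv (pvel w n u b) x) =
  - lint (fun x => zn b x n * bil (wx x m) (dv a x) (ev phi x) +
     bil (wx x n) (ev b x) (dv u x) * bil (wx x m) (ev a x) (ev phi x)).
Proof.
move=> sp ta tb.
have sdb : sm (zn b ^~ n) by exact: (sm_dinv_pvel w_smooth fu).
have tab i : tst (fun x => a x 0 i * zn b x n) by exact: tstMr.
have sph i := sm_wphi m i sp.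
have t1 i : tst (fun x => (a x 0 i * zn b x n) * derive1 (wphi m phi i) x).
  by apply: tstMr => //; exact: sm_derive1.
have t2 i : tst (fun x => derive1 (fun x => a x 0 i * zn b x n) x * wphi m phi i x).
  by apply: tstMr => //; exact: tst_derive1.
transitivity (lint (fun x => \sum_i (a x 0 i * zn b x n) * derive1 (wphi m phi i) x)).
  congr lint; apply/funext => x; rewrite /dpvel mulr_suml; apply: eq_bigr => i _.
  by rewrite dvel_closed // /zn; ring.
rewrite lint_sum //.
transitivity (\sum_i - lint (fun x => derive1 (fun x => a x 0 i * zn b x n) x *
    wphi m phi i x)).
  by apply: eq_bigr => i _; rewrite lint_by_parts.
rewrite sumrN -lint_sum //; congr (- lint _); apply/funext => x.
transitivity (\sum_i (dx a i x * zn b x n + a x 0 i * pvel w n u b x) * wphi m phi i x).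
  apply: eq_bigr => i _; rewrite derive1M //; last by case: (ta i).
  by rewrite /zn derive1_dinv //; exact: (tst_pvel w_smooth fu).
rewrite -pvel_bil; move: (pvel w n u b x) => P.
rewrite /bil !mulr_sumr -big_split; apply: eq_bigr => i _ /=.
rewrite mulrDl /wphi !mulr_sumr; congr (_ + _).
  by apply: eq_bigr => k _; rewrite /wx /dv /ev /=; ring.
apply: eq_bigr => k _; rewrite /wx /dv /ev /=; ring.
Qed.

Lemma tst_bil_pair n m phi a b : vsm phi -> vtst a -> vtst b ->
  tst (fun x => zn b x n * bil (wx x m) (dv a x) (ev phi x) +
     bil (wx x n) (ev b x) (dv u x) * bil (wx x m) (ev a x) (ev phi x)).
Proof.
move=> sp ta tb.
have t3 (c d : R -> 'I_N -> R) k : (forall i, tst (c^~ i)) -> (forall i, sm (d^~ i)) ->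
    tst (fun x => bil (wx x k) (c x) (d x)).
  move=> tc sd; apply: tst_sum => i _; apply: tst_sum => l _; apply: tstMr => //.
  by apply: tstMr => //; exact: (sm_w w_smooth fu).
apply: tstD.
  apply: tstMl; first exact: (sm_dinv_pvel w_smooth fu).
  by apply: t3 => // i; exact: tst_derive1.
apply: tstMl.
  have [h _] : tst (fun x => bil (wx x n) (ev b x) (dv u x)); last exact: h.
  by apply: t3 => // i; have [] := tst_dx fu i.
by apply: t3.
Qed.

Lemma vform_closed phi a b : vsm phi -> vtst a -> vtst b ->
  vform mu w u phi a b = - lint (fun x => jterm mu (wx x) (dv u x)
    (ev a x) (dv a x) (zn a x) (ev b x) (dv b x) (zn b x) (ev phi x)).
Proof.
move=> sp ta tb.
have t1 n m := tst_bil_pair n m sp ta tb; have t2 n m := tst_bil_pair n m sp tb ta.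
have t3 n m := tstD (t1 n m) (tstN (t2 n m)).
have t4 m n := tstMl (sm_cst (mu m n)) (t3 n m).
rewrite /jterm lint_sum; last by move=> m _; apply: tst_sum.
rewrite -sumrN; apply: eq_bigr => m _.
rewrite lint_sum // -sumrN; apply: eq_bigr => n _.
rewrite lintZ // lintB // !lint_dpvel_closed //; ring.
Qed.

Lemma tst_jterm phi a b : vsm phi -> vtst a -> vtst b ->
  tst (fun x => jterm mu (wx x) (dv u x)
    (ev a x) (dv a x) (zn a x) (ev b x) (dv b x) (zn b x) (ev phi x)).
Proof.
move=> sp ta tb; apply: tst_sum => m _; apply: tst_sum => n _.
apply: tstMl; first exact: sm_cst.
by apply: tstD; [exact: tst_bil_pair | apply: tstN; exact: tst_bil_pair].
Qed.

Lemma jacobiator_eq0 a b c : vtst a -> vtst b -> vtst c -> jacobiator eta mu w u a b c = 0.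
Proof.
move=> ta tb tc.
have sM z : vtst z -> vsm (M u z).
  by move=> tz; apply: vtst_vsm; exact: (vtst_op eta mu w_smooth fu).
have sMa := sM _ ta; have sMb := sM _ tb; have sMc := sM _ tc.
have j1 := tst_jterm sMc ta tb; have j2 := tst_jterm sMa tb tc.
have j3 := tst_jterm sMb tc ta.
rewrite /jacobiator !vform_closed // -!opprD -lintD // -lintD //; last exact: tstD.
rewrite -[RHS]oppr0 -[in RHS]lint0; congr (- lint _); apply/funext => x.
have [we cl cm ga] := flat (fval x).
have ME z : ev (M u z) x = (fun i => \sum_j eta i j * dv z x j +
  \sum_p \sum_q mu p q * ((\sum_k w p (u x) i k * dv u x k) * zn z x q)).
  by apply/funext => i; rewrite /ev nonlocal_opE.
rewrite !ME.
exact: (jterm_cyclic we cm ga (dv u x) (ev a x) (dv a x) (zn a x) (ev b x)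
  (dv b x) (zn b x) (ev c x) (dv c x) (zn c x)).
Qed.

End Sufficiency.

(** * Potentials *)

Section Poincare.
Context {R : realType} {N : nat}.
Variables (p : 'rV[R]_N) (r : R).

Let B := ball p r.
Let oB : open B := @ball_open _ _ p r.

Let ray (u : 'rV[R]_N) (t : R) : 'rV[R]_N := p + t *: (u - p).

Let ray_ball u t : B u -> 0 <= t <= 1 -> B (ray u t).
Proof.
rewrite /B -ball_normE /= /ray => Bu /andP[t0 t1].
rewrite opprD addrA subrr add0r normrN normrZ ger0_norm //.
by apply: le_lt_trans Bu; rewrite distrC ler_piMl.
Qed.

(** The integration lemma wants an open set around B x [0,1], so all pairs whose ray point lies in
    the ball are taken, with t not confined to the segment. *)
Let D : set ('rV[R]_N * R) := [set q | B (ray q.1 q.2)].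

Let ray_continuous : continuous (fun q : 'rV[R]_N * R => ray q.1 q.2).
Proof.
move=> q; apply: cvgD; first exact: cvg_cst.
by apply: cvgZ; [exact: cvg_snd | apply: cvgB; [exact: cvg_fst | exact: cvg_cst]].
Qed.

Let oD : open D.
Proof. by apply: open_comp oB => q _; exact: ray_continuous. Qed.

Let smooth_coord j : smooth_on D (fun q => q.1 0 j).
Proof. by have := @smooth_on_fst R _ R (rv_frame N) D j. Qed.

Let smooth_ray f : smooth_on B f -> smooth_on D (fun q => f (ray q.1 q.2)).
Proof.
move=> sf; apply: (smooth_on_comp (fr := rv_frame N) oD _ sf) => // j.
apply: (@smooth_on_ext _ _ _ (fun q : 'rV[R]_N * R => p 0 j + q.2 * (q.1 0 j - p 0 j))) => //.
  by move=> q _; rewrite /= /rvco !mxE.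
apply: smooth_onD => //; first exact: smooth_on_cst.
apply: smooth_onM => //; first exact: smooth_on_sndR.
by apply: smooth_onB => //; exact: smooth_on_cst.
Qed.

Let is_derive_coord (c d : R) t : is_derive t (1 : R) (fun z => c + z * d) d.
Proof.
have di : differentiable (fun s : R => s) t by exact: (sm_diff t sm_id).
have dd : differentiable (fun s : R => s * d) t.
  by apply: (differentiable_mul di); exact: (differentiable_cst d).
have dc : differentiable (fun=> c : R) (t : R) by exact: (differentiable_cst c).
split; first by apply: diff_derivable; exact: differentiable_add.
rewrite (derive_add _ dc dd) derive_cst add0r (derive_mul _ di (differentiable_cst d _)).
by rewrite derive_cst mulr0 addr0 derive_id mul1r.
Qed.

Let derive_ray_t f u t : smooth_on B f -> B (ray u t) ->
  is_derive t (1 : R) (fun t => f (ray u t)) (\sum_l (u 0 l - p 0 l) * partial l f (ray u t)).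
Proof.
move=> sf Bt.
have E l : (fun t : R => fco (rv_frame N) l (ray u t)) = (fun t => p 0 l + t * (u 0 l - p 0 l)).
  by apply/funext => z; rewrite /= /rvco !mxE.
have dl l : differentiable (fun t : R => fco (rv_frame N) l (ray u t)) t.
  by rewrite E; apply/derivable1_diffP; have [] := is_derive_coord (p 0 l) (u 0 l - p 0 l) t.
have df : differentiable f (ray u t) by exact: (smooth_on_diff sf).
split.
  apply: diff_derivable; apply: (differentiable_comp (f := ray u)) => //.
rewrite (derive_comp _ dl df); apply: eq_bigr => l _.
by rewrite E; have [_ ->] := is_derive_coord (p 0 l) (u 0 l - p 0 l) t.
Qed.

Let derive_ray_u f u t j : smooth_on B f -> B (ray u t) ->
  differentiable (fun u => f (ray u t)) u /\
  'D_(delta_mx 0 j) (fun u => f (ray u t)) u = t * partial j f (ray u t).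
Proof.
move=> sf Bt.
have E l : (fun u => fco (rv_frame N) l (ray u t)) = (fun u => (p 0 l - t * p 0 l) + t * rvco l u).
  by apply/funext => z; rewrite /= /rvco !mxE; ring.
have d1 l : differentiable (rvco (R := R) l) u.
  exact/linear_differentiable/rvco_continuous.
have d2 l : differentiable (fun u => t * rvco l u) u.
  by apply: differentiable_mul => //; exact: differentiable_cst.
have d3 l : differentiable (fun=> p 0 l - t * p 0 l : R) u by exact: differentiable_cst.
have df : differentiable f (ray u t) by exact: (smooth_on_diff sf).
have dl l : differentiable (fun u => fco (rv_frame N) l (ray u t)) u.
  by rewrite E; exact: differentiable_add.
split.
  apply: (differentiable_comp (f := fun u => ray u t)) => //.
rewrite (@derive_comp _ _ _ (rv_frame N) f (fun u => ray u t)) //.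
rewrite (bigD1 j) //= big1 ?addr0.
  rewrite E (derive_add _ (d3 j) (d2 j)) derive_cst add0r.
  rewrite (derive_mul _ (differentiable_cst t u) (d1 j)).
  rewrite derive_cst mul0r add0r deriveE // (diff_lin u (@rvco_continuous R N j)).
  by rewrite /= /rvco mxE !eqxx mulr1.
move=> l lj; rewrite E (derive_add _ (d3 l) (d2 l)) derive_cst add0r.
rewrite (derive_mul _ (differentiable_cst t u) (d1 l)).
rewrite derive_cst mul0r add0r deriveE // (diff_lin u (@rvco_continuous R N l)).
by rewrite /= /rvco mxE eqxx (negbTE lj) mulr0 mul0r.
Qed.

(** The radial primitive: the form is integrated along the segment from p to u. By closedness the
    integrand of its j-th derivative is the t-derivative of t al_j(ray u t), so the integral is
    al_j(u). *)
Lemma poincare (al : 'I_N -> 'rV[R]_N -> R) :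
  (forall i, smooth_on B (al i)) ->
  (forall u i j, B u -> partial i (al j) u = partial j (al i) u) ->
  exists2 f, smooth_on B f & forall u j, B u -> partial j f u = al j u.
Proof.
move=> sal cal.
pose g (q : 'rV[R]_N * R) := \sum_i al i (ray q.1 q.2) * (q.1 0 i - p 0 i).
have sc i : smooth_on D (fun q : 'rV[R]_N * R => q.1 0 i - p 0 i).
  by apply: smooth_onB => //; exact: smooth_on_cst.
have sg : smooth_on D g.
  by apply: smooth_on_sum => // i _; apply: smooth_onM => //; exact: smooth_ray.
have BD u (t : R) : B u -> 0 <= t <= 1 -> D (u, t) by exact: ray_ball.
exists (fun u => segint 0 1 (fun t => g (u, t))).
  exact: (smooth_on_param_integral (rv_frame N) oB oD BD sg).
move=> u j Bu; rewrite /partial (derive_param_integral (rv_frame N) oD BD _ sg Bu).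
transitivity (1 * al j (ray u 1) - 0 * al j (ray u 0)); last first.
  by rewrite mul1r mul0r subr0 /ray scale1r addrC subrK.
pose dg t := al j (ray u t) + t * \sum_l (u 0 l - p 0 l) * partial l (al j) (ray u t).
rewrite (@segint_ext _ _ _ _ dg).
  apply: (@segint_FTC R (fun t => t * al j (ray u t)) dg 0 1) => //.
    move=> t ht.
    have ct h : smooth_on B h -> {for t, continuous (fun t => h (ray u t))}.
      move=> sh; apply: (@continuous_slice R _ (fun q => h (ray q.1 q.2)) u).
      exact: (smooth_on_continuous (smooth_ray sh) (BD _ _ Bu ht)).
    apply: cvgD; first exact: ct.
    apply: cvgM; first exact: cvg_id.
    (* The degenerate segment from t to t makes [contin] mean continuity at the single point t. *)
    apply: (@contin_sum _ t t) => [l _ z|]; last by rewrite lexx.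
    rewrite -eq_le => /eqP <-.
    by apply: cvgM; [exact: cvg_cst | apply: ct; exact: smooth_on_derive].
  move=> t ht; have d := derive_ray_t (sal j) (ray_ball Bu ht).
  have [a b] := @is_deriveM R R id (fun t => al j (ray u t)) t 1 _ _ (is_derive_id t 1) d.
  split; first exact: a.
  by rewrite [LHS]b /= [_ *: 1]mulr1 addrC.
move=> t ht; have Bt := ray_ball Bu ht.
rewrite -(derive_slice (fun u t => g (u, t))).
have dr i := derive_ray_u j (sal i) Bt.
have dco i : differentiable (fun u : 'rV[R]_N => u 0 i - p 0 i) u.
  apply: differentiableB; last exact: differentiable_cst.
  exact: (linear_differentiable u (@rvco_continuous R N i)).
rewrite (proj1 (@derive_big _ _ _ (index_enum _) xpredT
  (fun i u => al i (ray u t) * (u 0 i - p 0 i)) _ u _)); last first.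
  by move=> i _; apply: differentiable_mul => //; have [] := dr i.
transitivity (\sum_i (t * partial j (al i) (ray u t) * (u 0 i - p 0 i) +
    al i (ray u t) * (i == j)%:R)).
  apply: eq_bigr => i _; have [d1 d2] := dr i.
  rewrite (derive_mul _ d1 (dco i)) d2; congr (_ + _ * _).
  have di : differentiable (rvco (R := R) i) u.
    exact: (linear_differentiable u (@rvco_continuous R N i)).
  rewrite (@derive_add _ _ (rvco i) (fun=> - p 0 i) _ _ di (differentiable_cst (- p 0 i) u)).
  rewrite derive_cst addr0 deriveE // (diff_lin u (@rvco_continuous R N i)).
  by rewrite /= /rvco mxE eqxx.
rewrite big_split /= addrC /dg; congr (_ + _).
  rewrite (bigD1 j) //= eqxx mulr1 big1 ?addr0 // => i ij.
  by rewrite (negbTE ij) mulr0.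
by rewrite mulr_sumr; apply: eq_bigr => i _; rewrite (cal _ j i Bt); ring.
Qed.

End Poincare.

(** * Equivalence of the pointwise conditions with the existence of potentials *)

Section Potential.
Context {R : realType} {N L : nat}.
Variables (U : set 'rV[R]_N) (eta : 'M[R]_N) (mu : 'M[R]_L).
Variable w : 'I_L -> 'rV[R]_N -> 'M[R]_N.
Hypotheses (openU : open U) (eta_sym : eta^T = eta) (mu_sym : mu^T = mu).

Definition gauss_eq (H : 'I_L -> 'M[R]_N) := forall i j k l,
  \sum_m \sum_n mu m n * (H m i k * H n j l - H m j k * H n i l) = 0.

(** Contracting two indices with a fixed matrix carries the equation from Hessians to affinors with
    [eta], and back with [invmx eta]. *)
Lemma gauss_mul (A : 'M[R]_N) H : gauss_eq H -> gauss_eq (fun m => A *m H m).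
Proof.
move=> gH i j k l.
transitivity (\sum_s \sum_t A i s * A j t * \sum_m \sum_n mu m n *
  (H m s k * H n t l - H m t k * H n s l)); last first.
  by apply: big1 => s _; apply: big1 => t _; rewrite gH mulr0.
transitivity (\sum_m \sum_n \sum_s \sum_t A i s * A j t * (mu m n *
  (H m s k * H n t l - H m t k * H n s l))).
  apply: eq_bigr => m _; apply: eq_bigr => n _; rewrite !mxE.
  have E (a b : 'I_N) (c d : 'I_N -> R) : (\sum_s A a s * c s) * (\sum_t A b t * d t) =
      \sum_s \sum_t A a s * A b t * (c s * d t).
    rewrite mulr_suml; apply: eq_bigr => s _; rewrite mulr_sumr.
    by apply: eq_bigr => t _; ring.
  rewrite !E [X in _ - X]exchange_big -sumrB mulr_sumr; apply: eq_bigr => s _.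
  by rewrite -sumrB mulr_sumr; apply: eq_bigr => t _; ring.
have ex2 (F : 'I_N -> 'I_N -> 'I_L -> R) :
   \sum_n \sum_s \sum_t F s t n = \sum_s \sum_t \sum_n F s t n.
  by rewrite exchange_big; apply: eq_bigr => s _; rewrite exchange_big.
under eq_bigr do rewrite ex2.
rewrite ex2; apply: eq_bigr => s _; apply: eq_bigr => t _.
by rewrite mulr_sumr; apply: eq_bigr => m _; rewrite mulr_sumr.
Qed.

(** The equation of the theorem exchanges k and l, [gauss_eq] exchanges i and j; renaming m and n in
    the second product, with [mu] symmetric, identifies the two. *)
Lemma gauss_swap (H : 'I_L -> 'M[R]_N) i j k l :
  \sum_m \sum_n mu m n * (H m i k * H n j l - H m j k * H n i l) =
  \sum_m \sum_n mu m n * (H m i k * H n j l - H m i l * H n j k).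
Proof.
have sB (F G : 'I_L -> 'I_L -> R) : \sum_m \sum_n mu m n * (F m n - G m n) =
    \sum_m \sum_n mu m n * F m n - \sum_m \sum_n mu m n * G m n.
  rewrite -sumrB; apply: eq_bigr => m _; rewrite -sumrB; apply: eq_bigr => n _.
  by rewrite mulrBr.
rewrite !sB; congr (_ - _); rewrite exchange_big; apply: eq_bigr => m _.
by apply: eq_bigr => n _; rewrite -[in LHS]mu_sym mxE; ring.
Qed.

(** The left side is that of the second equation of the theorem: up to a factor the antisymmetric
    part of G eta H. If G and H are symmetric and it vanishes, eta G and eta H commute. *)
Lemma eta_swap (G H : 'M[R]_N) k l : G^T = G ->
  \sum_i \sum_j eta i j * (G i k * H j l - G i l * H j k) =
  (G *m eta *m H) k l - (G *m eta *m H) l k.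
Proof.
move=> sG.
have E a b : (G *m eta *m H) a b = \sum_i \sum_j eta i j * (G i a * H j b).
  rewrite mxE exchange_big; apply: eq_bigr => j _; rewrite mxE mulr_suml.
  by apply: eq_bigr => i _; rewrite -[in LHS]sG mxE; ring.
rewrite !E -sumrB; apply: eq_bigr => i _; rewrite -sumrB; apply: eq_bigr => j _.
by rewrite mulrBr.
Qed.

Definition hess_mx (f : 'rV[R]_N -> R) u : 'M[R]_N := \matrix_(i, j) hess f i j u.

Lemma hess_sym (V : set 'rV[R]_N) f u : open V -> smooth_on V f -> V u ->
  (hess_mx f u)^T = hess_mx f u.
Proof.
move=> oV sf Vu; apply/matrixP => i j; rewrite !mxE /hess /partial.
exact: (smooth_on_derive_derive _ _ oV Vu sf).
Qed.

Lemma hess_commute (A G : 'I_L -> 'M[R]_N) : (forall n, A n = eta *m G n) ->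
  (forall n, (G n)^T = G n) ->
  (forall a b k l, \sum_i \sum_j eta i j *
    (G a i k * G b j l - G a i l * G b j k) = 0) ->
  forall m n, A m *m A n = A n *m A m.
Proof.
move=> AE sG eG m n; rewrite !AE -!mulmxA; congr (_ *m _).
rewrite !mulmxA; apply/matrixP => k l.
have := eG m n k l; rewrite eta_swap // => /eqP; rewrite subr_eq0 => /eqP ->.
transitivity ((G m *m eta *m G n)^T k l); first by rewrite [RHS]mxE.
by rewrite !trmx_mul !sG eta_sym mulmxA.
Qed.

Lemma potential_flat : locally_potential_flat eta mu U w ->
  forall p, U p -> flat_at eta mu w p.
Proof.
move=> H p Up; have [V [psi [[oV Vp VU] spsi wE gH eH]]] := H p Up.
pose Hm n u := hess_mx (psi n) u.
have sH n u : V u -> (Hm n u)^T = Hm n u by exact: (hess_sym oV (spsi n)).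
have wH n u : V u -> w n u = eta *m Hm n u.
  move=> Vu; apply/matrixP => i j; rewrite wE // mxE.
  by apply: eq_bigr => s _; rewrite mxE.
have hE n i j : hess (psi n) i j p = Hm n p i j by rewrite mxE.
have eG a b k l : \sum_i \sum_j eta i j *
    (Hm a p i k * Hm b p j l - Hm a p i l * Hm b p j k) = 0.
  rewrite -[RHS](eH p Vp a b k l); apply: eq_bigr => i _; apply: eq_bigr => j _.
  by rewrite !hE.
have gG i j k l : \sum_a \sum_b mu a b *
    (Hm a p i k * Hm b p j l - Hm a p i l * Hm b p j k) = 0.
  rewrite -[RHS](gH p Vp i j k l); apply: eq_bigr => a _; apply: eq_bigr => b _.
  by rewrite !hE.
split.
- by move=> n; rewrite wH // !trmx_mul eta_sym sH // mulmxA.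
- move=> n i k l.
  have E a b : partial a (fun q => w n q i b) p =
      \sum_s eta i s * partial a (fun q => hess (psi n) s b q) p.
    rewrite /partial (@eq_on_derive _ _ V _ (fun q => \sum_s eta i s * hess (psi n) s b q)) //;
      last by move=> y Vy; exact: wE.
    have sh s : smooth_on V (hess (psi n) s b) by do 2 apply: smooth_on_derive.
    have dh s : differentiable (hess (psi n) s b) p by exact: (smooth_on_diff (sh s)).
    rewrite (proj1 (@derive_big _ _ _ (index_enum _) xpredT
      (fun s q => eta i s * hess (psi n) s b q) _ p _)).
      apply: eq_bigr => s _; rewrite (derive_mul _ (differentiable_cst _ _) (dh s)).
      by rewrite derive_cst mul0r add0r.
    by move=> s _; apply: differentiable_mul => //; exact: differentiable_cst.
  apply: (etrans (E l k)); apply: esym; apply: (etrans (E k l)); apply: esym.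
  apply: eq_bigr => s _; apply: (congr1 ( *%R (eta i s))).
  have sc a b y : V y -> partial a (partial b (psi n)) y = partial b (partial a (psi n)) y.
    by move=> Vy; exact: (smooth_on_derive_derive _ _ oV Vy (spsi n)).
  have sc2 a b c : partial a (partial b (partial c (psi n))) p =
      partial b (partial a (partial c (psi n))) p.
    apply: (smooth_on_derive_derive _ _ oV Vp); exact: smooth_on_derive.
  have Es : partial s (partial l (partial k (psi n))) p =
      partial s (partial k (partial l (psi n))) p.
    by apply: (eq_on_derive _ oV Vp) => y Vy; exact: sc.
  (* Three derivatives are reordered by adjacent swaps: l s k, s l k, s k l, k s l. *)
  exact: (etrans (sc2 l s k) (etrans Es (esym (sc2 k s l)))).
- exact: (hess_commute (fun n => wH n p Vp) (fun n => sH n p Vp) eG).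
- have gHm : gauss_eq (fun n => Hm n p) by move=> a b c d; rewrite gauss_swap; exact: gG.
  move=> i j k l; rewrite -[RHS](gauss_mul eta gHm i j k l).
  by apply: eq_bigr => m _; apply: eq_bigr => n _; rewrite !wH.
Qed.

Hypothesis eta_unit : eta \in unitmx.
Hypothesis w_smooth : forall n i j, smooth_on U (fun u => w n u i j).

(** The future Hessians are eta^-1 w_n. Closedness makes each row a gradient, and symmetry makes the
    resulting vector of functions a gradient again. The Poincare lemma needs a ball, which is why
    the potentials are local. *)
Lemma flat_potential : (forall p, U p -> flat_at eta mu w p) ->
  locally_potential_flat eta mu U w.
Proof.
move=> fl p Up.
have /nbhs_ballP[r /= r0 BU] := open_near openU Up.
pose B := ball p r; have oB : open B by exact: ball_open.
pose h n i j (u : 'rV[R]_N) := \sum_s (invmx eta) i s * w n u s j.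
have hE n u i j : h n i j u = (invmx eta *m w n u) i j by rewrite mxE.
have sh n i j : smooth_on B (h n i j).
  apply: smooth_on_sum => // s _; apply: smooth_onM => //; first exact: smooth_on_cst.
  exact: smooth_onS BU (w_smooth n s j).
have inv_sym : (invmx eta)^T = invmx eta by rewrite trmx_inv eta_sym.
have mx_sym n u : B u -> (invmx eta *m w n u)^T = invmx eta *m w n u.
  move=> Bu; have [we _ _ _] := fl u (BU _ Bu).
  (* A congruence of the symmetric matrix [w n u *m eta] by the symmetric matrix [invmx eta], hence
     symmetric. *)
  have -> : invmx eta *m w n u = invmx eta *m (w n u *m eta) *m invmx eta.
    by rewrite mulmxA mulmxK.
  by rewrite trmx_mul [X in _ *m X]trmx_mul inv_sym we mulmxA.
have h_sym n i j u : B u -> h n i j u = h n j i u.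
  by move=> Bu; rewrite !hE -[in LHS](mx_sym n u Bu) [LHS]mxE.
have h_cl n i k l u : B u -> partial l (h n i k) u = partial k (h n i l) u.
  move=> Bu; have [_ cl _ _] := fl u (BU _ Bu).
  have E a b : partial a (h n i b) u =
      \sum_s (invmx eta) i s * partial a (fun q => w n q s b) u.
    have dw s : differentiable (fun q => w n q s b) u.
      exact: (smooth_on_diff (w_smooth n s b) (BU _ Bu)).
    rewrite /partial (proj1 (@derive_big _ _ _ (index_enum _) xpredT
      (fun s q => (invmx eta) i s * w n q s b) _ u _)).
      apply: eq_bigr => s _; rewrite (derive_mul _ (differentiable_cst _ _) (dw s)).
      by rewrite derive_cst mul0r add0r.
    by move=> s _; apply: differentiable_mul => //; exact: differentiable_cst.
  apply: (etrans (E l k)); apply: esym; apply: (etrans (E k l)).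
  by apply: eq_bigr => s _; rewrite (cl n s l k).
have th n : exists f : 'I_N -> 'rV[R]_N -> R, (forall i, smooth_on B (f i)) /\
    forall i j u, B u -> partial j (f i) u = h n i j u.
  have : forall i, exists f, smooth_on B f /\ forall u j, B u -> partial j f u = h n i j u.
    move=> i; have [f sf df] := poincare (sh n i) (fun u k l Bu => h_cl n i l k u Bu).
    by exists f.
  by move=> /choice[f Hf]; exists f; split=> [i|i j u]; have [h1 h2] := Hf i => //; exact: h2.
have ps : forall n, exists f : 'rV[R]_N -> R, smooth_on B f /\
    forall u, B u -> forall i j, hess f i j u = (invmx eta *m w n u) i j.
  move=> n; have [f [sf df]] := th n.
  have cf u i j : B u -> partial i (f j) u = partial j (f i) u.
    by move=> Bu; rewrite !df // h_sym.
  have [g sg dg] := poincare sf cf; exists g; split=> // u Bu i j.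
  rewrite -hE h_sym // -df //; apply: (eq_on_derive _ oB Bu) => y By; exact: dg.
have [psi Hpsi] := choice ps.
have hpsi n u i j : B u -> hess (psi n) i j u = (invmx eta *m w n u) i j.
  by move=> Bu; have [_ ->] := Hpsi n.
exists B, psi; split.
- by split=> //; exact: ballxx.
- by move=> n; have [] := Hpsi n.
- move=> u Bu n i j.
  have -> : w n u = eta *m (invmx eta *m w n u) by rewrite mulKVmx.
  by rewrite [LHS]mxE; apply: eq_bigr => s _; rewrite hpsi.
- move=> u Bu i j k l; have [_ _ _ ga] := fl u (BU _ Bu).
  have gw : gauss_eq (fun m => w m u) by exact: ga.
  rewrite -[RHS](gauss_mul (invmx eta) gw i j k l) gauss_swap.
  by apply: eq_bigr => a _; apply: eq_bigr => b _; rewrite !hpsi.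
- move=> u Bu a b k l; have [_ _ cm _] := fl u (BU _ Bu).
  transitivity (\sum_i \sum_j eta i j *
    ((invmx eta *m w a u) i k * (invmx eta *m w b u) j l -
     (invmx eta *m w a u) i l * (invmx eta *m w b u) j k)).
    by apply: eq_bigr => i _; apply: eq_bigr => j _; rewrite !hpsi.
  rewrite eta_swap ?mx_sym //; apply/eqP; rewrite subr_eq0; apply/eqP.
  have mE c d : invmx eta *m w c u *m eta *m (invmx eta *m w d u) =
      invmx eta *m (w c u *m w d u) by rewrite -mulmxA mulKVmx // mulmxA.
  transitivity ((invmx eta *m w a u *m eta *m (invmx eta *m w b u))^T l k).
    by rewrite [RHS]mxE.
  rewrite trmx_mul [X in _ *m X]trmx_mul !mx_sym // eta_sym.
  by rewrite mulmxA !mE cm.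
Qed.

End Potential.

(** * Bump functions and paths *)

Section Step.
Context {R : realType}.

(** The exponent [k] is there for closure: the derivative is a combination of the members with
    indices k + 1 and k + 2, so all members are smooth by one simultaneous induction. *)
Definition flatexp (k : nat) (x : R) : R :=
  if 0 < x then x^-1 ^+ k * expR (- x^-1) else 0.

Lemma flatexp_ge0 k x : 0 <= flatexp k x.
Proof.
rewrite /flatexp; case: ltP => // x0; apply: mulr_ge0; last exact: expR_ge0.
by apply: exprn_ge0; rewrite invr_ge0 ltW.
Qed.

(** With y = 1/x, this is y^(k+2) / (k+2)! <= exp y. A quadratic bound is what makes the derivative
    at 0 exist and vanish. *)
Lemma flatexp_le k x : flatexp k x <= (k.+2)`!%:R * x ^+ 2.
Proof.
rewrite /flatexp; case: ltP => [x0|_]; last by rewrite mulr_ge0 // sqr_ge0.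
have y0 : 0 < x^-1 by rewrite invr_gt0.
set y := x^-1 in y0 *.
have -> : x = y^-1 by rewrite invrK.
have h : y ^+ k.+2 / (k.+2)`!%:R <= expR y.
  by apply: le_trans (expR_ge1Dxn k.+1 (ltW y0)); rewrite lerDr.
have f0 : 0 < (k.+2)`!%:R :> R by rewrite ltr0n fact_gt0.
rewrite expRN ler_pdivrMr ?expR_gt0 //.
have -> : y ^+ k = (k.+2)`!%:R * y^-1 ^+ 2 * (y ^+ k.+2 / (k.+2)`!%:R).
  by rewrite !exprS; field; rewrite !gt_eqF.
apply: ler_wpM2l => //; apply: mulr_ge0; [exact: ltW | exact: sqr_ge0].
Qed.

Lemma flatexp_derive k x :
  is_derive x (1 : R) (flatexp k) (- k%:R * flatexp k.+1 x + flatexp k.+2 x).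
Proof.
have [x0|x0|x0] := ltgtP 0 x.
- have E : \forall y \near x, y^-1 ^+ k * expR (- y^-1) = flatexp k y.
    near=> y; rewrite /flatexp ifT //.
    by near: y; exact: lt_nbhsr.
  have xn0 : x != 0 by rewrite gt_eqF.
  have dinv : is_derive x (1 : R) (fun y : R => y^-1) (- x ^- 2).
    have := @is_deriveV R id x 1 1 xn0 (is_derive_id x 1).
    by rewrite [_ *: 1]mulr1.
  have dX : is_derive x (1 : R) (fun y : R => y^-1 ^+ k) (- k%:R * x^-1 ^+ k.+1).
    have [a b] := @is_deriveX R R (fun y : R => y^-1) k x 1 _ dinv.
    have XE : (fun y : R => y^-1 ^+ k) = (fun y : R => y^-1) ^+ k.
      by apply/funext => y; rewrite exprfctE.
    rewrite XE; split; first exact: a.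
    rewrite [LHS]b; case: k {E a b XE} => [|k]; first by rewrite mul0r scale0r oppr0 mul0r.
    rewrite /= -exprVn [_ *: _]mulrN mulNr -mulrA; congr (- (_ * _)).
    by rewrite -exprD addn2.
  have dE : is_derive x (1 : R) (fun y : R => expR (- y^-1)) (expR (- x^-1) * x^-1 ^+ 2).
    have dN : is_derive x (1 : R) (fun y : R => - y^-1) (x^-1 ^+ 2).
      by have := @is_deriveN R R R _ x 1 _ dinv; rewrite opprK exprVn.
    exact: (@is_derive1_comp R expR _ x _ _ (is_derive_expR _) dN).
  have [a b] := @is_deriveM R R _ _ x 1 _ _ dX dE.
  have fE : flatexp k.+1 x = x^-1 ^+ k.+1 * expR (- x^-1) by rewrite /flatexp x0.
  have fE2 : flatexp k.+2 x = x^-1 ^+ k.+2 * expR (- x^-1) by rewrite /flatexp x0.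
  split; first exact: (near_eq_derivable E a).
  rewrite -(@near_eq_derive _ _ _ _ _ x (1 : R) E) fE fE2 [LHS]b.
  rewrite addrC; congr (_ + _); first by rewrite [LHS]mulrC mulrA.
  by rewrite [LHS]mulrCA mulrC -exprD addn2.
- have E : \forall y \near x, 0 = flatexp k y.
    near=> y; rewrite /flatexp ltNge ifF //; apply/negbF/ltW.
    by near: y; exact: lt_nbhsl.
  have f0 j : flatexp j x = 0 by rewrite /flatexp ltNge (ltW x0).
  have [a b] := is_derive_cst (0 : R) x (1 : R).
  split; first exact: (near_eq_derivable E a).
  by rewrite -(@near_eq_derive _ _ _ _ _ x (1 : R) E) !f0 mulr0 addr0; exact: b.
- subst x.
  have f0 j : flatexp j 0 = 0 by rewrite /flatexp ltxx.
  have [d dE] : differentiable (flatexp k) 0 /\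
      'd (flatexp k) 0 = (\0 : {linear R -> R}) :> (R -> R).
    apply: diff_eps; first by move=> y; exact: cvg_cst.
    move=> e e0; pose C : R := (k.+2)`!%:R.
    have C0 : 0 < C by rewrite ltr0n fact_gt0.
    near=> h; rewrite addr0 f0 !subr0 ger0_norm ?flatexp_ge0 //.
    apply: (le_trans (flatexp_le k h)).
    rewrite -(@real_normK _ h) ?num_real // expr2 mulrA ler_wpM2r //.
    rewrite mulrC -ler_pdivlMr //; apply: ltW; near: h.
    apply/nbhs_ballP; exists (e / C); first by rewrite /= divr_gt0.
    by move=> y; rewrite /ball /= sub0r normrN.
  split; first exact: diff_derivable.
  by rewrite deriveE // dE !f0 mulr0 addr0.
Unshelve. all: by end_near. Qed.

Lemma flatexp_smooth k : sm (flatexp k).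
Proof.
apply/smooth_onP => n; elim: n k => [|n ih] k.
  by split=> // x _; apply/derivable1_diffP; have [] := flatexp_derive k x.
split=> [x _|v].
  by apply/derivable1_diffP; have [] := flatexp_derive k x.
apply: (@Cn_ext _ _ _ _ (fun x => v * (- k%:R * flatexp k.+1 x + flatexp k.+2 x))).
- exact: openT.
- move=> x _; have [a b] := flatexp_derive k x.
  rewrite deriveE; last exact/derivable1_diffP.
  by rewrite diff1E ?derive1E ?b //; exact/derivable1_diffP.
- apply: CnM; [exact: openT|exact: Cn_cst|]; apply: CnD; [exact: openT| |exact: ih].
  by apply: CnM; [exact: openT|exact: Cn_cst|exact: ih].
Qed.

Definition bumpfun (x : R) := flatexp 0 x * flatexp 0 (1 - x).

Lemma smooth_affine f (a b : R) : sm f -> sm (fun x => f (a + b * x)).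
Proof.
move=> sf; apply: (smooth_on_comp (fr := real_frame) (B := setT) (g := fun x => a + b * x)) => //.
  exact: openT.
move=> i; apply: smD; first exact: sm_cst.
by apply: smM; [exact: sm_cst | exact: sm_id].
Qed.

Lemma bumpfun_sm : sm bumpfun.
Proof.
apply: smM; first exact: flatexp_smooth.
have := @smooth_affine (flatexp 0) 1 (-1) (flatexp_smooth 0).
by congr sm; apply/funext => x; rewrite mulN1r.
Qed.

Lemma bumpfun_ge0 x : 0 <= bumpfun x.
Proof. by apply: mulr_ge0; exact: flatexp_ge0. Qed.

Lemma bumpfun_out x : (x <= 0) || (1 <= x) -> bumpfun x = 0.
Proof.
move=> /orP[x0|x1]; rewrite /bumpfun /flatexp.
  by rewrite ltNge x0 mul0r.
by rewrite [0 < 1 - x]ltNge subr_le0 x1 mulr0.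
Qed.

Lemma bumpfun_tst : tst bumpfun.
Proof.
split; first exact: bumpfun_sm.
exists 1 => x; rewrite ler_normr => /orP[x1|x1]; apply: bumpfun_out; apply/orP; first by right.
by left; lra.
Qed.

Lemma bumpfun_half : 0 < bumpfun 2^-1.
Proof.
have h : 0 < 2^-1 :> R by rewrite invr_gt0.
have h2 : 1 - 2^-1 = 2^-1 :> R by field.
by rewrite /bumpfun h2 /flatexp h expr0 mul1r mulr_gt0 // expR_gt0.
Qed.

Let P := prim bumpfun.

Let dP x : is_derive x (1 : R) P (bumpfun x).
Proof. exact: is_derive_prim bumpfun_sm. Qed.

Let P_ndecr a b : a <= b -> P a <= P b.
Proof.
move=> ab; rewrite -subr_ge0 -(segint_antiderivative bumpfun_sm dP ab).
by apply: Rintegral_ge0 => x _; exact: bumpfun_ge0.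
Qed.

Let P_const a b : a <= b -> (forall x, a <= x <= b -> bumpfun x = 0) -> P a = P b.
Proof.
move=> ab h; apply/esym/eqP; rewrite -subr_eq0 -(segint_antiderivative bumpfun_sm dP ab).
rewrite (@segint_ext _ _ _ _ (fun=> 0 * 0)); last by move=> t /h ->; rewrite mulr0.
by rewrite segintZ ?mul0r //; exact: contin_cst.
Qed.

Let P0 x : x <= 0 -> P x = 0.
Proof.
move=> x0; rewrite -(prim0 bumpfun); apply: P_const => // y /andP[_ y0].
by apply: bumpfun_out; rewrite y0.
Qed.

Let P1 x : 1 <= x -> P x = P 1.
Proof.
move=> x1; symmetry; apply: P_const => // y /andP[y1 _].
by apply: bumpfun_out; rewrite y1 orbT.
Qed.

(** Otherwise the nonnegative [bumpfun] would have integral 0 and vanish at 1/2. *)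
Let P1_gt0 : 0 < P 1.
Proof.
have P1ge : 0 <= P 1 by rewrite -(P0 (lexx 0)) P_ndecr.
rewrite lt_neqAle P1ge andbT; apply/eqP => E.
have [A0 sA] : 0 < (1 : R) /\ supp 1 bumpfun.
  split=> // x; rewrite ler_normr => /orP[x1|x1]; apply: bumpfun_out; apply/orP; first by right.
  by left; lra.
have I0 : lint bumpfun = 0.
  rewrite (lint_antiderivative bumpfun_sm A0 sA dP) -E (P0 (x := -1)) ?subr0 //.
have := lint_eq0 bumpfun_tst bumpfun_ge0 I0 2^-1.
by have := bumpfun_half; move=> /gt_eqF/eqP h /h.
Qed.

Definition step (x : R) := prim bumpfun x / prim bumpfun 1.

Lemma step_sm : sm step.
Proof.
apply: smM; last exact: sm_cst.
have sF : sfam [set: R] (fun _ : R => bumpfun).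
  apply: (smooth_on_comp (fr := real_frame) (B := [set: R])
    (g := fun p : R * R => p.2)) bumpfun_sm _ => //; first exact: open_setXT openT.
  by move=> j; exact: smooth_on_sndR.
exact: (sfam_slice real_frame (sfam_prim real_frame openT sF) (s := 0)).
Qed.

Lemma step0 x : x <= 0 -> step x = 0.
Proof. by move=> /P0 h; rewrite /step -/P h mul0r. Qed.

Lemma step1 x : 1 <= x -> step x = 1.
Proof. by move=> /P1 h; rewrite /step -/P h divff // gt_eqF. Qed.

Lemma step_ge0 x : 0 <= step x.
Proof.
rewrite /step -/P; apply: divr_ge0; last exact: ltW.
have [x0|x0] := leP x 0; first by rewrite P0.
by rewrite -(P0 (lexx 0)) P_ndecr // ltW.
Qed.

Lemma step_le1 x : step x <= 1.
Proof.
rewrite /step -/P ler_pdivrMr // mul1r; have [x1|x1] := leP 1 x; first by rewrite P1.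
by rewrite P_ndecr // ltW.
Qed.

Lemma tst_derive1_step : tst (derive1 step).
Proof.
apply: (eq_tst (f := fun x => (P 1)^-1 * bumpfun x)); last first.
  by apply: tstMl; [exact: sm_cst | exact: bumpfun_tst].
move=> x; rewrite derive1E.
have [a b] := @is_deriveZ R R R P (P 1)^-1 x 1 _ (dP x).
rewrite -[LHS]b; congr ('D_1 _ x); apply/funext => y; exact: mulrC.
Qed.

End Step.

(** * Paths through prescribed points with prescribed velocities *)

Section Curves.
Context {R : realType} {N : nat}.
Implicit Types (u v : R -> 'rV[R]_N) (p q : 'rV[R]_N).

(** A field without the obligation to stay in [U]: this class is closed under sums and shifts, so a
    path is assembled first and shown to lie in [U] afterwards. *)
Definition curve u := vsm u /\ forall i, tst (dx u i).

Lemma curve_field (U : set 'rV[R]_N) u : curve u -> (forall x, U (u x)) -> is_field U u.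
Proof.
move=> [su tu] Uu; split=> //.
have /choice[A HA] : forall i, exists A, supp A (dx u i) by move=> i; have [] := tu i.
exists (\sum_i `|A i|) => i x Ax; apply: HA; apply: le_trans Ax.
rewrite (bigD1 i) //=; apply: (le_trans (ler_norm _)).
by rewrite lerDl; apply: sumr_ge0.
Qed.

Lemma curve_cst p : curve (fun=> p).
Proof.
split; first by move=> i; exact: sm_cst.
by move=> i; apply: (eq_tst _ tst0) => x; rewrite /dx derive1_cst.
Qed.

Lemma curveD u v : curve u -> curve v -> curve (fun x => u x + v x).
Proof.
move=> [su tu] [sv tv].
have E i : (fun x => (u x + v x) 0 i) = (fun x => u x 0 i + v x 0 i).
  by apply/funext => x; rewrite mxE.
split=> i; first by rewrite E; exact: smD.
by apply: (eq_tst _ (tstD (tu i) (tv i))) => x; rewrite /dx E derive1D.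
Qed.

Lemma dxD u v i x : curve u -> curve v ->
  dx (fun x => u x + v x) i x = dx u i x + dx v i x.
Proof.
move=> [su _] [sv _]; rewrite /dx -derive1D //; apply: (congr1 (fun g => derive1 g x)).
by apply/funext => y; rewrite mxE.
Qed.

Lemma derive1_shift (f : R -> R) c x :
  derive1 (fun x => f (x + c)) x = derive1 f (x + c).
Proof.
rewrite !derive1E /derive; apply: (congr1 (fun f : R -> R => lim (f @ 0^'))).
by apply/funext => h /=; rewrite addrA.
Qed.

Lemma sm_shift f (c : R) : sm f -> sm (fun x => f (x + c)).
Proof.
move=> sf; have := smooth_affine c 1 sf; congr sm; apply/funext => x.
by rewrite mul1r addrC.
Qed.

Lemma tst_shift f (c : R) : tst f -> tst (fun x => f (x + c)).
Proof.
move=> [sf [A sA]]; split; first exact: sm_shift.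
exists (A + `|c|) => x Ax; apply: sA.
have := ler_normB (x + c) c; rewrite addrK; lra.
Qed.

Lemma curve_shift u c : curve u -> curve (fun x => u (x + c)).
Proof.
move=> [su tu]; split=> i; first exact: (sm_shift c (su i)).
apply: (eq_tst _ (tst_shift c (tu i))) => x.
exact: (esym (derive1_shift (fun x => u x 0 i) c x)).
Qed.

Lemma dx_shift u c i x : dx (fun x => u (x + c)) i x = dx u i (x + c).
Proof. exact: (derive1_shift (fun x => u x 0 i) c x). Qed.

Lemma derive1_scaled f (d : R) x : sm f -> derive1 (fun x => f x * d) x = derive1 f x * d.
Proof.
move=> sf; rewrite (derive1M x sf (sm_cst d)).
by rewrite (derive1_cst d x) mulr0 addr0.
Qed.

Lemma curve_scaled f p : sm f -> tst (derive1 f) -> curve (fun x => f x *: p).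
Proof.
move=> sf tf.
have E i : (fun x => (f x *: p) 0 i) = (fun x => f x * p 0 i).
  by apply/funext => x; rewrite mxE.
split=> i; first by rewrite E; apply: smM => //; exact: sm_cst.
by apply: (eq_tst _ (tstMr tf (sm_cst (p 0 i)))) => x; rewrite /dx E derive1_scaled.
Qed.

Lemma dx_scaled f p i x : sm f -> dx (fun x => f x *: p) i x = derive1 f x * p 0 i.
Proof.
move=> sf; rewrite /dx -derive1_scaled //; apply: (congr1 (fun g => derive1 g x)).
by apply/funext => y; rewrite mxE.
Qed.

Lemma derive1_lt (f g : R -> R) a x : (forall y, y < a -> f y = g y) -> x < a ->
  derive1 f x = derive1 g x.
Proof.
move=> fg xa; rewrite !derive1E; apply: (@eq_on_derive _ _ [set y | y < a]) => //.
Qed.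

Lemma derive1_gt (f g : R -> R) a x : (forall y, a < y -> f y = g y) -> a < x ->
  derive1 f x = derive1 g x.
Proof.
move=> fg xa; rewrite !derive1E; apply: (@eq_on_derive _ _ [set y | a < y]) => //.
Qed.

Lemma dx_lt u p a i x : (forall y, y < a -> u y = p) -> x < a -> dx u i x = 0.
Proof.
move=> up xa; rewrite /dx (@derive1_lt _ (fun=> p 0 i) a) ?derive1_cst //.
by move=> y /up ->.
Qed.

Lemma dx_gt u p a i x : (forall y, a < y -> u y = p) -> a < x -> dx u i x = 0.
Proof.
move=> up xa; rewrite /dx (@derive1_gt _ (fun=> p 0 i) a) ?derive1_cst //.
by move=> y /up ->.
Qed.

Section Joined.
Variable U : set 'rV[R]_N.
Hypotheses (openU : open U) (connectedU : connected U).

(** The curve rests on both ends, so that further motion can be attached smoothly. *)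
Definition joined q p := exists v (T : R), [/\ curve v, forall x, U (v x),
  forall x, x <= 0 -> v x = q, forall x, T <= x -> v x = p & 0 <= T].

Lemma joined_refl q : U q -> joined q q.
Proof. by move=> Uq; exists (fun=> q), 0; split=> //; exact: curve_cst. Qed.

(** The old curve rests at p from time [T] on; the segment to p' is then run through with the clock
    [step (x - T)], so no corner arises. *)
Lemma joined_segment q p p' : joined q p ->
  (forall t : R, 0 <= t <= 1 -> U (p + t *: (p' - p))) -> joined q p'.
Proof.
move=> [v [T [cv Uv v0 vT T0]]] Us.
pose f x := step (x - T) : R.
exists (fun x => v x + f x *: (p' - p)), (T + 1).
have sf : sm f by apply: sm_shift; exact: step_sm.
have tf : tst (derive1 f).
  apply: (eq_tst _ (tst_shift (- T) tst_derive1_step)) => x.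
  exact: (esym (derive1_shift _ _ _)).
split.
- by apply: curveD => //; exact: curve_scaled.
- move=> x; have [xT|/ltW Tx] := leP x T.
    by rewrite /f step0 ?scale0r ?addr0 // subr_le0.
  by rewrite vT //; apply: Us; rewrite step_ge0 step_le1.
- move=> x x0; rewrite v0 // /f step0 ?scale0r ?addr0 // subr_le0.
  exact: le_trans T0.
- move=> x Tx; rewrite vT; last by lra.
  by rewrite /f step1 ?scale1r ?[p + _]addrC ?subrK //; lra.
- by lra.
Qed.

Lemma ball_segment q r p' (t : R) : ball q r p' -> 0 <= t <= 1 ->
  ball q r (q + t *: (p' - q)) /\ ball q r (p' + t *: (q - p')).
Proof.
rewrite -ball_normE /= => qp /andP[t0 t1]; split.
  rewrite opprD addrA subrr add0r normrN normrZ ger0_norm // distrC.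
  by apply: le_lt_trans qp; rewrite ler_piMl.
have -> : q - (p' + t *: (q - p')) = (1 - t) *: (q - p').
  by rewrite opprD addrA scalerBl scale1r.
rewrite normrZ ger0_norm ?subr_ge0 //.
by apply: le_lt_trans qp; rewrite ler_piMl // lerBlDr lerDl.
Qed.

(** Segments in a small ball can be run in both directions, so the points of [U] joined to q and
    those not joined to it both form open sets; connectedness leaves only the first. *)
Lemma joined_all q p : U q -> U p -> joined q p.
Proof.
move=> Uq Up.
have joined_ball a r b : ball a r `<=` U -> ball a r b ->
    (joined q a -> joined q b) /\ (joined q b -> joined q a).
  move=> aU ab; split=> j.
    by apply: (joined_segment j) => t /(ball_segment ab)[h _]; exact: aU.
  by apply: (joined_segment j) => t /(ball_segment ab)[_ h]; exact: aU.
pose J := U `&` [set b | joined q b].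
have oJ : open J.
  rewrite openE => a [Ua ja]; have /nbhs_ballP[r /= r0 aU] := open_near openU Ua.
  apply/nbhs_ballP; exists r => // b ab; split; first exact: aU.
  by have [h _] := joined_ball a r b aU ab; exact: h.
pose K := U `&` [set b | ~ joined q b].
have oK : open K.
  rewrite openE => a [Ua ja]; have /nbhs_ballP[r /= r0 aU] := open_near openU Ua.
  apply/nbhs_ballP; exists r => // b ab; split; first exact: aU.
  by move=> jb; apply: ja; have [_ h] := joined_ball a r b aU ab; exact: h.
have JU : J = U.
  apply: connectedU.
  - by exists q; split=> //; exact: joined_refl.
  - by exists J => //; rewrite setIA setIid.
  - exists (~` K); first exact: open_closedC.
    apply/seteqP; split=> [b [Ub jb]|b [Ub nK]]; first by split=> // -[_]; exact.
    by split=> //; apply: contrapT => jb; apply: nK.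
by have [] : J p by rewrite JU.
Qed.

(** An excursion confined to [0,1] that passes through 0 with slope 1 at 1/2: both cutoff factors
    are 1 between 1/4 and 3/4. *)
Definition kink (y : R) : R := (y - 2^-1) * (step (4 * y) * step (4 * (1 - y))).

Lemma kink_sm : sm kink.
Proof.
apply: smM; first exact: (@sm_shift (fun y => y) (- 2^-1) (@sm_id R)).
apply: smM.
  have := smooth_affine 0 4 (@step_sm R); congr sm; apply/funext => x.
  by rewrite add0r.
have := smooth_affine 4 (-4) (@step_sm R); congr sm; apply/funext => x.
by congr step; ring.
Qed.

Lemma kink_out y : (y <= 0) || (1 <= y) -> kink y = 0.
Proof.
move=> /orP[y0|y1]; rewrite /kink.
  by rewrite (@step0 _ (4 * y)) ?mul0r ?mulr0 //; lra.
by rewrite (@step0 _ (4 * (1 - y))) ?mulr0 //; lra.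
Qed.

Lemma kink_tst : tst kink.
Proof.
split; first exact: kink_sm.
exists 1 => x; rewrite ler_normr => /orP[x1|x1]; apply: kink_out; apply/orP; first by right.
by left; lra.
Qed.

Lemma kink_le1 y : `|kink y| <= 1.
Proof.
have [h|] := boolP ((y <= 0) || (1 <= y)); first by rewrite kink_out // normr0.
rewrite negb_or -!ltNge => /andP[y0 y1]; rewrite /kink normrM.
have h1 : `|y - 2^-1| <= 1 by rewrite ler_norml; apply/andP; split; lra.
have h2 : `|step (4 * y) * step (4 * (1 - y))| <= 1.
  have S z : `|step z : R| <= 1 by rewrite ger0_norm ?step_le1 ?step_ge0.
  by rewrite normrM; have := ler_pM (normr_ge0 _) (normr_ge0 _) (S _) (S _); rewrite mulr1; apply.
by have := ler_pM (normr_ge0 _) (normr_ge0 _) h1 h2; rewrite mulr1.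
Qed.

Lemma kink_half : kink 2^-1 = 0.
Proof. by rewrite /kink subrr mul0r. Qed.

Lemma derive1_kink_half : derive1 kink 2^-1 = 1.
Proof.
transitivity (derive1 (fun y : R => y - 2^-1) 2^-1).
  rewrite !derive1E; apply: (@eq_on_derive _ _
    ([set y : R | 4^-1 < y] `&` [set y : R | y < 1 - 4^-1])).
  - by apply: openI; [exact: open_gt | exact: open_lt].
  - by split => /=; lra.
  - move=> y [/= y1 y2]; rewrite /kink !step1 ?mulr1 //; lra.
rewrite (derive1_shift (fun y => y)) derive1E; exact: derive_id.
Qed.

(** At such a time W_n is a nonzero multiple of column k of w_n(q). The bound -2 reserves the
    neighbourhood of 0 for the jets. *)
Definition visits u q k := exists x, [/\ x < -2, u x = q &
  exists2 s, s != 0 & forall l, dx u l x = s * (l == k)%:R].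

(** Induction on the list: a path for the tail ends at rest at q, a small oscillation along e_k
    supplies the visit, and a connecting curve leads from q to p. *)
Lemma path_exists (L : seq ('rV[R]_N * 'I_N)) : (forall a, a \in L -> U a.1) ->
  forall p, U p -> exists u, [/\ curve u, forall x, U (u x),
    forall x, -2 <= x -> u x = p & forall a, a \in L -> visits u a.1 a.2].
Proof.
elim: L => [|[q k] L ih] UL p Up.
  by exists (fun=> p); split=> //; exact: curve_cst.
have Uq : U q by apply: (UL (q, k)); rewrite mem_head.
have [a aL|u1 [c1 U1 e1 V1]] := ih _ q Uq.
  by apply: UL; rewrite inE aL orbT.
have [v [T [cv Uv v0 vT T0]]] := joined_all Uq Up.
have /nbhs_ballP[r /= r0 BU] := open_near openU Uq.
pose e : 'rV[R]_N := delta_mx 0 k.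
(* Since [kink] is bounded by 1, the excursion has norm at most s|e| < r and stays in the ball
   around q. *)
pose s := r / (1 + `|e|).
have ne : 0 < 1 + `|e| by rewrite ltr_pwDl.
have s0 : 0 < s by rewrite divr_gt0.
pose g y := s * kink y.
have sg : sm g by apply: smM; [exact: sm_cst | exact: kink_sm].
have tg : tst (derive1 g) by apply: tst_derive1; apply: tstMl; [exact: sm_cst|exact: kink_tst].
pose z x := v x + - q.
have cz : curve z by apply: curveD => //; exact: curve_cst.
pose u2 x := u1 (x + (T + 1)).
pose g2 x := g (x + (T + 3)) *: e.
pose z2 x := z (x + (T + 2)).
have cu2 : curve u2 by exact: curve_shift.
have cg2 : curve g2 by exact: (curve_shift _ (curve_scaled e sg tg)).
have cz2 : curve z2 by exact: curve_shift.
(* Schedule: the tail path is over at - T - 3, the excursion takes place between - T - 3 and - T -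
   2, and the connecting curve runs from - T - 2 to -2. In each period the other two summands are
   constant. *)
pose u x := u2 x + (g2 x + z2 x).
have g2_out x : (x <= - T - 3) || (- T - 2 <= x) -> g2 x = 0.
  move=> h; rewrite /g2 /g kink_out ?mulr0 ?scale0r //; apply/orP.
  by case/orP: h => h; [left | right]; lra.
have z2_lt x : x <= - T - 2 -> z2 x = 0.
  by move=> h; rewrite /z2 /z v0 ?subrr //; lra.
have u2_gt x : - T - 3 <= x -> u2 x = q by move=> h; rewrite /u2 e1 //; lra.
have dxu l x : dx u l x = dx u2 l x + (dx g2 l x + dx z2 l x).
  by rewrite (dxD _ _ cu2 (curveD cg2 cz2)) (dxD _ _ cg2 cz2).
exists u; split.
- exact: (curveD cu2 (curveD cg2 cz2)).
- move=> x; rewrite /u; have [h1|h1] := leP x (- T - 3).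
    have h3 : x <= - T - 2 by lra.
    by rewrite (g2_out x) ?h1 // (z2_lt x h3) !addr0; exact: U1.
  have [h2|h2] := leP x (- T - 2); last first.
    rewrite (u2_gt x (ltW h1)) g2_out ?(ltW h2) ?orbT // add0r /z2 /z addrC subrK.
    exact: Uv.
  rewrite (u2_gt x (ltW h1)) z2_lt // addr0; apply: BU.
  rewrite -ball_normE /= opprD addrA subrr add0r normrN /g2 normrZ.
  have : `|g (x + (T + 3))| <= s.
    by rewrite normrM (gtr0_norm s0) ler_piMr ?kink_le1 ?(ltW s0).
  move=> /(ler_wpM2r (normr_ge0 e))/le_lt_trans; apply.
  by rewrite /s mulrAC ltr_pdivrMr // ltr_pM2l // ltrDr.
- move=> x hx; rewrite /u u2_gt ?g2_out ?add0r; [|by apply/orP; right; lra|by lra].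
  by rewrite /z2 /z vT ?[q + _]addrC ?subrK //; lra.
move=> a; rewrite inE => /predU1P[->|/V1 /= [x [hx ux [s' s'0 dxs]]]].
  (* The middle of the excursion, where [kink] vanishes with slope 1. *)
  exists (- T - 2 - 2^-1); split; first by lra.
    rewrite /u /= u2_gt ?z2_lt; [|lra|lra].
    have -> : g2 (- T - 2 - 2^-1) = 0.
      rewrite /g2 /g; have -> : - T - 2 - 2^-1 + (T + 3) = 2^-1 :> R by field.
      by rewrite kink_half mulr0 scale0r.
    by rewrite !addr0.
  exists s; first by rewrite gt_eqF.
  move=> l; rewrite dxu (@dx_gt u2 q (- T - 3)); [|by move=> y /ltW; exact: u2_gt|by lra].
  rewrite (@dx_lt z2 0 (- T - 2)); [|by move=> y /ltW; exact: z2_lt|by lra].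
  rewrite add0r addr0 (dx_shift (fun x => g x *: e)) dx_scaled //.
  have -> : - T - 2 - 2^-1 + (T + 3) = 2^-1 :> R by field.
  have -> : derive1 g 2^-1 = s.
    rewrite (derive1M _ (sm_cst s) kink_sm) (derive1_cst s _) mul0r add0r.
    by rewrite derive1_kink_half mulr1.
  by rewrite mxE eqxx.
exists (x - (T + 1)); split; first by lra.
  rewrite /u g2_out; last by apply/orP; left; lra.
  by rewrite z2_lt ?addr0 /u2 ?subrK //; lra.
exists s' => // l; rewrite dxu (@dx_lt g2 0 (- T - 3)); last by lra.
  rewrite (@dx_lt z2 0 (- T - 2)); [|by move=> y /ltW; exact: z2_lt|by lra].
  by rewrite !addr0 (dx_shift u1) subrK.
by move=> y /ltW hy; rewrite g2_out ?hy.
Qed.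

End Joined.

End Curves.

(** * The Jacobi identity at a critical point of the field *)

Section Jacobiator.
Context {R : realType} {N L : nat}.
Variables (U : set 'rV[R]_N) (eta : 'M[R]_N) (mu : 'M[R]_L).
Variable w : 'I_L -> 'rV[R]_N -> 'M[R]_N.
Hypotheses (openU : open U) (eta_sym : eta^T = eta) (mu_sym : mu^T = mu).
Hypothesis w_smooth : forall n i j, smooth_on U (fun u => w n u i j).

Local Notation M := (nonlocal_op eta mu w).
Local Notation pvel := (pvel w).
Local Notation dpvel := (dpvel w).

(** The factor of a when [vform phi a b] is written as an integral against a; in the half containing
    a_n, the skewness of [dinv] takes a out of the antiderivative. *)
Definition fadj (u phi b : R -> 'rV[R]_N) (x : R) : 'rV[R]_N :=
  \row_i \sum_m \sum_n mu m n * (dvel w m u phi x i * Defs.dinv (pvel n u b) x +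
    Defs.dinv (dpvel m u phi b) x * vel w n u x i).

(** F(b, c) of the overview. In the three terms of the cyclic sum a stands in the first slot, in the
    second slot (hence a sign), and under the operator; the last is freed through [vcov] and the
    skewness of the operator. *)
Definition jcov (u b c : R -> 'rV[R]_N) (x : R) : 'rV[R]_N :=
  fadj u (M u c) b x + - fadj u (M u b) c x + - M u (vcov mu w u b c) x.

Lemma jacE u b c x i : jcov u b c x 0 i =
  fadj u (M u c) b x 0 i - fadj u (M u b) c x 0 i - M u (vcov mu w u b c) x 0 i.
Proof.
have E (p q r : 'rV[R]_N) : (p + - q + - r) 0 i = p 0 i - q 0 i - r 0 i by rewrite !mxE.
exact: E.
Qed.

Section AtField.
Variable u : R -> 'rV[R]_N.
Hypothesis fu : is_field U u.

Lemma vtst_fadj phi b : vtst phi -> vtst b -> vtst (fadj u phi b).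
Proof.
move=> tp tb i.
have H : tst (fun x => \sum_m \sum_n mu m n * (dvel w m u phi x i * Defs.dinv (pvel n u b) x +
    Defs.dinv (dpvel m u phi b) x * vel w n u x i)).
  apply: tst_sum => m _; apply: tst_sum => n _; apply: tstMl; first exact: sm_cst.
  apply: tstD.
    by apply: tstMr; [exact: (tst_dvel w_smooth fu)|exact: (sm_dinv_pvel w_smooth fu)].
  apply: tstMl; last exact: (tst_vel w_smooth fu).
  by apply: sm_dinv; apply: (tst_dpvel w_smooth fu) => //; exact: vtst_vsm.
by apply: (eq_tst _ H) => x; rewrite mxE.
Qed.

Lemma vform_fadj phi a b : vtst phi -> vtst a -> vtst b ->
  vform mu w u phi a b = lint (dot a (fadj u phi b)).
Proof.
move=> tp ta tb.
have sa := vtst_vsm ta; have sb := vtst_vsm tb.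
have tpa m := tst_dpvel w_smooth fu m tp sa.
have tpb m := tst_dpvel w_smooth fu m tp sb.
have twa n := tst_pvel w_smooth fu n ta; have twb n := tst_pvel w_smooth fu n tb.
have t1 m n : tst (fun x => dpvel m u phi a x * Defs.dinv (pvel n u b) x).
  by apply: tstMr => //; exact: sm_dinv.
have t2 m n : tst (fun x => Defs.dinv (dpvel m u phi b) x * pvel n u a x).
  by apply: tstMl => //; exact: sm_dinv.
have t3 m n := tstMl (sm_cst (mu m n)) (tstD (t1 m n) (t2 m n)).
transitivity (lint (fun x => \sum_m \sum_n mu m n *
   (dpvel m u phi a x * Defs.dinv (pvel n u b) x + Defs.dinv (dpvel m u phi b) x * pvel n u a x))).
  rewrite lint_sum; last by move=> m _; apply: tst_sum.
  apply: eq_bigr => m _; rewrite lint_sum //; apply: eq_bigr => n _.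
  rewrite lintZ; last exact: tstD.
  rewrite lintD // (lint_dinv_skew (tpb m) (twa n)) opprK.
  by [].
congr lint; apply/funext => x; rewrite /dot.
under [RHS]eq_bigr do rewrite mxE mulr_sumr.
rewrite [RHS]exchange_big; apply: eq_bigr => m _.
under [RHS]eq_bigr do rewrite mulr_sumr.
rewrite [RHS]exchange_big; apply: eq_bigr => n _.
rewrite /dpvel /pvel mulr_suml mulr_sumr -big_split mulr_sumr; apply: eq_bigr => i _ /=.
ring.
Qed.

Lemma vform_skew phi a b : vform mu w u phi a b = - vform mu w u phi b a.
Proof.
rewrite /vform -sumrN; apply: eq_bigr => m _; rewrite -sumrN; apply: eq_bigr => n _.
by rewrite -mulrN opprB.
Qed.

Lemma vtst_jcov b c : vtst b -> vtst c -> vtst (jcov u b c).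
Proof.
move=> tb tc; have tM z : vtst z -> vtst (M u z) by exact: (vtst_op eta mu w_smooth fu).
apply: vtstD; first apply: vtstD; first by apply: vtst_fadj => //; exact: tM.
  by apply: vtstN; apply: vtst_fadj => //; exact: tM.
by apply: vtstN; apply: tM; exact: (vcov_vtst mu w_smooth fu).
Qed.

Lemma jacobiator_jcov a b c : vtst a -> vtst b -> vtst c ->
  jacobiator eta mu w u a b c = lint (dot a (jcov u b c)).
Proof.
move=> ta tb tc; have tM z : vtst z -> vtst (M u z) by exact: (vtst_op eta mu w_smooth fu).
have tN := vcov_vtst mu w_smooth fu tb tc.
have E1 : vform mu w u (M u c) a b = lint (dot a (fadj u (M u c) b)).
  by apply: vform_fadj => //; exact: tM.
have E2 : vform mu w u (M u b) c a = - lint (dot a (fadj u (M u b) c)).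
  by rewrite vform_skew vform_fadj //; exact: tM.
have E3 : vform mu w u (M u a) b c = - lint (dot a (M u (vcov mu w u b c))).
  rewrite (vform_adj mu w_smooth fu) //; last exact: tM.
  exact: (oform_skew eta_sym mu_sym w_smooth fu tN ta).
rewrite /jacobiator E1 E2 E3.
have s1 : tst (dot a (fadj u (M u c) b)).
  by apply: tst_dot => //; apply: vtst_vsm; apply: vtst_fadj => //; exact: tM.
have s2 : tst (dot a (fadj u (M u b) c)).
  by apply: tst_dot => //; apply: vtst_vsm; apply: vtst_fadj => //; exact: tM.
have s3 : tst (dot a (M u (vcov mu w u b c))).
  by apply: tst_dot => //; apply: vtst_vsm; exact: tM.
transitivity (lint (fun x => dot a (fadj u (M u c) b) x - dot a (fadj u (M u b) c) x
   - dot a (M u (vcov mu w u b c)) x)).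
  rewrite lintB //; last by apply: tstD => //; exact: tstN.
  by rewrite lintB // addrAC.
congr lint; apply/funext => x; rewrite /dot -!sumrB; apply: eq_bigr => i _.
by rewrite jacE !mulrBr.
Qed.

(** With a = F(b, c), itself a test function, the cyclic sum is the integral of |F(b, c)|^2. *)
Lemma jcov_eq0 b c : vtst b -> vtst c ->
  (forall a, vtst a -> jacobiator eta mu w u a b c = 0) -> forall x, jcov u b c x = 0.
Proof.
move=> tb tc H x; have tj := vtst_jcov tb tc; have := H _ tj; rewrite jacobiator_jcov // => I0.
have tjj : tst (dot (jcov u b c) (jcov u b c)) by apply: tst_dot => //; exact: vtst_vsm.
have pos y : 0 <= dot (jcov u b c) (jcov u b c) y.
  by apply: sumr_ge0 => i _; rewrite -expr2 sqr_ge0.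
have /eqP := lint_eq0 tjj pos I0 x; rewrite psumr_eq0; last first.
  by move=> i _; rewrite -expr2 sqr_ge0.
move=> /allP all0; apply/rowP => i; rewrite [in RHS]mxE.
have := all0 i (mem_index_enum i).
by rewrite implyTb mulf_eq0 orbb => /eqP.
Qed.

End AtField.

End Jacobiator.

Section SecondDerivative.
Context {R : realType}.
Implicit Types f g : R -> R.

Lemma derive1M_zero f g x : sm f -> sm g -> f x = 0 ->
  derive1 (fun y => f y * g y) x = derive1 f x * g x.
Proof. by move=> sf sg f0; rewrite derive1M // f0 mul0r addr0. Qed.

Definition derive2 f := derive1 (derive1 f).

Lemma derive2M f g x : sm f -> sm g ->
  derive2 (fun y => f y * g y) x =
  derive2 f x * g x + 2 * (derive1 f x * derive1 g x) + f x * derive2 g x.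
Proof.
move=> sf sg; rewrite /derive2.
have -> : derive1 (fun y => f y * g y) = (fun y => derive1 f y * g y + f y * derive1 g y).
  by apply/funext => y; rewrite derive1M.
have sf' := sm_derive1 sf; have sg' := sm_derive1 sg.
rewrite (derive1D x (smM sf' sg) (smM sf sg')) (derive1M x sf' sg) (derive1M x sf sg').
have E (p q r : R) : p + q + (q + r) = p + 2 * q + r by ring.
exact: E.
Qed.

Lemma derive2D f g x : sm f -> sm g ->
  derive2 (fun y => f y + g y) x = derive2 f x + derive2 g x.
Proof.
move=> sf sg; rewrite /derive2 -derive1D; [|exact: sm_derive1|exact: sm_derive1].
by apply: (congr1 (fun h => derive1 h x)); apply/funext => y; rewrite derive1D.
Qed.

Lemma derive2N f x : sm f -> derive2 (fun y => - f y) x = - derive2 f x.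
Proof.
have N g y : sm g -> derive1 (fun y => - g y) y = - derive1 g y.
  move=> sg; rewrite !derive1E deriveN //; exact: sm_derivable.
move=> sf; rewrite /derive2 -N; last exact: sm_derive1.
by apply: (congr1 (fun h => derive1 h x)); apply/funext => y; exact: N.
Qed.

Lemma derive2_sum (I : Type) (r : seq I) (P : pred I) (f : I -> R -> R) x :
  (forall i, P i -> sm (f i)) ->
  derive2 (fun y => \sum_(i <- r | P i) f i y) x = \sum_(i <- r | P i) derive2 (f i) x.
Proof.
move=> sf; rewrite /derive2 -derive1_sum; last by move=> i Pi; apply: sm_derive1; exact: sf.
by apply: (congr1 (fun h => derive1 h x)); apply/funext => y; rewrite derive1_sum.
Qed.

End SecondDerivative.

Section Jet.
Context {R : realType} {N L : nat}.
Variables (eta : 'M[R]_N) (mu : 'M[R]_L) (W : 'I_L -> 'M[R]_N).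
Variables (D : 'I_L -> 'I_N -> 'I_N -> 'I_N -> R) (Y : 'I_N -> R).
Implicit Types (b c : 'I_N -> R) (bn cn : 'I_L -> R).

(* The value of jcov at a critical point x of u in terms of b = b(x), b2 = b''(x),
   bn = (dinv (pvel n u b) x)_n, and likewise for c, with W = w(u(x)), Y = u_xx(x)
   and D the curl of w at u(x). *)
Definition jetS b2 bn m i : R := \sum_k W m i k * (\sum_j eta k j * b2 j +
  \sum_p \sum_q mu p q * ((\sum_l W p k l * Y l) * bn q)).

Definition jetG b bn c cn (n : 'I_L) (s : 'I_N) : R := b s * cn n - c s * bn n.

Definition jetG2 b b2 bn c c2 cn n s : R :=
  (b2 s * cn n + b s * bil (W n) c Y) - (c2 s * bn n + c s * bil (W n) b Y).

Definition jetN b b2 bn c c2 cn j : R := \sum_m \sum_n mu m n *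
  (\sum_s jetG b bn c cn n s * (\sum_k D m s k j * Y k)
   - \sum_s jetG2 b b2 bn c c2 cn n s * W m s j).

Definition jetJ b b2 bn c c2 cn i : R :=
  \sum_m \sum_n mu m n * (bn n * jetS c2 cn m i) -
  \sum_m \sum_n mu m n * (cn n * jetS b2 bn m i) -
  \sum_j eta i j * jetN b b2 bn c c2 cn j.

End Jet.

Definition curl {R : realType} {N L : nat} (w : 'I_L -> 'rV[R]_N -> 'M[R]_N) q
    (m : 'I_L) (s k j : 'I_N) : R :=
  partial j (fun p => w m p s k) q - partial k (fun p => w m p s j) q.

(** * The jet of the cyclic sum where u_x = 0 *)

Section CriticalPoint.
Context {R : realType} {N L : nat}.
Variables (U : set 'rV[R]_N) (eta : 'M[R]_N) (mu : 'M[R]_L).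
Variable w : 'I_L -> 'rV[R]_N -> 'M[R]_N.
Hypothesis w_smooth : forall n i j, smooth_on U (fun u => w n u i j).

Local Notation M := (nonlocal_op eta mu w).
Local Notation pvel := (pvel w).
Local Notation vel := (vel w).

Variable u : R -> 'rV[R]_N.
Hypothesis fu : is_field U u.
Variable x : R.
Hypothesis crit : forall k, dx u k x = 0.

Let Y k : R := derive1 (dx u k) x.
Let W n := w n (u x).
Let ev (z : R -> 'rV[R]_N) i : R := z x 0 i.
Let ev2 (z : R -> 'rV[R]_N) i : R := derive2 (fun y => z y 0 i) x.
Let zn z n : R := Defs.dinv (pvel n u z) x.

Lemma crit_derive1_comp f : smooth_on U f -> derive1 (fun y => f (u y)) x = 0.
Proof.
move=> sf; rewrite (derive1_field_comp fu _ sf); apply: big1 => l _.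
by rewrite crit mul0r.
Qed.

Lemma crit_derive2_comp f : smooth_on U f ->
  derive2 (fun y => f (u y)) x = \sum_l partial l f (u x) * Y l.
Proof.
move=> sf; rewrite /derive2.
have -> : derive1 (fun y => f (u y)) = (fun y => \sum_l dx u l y * partial l f (u y)).
  by apply/funext => y; rewrite (derive1_field_comp fu _ sf).
have sd l : sm (dx u l) by have [] := tst_dx fu l.
have sp l : sm (fun y => partial l f (u y)).
  by apply: (sm_comp fu (f := partial l f)); exact: smooth_on_derive.
rewrite derive1_sum; last by move=> l _; exact: smM.
apply: eq_bigr => l _.
by rewrite (derive1M_zero (sd l) (sp l) (crit l)) mulrC.
Qed.

Lemma crit_vel n i : vel n u x i = 0.
Proof. by apply: big1 => k _; rewrite crit mulr0. Qed.

Lemma crit_derive1_vel n i : derive1 (fun y => vel n u y i) x = \sum_k W n i k * Y k.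
Proof.
have sd l : sm (dx u l) by have [] := tst_dx fu l.
rewrite derive1_sum; last by move=> k _; apply: smM => //; exact: (sm_w w_smooth fu).
apply: eq_bigr => k _; rewrite derive1M //; last exact: (sm_w w_smooth fu).
by rewrite (crit_derive1_comp (w_smooth n i k)) mul0r add0r.
Qed.

Lemma crit_pvel n z : pvel n u z x = 0.
Proof. by apply: big1 => j _; rewrite crit_vel mul0r. Qed.

Lemma crit_derive1_dinv n z : vtst z -> derive1 (Defs.dinv (pvel n u z)) x = 0.
Proof. by move=> tz; rewrite derive1_dinv ?crit_pvel //; exact: (tst_pvel w_smooth fu). Qed.

(** b_n' = <W_n, b> vanishes together with u_x; in b_n'' only the derivative of W_n survives, which
    is w_n u_xx. *)
Lemma crit_derive2_dinv n z : vtst z ->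
  derive2 (Defs.dinv (pvel n u z)) x = bil (W n) (ev z) Y.
Proof.
move=> tz; have tp := tst_pvel w_smooth fu n tz; rewrite /derive2.
have -> : derive1 (Defs.dinv (pvel n u z)) = pvel n u z.
  by apply/funext => y; rewrite derive1_dinv.
have sW j : sm (fun y => vel n u y j) by have [] := tst_vel w_smooth fu n j.
rewrite derive1_sum; last by move=> j _; apply: smM => //; case: (tz j).
apply: eq_bigr => j _; rewrite derive1M_zero ?crit_vel //; last by case: (tz j).
rewrite crit_derive1_vel mulr_suml; apply: eq_bigr => k _; rewrite /ev; ring.
Qed.

Lemma crit_dx_op z k : vtst z -> dx (M u z) k x =
  \sum_j eta k j * ev2 z j + \sum_p \sum_q mu p q * ((\sum_l W p k l * Y l) * zn z q).
Proof.
move=> tz; rewrite /dx.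
have -> : (fun y => M u z y 0 k) = (fun y => \sum_j eta k j * dx z j y +
  \sum_m \sum_n mu m n * (vel m u y k * Defs.dinv (pvel n u z) y)).
  by apply/funext => y; rewrite nonlocal_opE.
have sz j : sm (dx z j) by apply: sm_derive1; case: (tz j).
have sW m : sm (fun y => vel m u y k) by have [] := tst_vel w_smooth fu m k.
have sd n := sm_dinv_pvel w_smooth fu n tz.
have s1 j : sm (fun y => eta k j * dx z j y) by apply: smM => //; exact: sm_cst.
have s2 m n := smM (sW m) (sd n).
have s3 m n := smM (sm_cst (mu m n)) (s2 m n).
have s4 m : sm (fun y => \sum_n mu m n * (vel m u y k * Defs.dinv (pvel n u z) y)).
  by apply: sm_sum.
rewrite derive1D; [|by apply: sm_sum|by apply: sm_sum].
rewrite derive1_sum // derive1_sum //; congr (_ + _).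
  apply: eq_bigr => j _; rewrite (derive1M _ (sm_cst (eta k j)) (sz j)).
  by rewrite (derive1_cst (eta k j) x) mul0r add0r.
apply: eq_bigr => m _; rewrite derive1_sum //; apply: eq_bigr => n _.
rewrite (derive1M _ (sm_cst (mu m n)) (s2 m n)) (derive1_cst (mu m n) x) mul0r add0r.
by rewrite (derive1M_zero (sW m) (sd n) (crit_vel m k)) crit_derive1_vel.
Qed.

Lemma crit_gap n b c i : gap w u n b c x 0 i = ev b i * zn c n - ev c i * zn b n.
Proof. by rewrite mxE. Qed.

(** b' could enter only through the cross term 2 b' c_n', and c_n' is 0 here; this keeps first
    derivatives out of the jet. *)
Lemma crit_derive2_gap n b c i : vtst b -> vtst c ->
  derive2 (fun y => gap w u n b c y 0 i) x =
  (ev2 b i * zn c n + ev b i * bil (W n) (ev c) Y) -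
  (ev2 c i * zn b n + ev c i * bil (W n) (ev b) Y).
Proof.
move=> tb tc.
have -> : (fun y => gap w u n b c y 0 i) = (fun y =>
    b y 0 i * Defs.dinv (pvel n u c) y + - (c y 0 i * Defs.dinv (pvel n u b) y)).
  by apply/funext => y; rewrite mxE.
have sd z : vtst z -> sm (Defs.dinv (pvel n u z)) by exact: (sm_dinv_pvel w_smooth fu).
have sz (z : R -> 'rV[R]_N) : vtst z -> sm (fun y => z y 0 i) by move=> tz; case: (tz i).
have s1 := smM (sz _ tb) (sd _ tc); have s2 := smM (sz _ tc) (sd _ tb).
rewrite (derive2D _ s1 (smN s2)) (derive2N _ s2).
rewrite (derive2M _ (sz _ tb) (sd _ tc)) (derive2M _ (sz _ tc) (sd _ tb)).
by rewrite !crit_derive1_dinv // !crit_derive2_dinv // !mulr0 !addr0.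
Qed.

(** Here (w(u))' = 0 and (w(u))'' = (d_k w) u_xx^k. The latter meets the derivative of the explicit
    term (d_l w_k) u_x^k, and the two form the curl; g' is multiplied by 0 in both. *)
Lemma crit_derive1_vadj m g l : vsm g ->
  derive1 (fun y => vadj w u m g y l) x =
  \sum_i ev g i * (\sum_k (partial l (fun p => w m p i k) (u x)
     - partial k (fun p => w m p i l) (u x)) * Y k) - \sum_i ev2 g i * W m i l.
Proof.
move=> sg; have sd k : sm (dx u k) by have [] := tst_dx fu k.
have sw i := sm_w w_smooth fu m i l.
have sp i k := sm_partial_w w_smooth fu m i k l.
have s1 i k := smM (sp i k) (sd k).
have s2 i : sm (fun y => \sum_k partial l (fun p => w m p i k) (u y) * dx u k y).
  by apply: sm_sum.
have s3 i := smM (sg i) (s2 i); have s4 i := smM (sg i) (sw i).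
have s5 : sm (fun y => \sum_i g y 0 i *
    \sum_k partial l (fun p => w m p i k) (u y) * dx u k y) by apply: sm_sum.
have s6 : sm (fun y => \sum_i g y 0 i * w m (u y) i l) by apply: sm_sum.
rewrite /vadj (derive1D _ s5 (smN (sm_derive1 s6))).
have -> : derive1 (fun y => - derive1 (fun y => \sum_i g y 0 i * w m (u y) i l) y) x =
    - \sum_i (ev2 g i * W m i l +
      ev g i * \sum_k partial k (fun p => w m p i l) (u x) * Y k).
  rewrite derive1E deriveN; last by apply: sm_derivable; exact: sm_derive1.
  rewrite -derive1E; congr (- _); rewrite [LHS]derive2_sum //; apply: eq_bigr => i _.
  rewrite (derive2M _ (sg i) (sw i)) (crit_derive1_comp (w_smooth m i l)).
  by rewrite (crit_derive2_comp (w_smooth m i l)) !mulr0 addr0.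
have -> : derive1 (fun y => \sum_i g y 0 i *
    \sum_k partial l (fun p => w m p i k) (u y) * dx u k y) x =
   \sum_i ev g i * \sum_k partial l (fun p => w m p i k) (u x) * Y k.
  rewrite derive1_sum //; apply: eq_bigr => i _.
  have z0 : \sum_k partial l (fun p => w m p i k) (u x) * dx u k x = 0.
    by apply: big1 => k _; rewrite crit mulr0.
  rewrite (derive1M _ (sg i) (s2 i)) z0 mulr0 add0r derive1_sum //; congr (_ * _).
  apply: eq_bigr => k _; rewrite (derive1M _ (sp i k) (sd k)) crit mulr0 add0r.
  by [].
rewrite big_split opprD addrCA [RHS]addrC; congr (_ + _).
rewrite -sumrB; apply: eq_bigr => i _; rewrite -mulrBr -sumrB; congr (_ * _).
by apply: eq_bigr => k _; rewrite mulrBl.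
Qed.

(** The uncontrolled antiderivative [dinv (dpvel m u phi b)] is multiplied by [vel], which is 0 at a
    critical point. This is the reason for evaluating there. *)
Lemma crit_fadj b c i : vtst b -> vtst c -> fadj mu w u (M u c) b x 0 i =
  \sum_m \sum_n mu m n * (zn b n * jetS eta mu W Y (ev2 c) (zn c) m i).
Proof.
move=> tb tc; rewrite mxE; apply: eq_bigr => m _; apply: eq_bigr => n _.
rewrite crit_vel mulr0 addr0 mulrC -/(zn b n) mulrC; congr (_ * _).
rewrite mulrC; congr (_ * _); apply: eq_bigr => k _.
by rewrite crit mulr0 add0r crit_dx_op.
Qed.

Lemma crit_op z i : M u z x 0 i = \sum_j eta i j * dx z j x.
Proof.
rewrite nonlocal_opE [X in _ + X]big1 ?addr0 // => m _; apply: big1 => n _.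
by rewrite crit_vel mul0r mulr0.
Qed.

Lemma crit_dx_vcov b c j : vtst b -> vtst c -> dx (vcov mu w u b c) j x =
  jetN mu W (curl w (u x)) Y (ev b) (ev2 b) (zn b) (ev c) (ev2 c) (zn c) j.
Proof.
move=> tb tc; rewrite /dx.
have -> : (fun y => vcov mu w u b c y 0 j) =
    (fun y => \sum_m \sum_n mu m n * vadj w u m (gap w u n b c) y j).
  by apply/funext => y; rewrite mxE.
have sg n : vsm (gap w u n b c) by apply: vtst_vsm; exact: (vtst_gap w_smooth fu).
have sa m n : sm (fun y => vadj w u m (gap w u n b c) y j).
  have [] // := tst_vadj w_smooth fu m j (g := gap w u n b c).
  exact: (vtst_gap w_smooth fu).
have sc m n := smM (sm_cst (mu m n)) (sa m n).
rewrite derive1_sum; last by move=> m _; apply: sm_sum.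
apply: eq_bigr => m _; rewrite derive1_sum //; apply: eq_bigr => n _.
rewrite (derive1M _ (sm_cst (mu m n)) (sa m n)) (derive1_cst (mu m n) x) mul0r add0r.
congr (_ * _); rewrite crit_derive1_vadj //; congr (_ - _).
  by apply: eq_bigr => s _; rewrite /ev crit_gap.
by apply: eq_bigr => s _; rewrite /ev2 crit_derive2_gap.
Qed.

Lemma crit_jcov b c i : vtst b -> vtst c -> jcov eta mu w u b c x 0 i =
  jetJ eta mu W (curl w (u x)) Y (ev b) (ev2 b) (zn b) (ev c) (ev2 c) (zn c) i.
Proof.
move=> tb tc; rewrite jacE !crit_fadj // crit_op /jetJ; congr (_ - _).
by apply: eq_bigr => j _; rewrite crit_dx_vcov.
Qed.

Lemma crit_jcov_jet b b0 b2 bn c c0 c2 cn y i : vtst b -> vtst c -> Y =1 y ->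
  ev b =1 b0 -> ev2 b =1 b2 -> zn b =1 bn -> ev c =1 c0 -> ev2 c =1 c2 -> zn c =1 cn ->
  jcov eta mu w u b c x 0 i = jetJ eta mu W (curl w (u x)) y b0 b2 bn c0 c2 cn i.
Proof.
move=> tb tc /funext <- /funext <- /funext <- /funext <- /funext <- /funext <- /funext <-.
exact: crit_jcov.
Qed.

End CriticalPoint.

(** * Separation of the conditions by special jets *)

Section JetAlgebra.
Context {R : realType} {N L : nat}.
Variables (eta : 'M[R]_N) (mu : 'M[R]_L) (W : 'I_L -> 'M[R]_N).
Variable D : 'I_L -> 'I_N -> 'I_N -> 'I_N -> R.
Hypotheses (eta_sym : eta^T = eta) (eta_unit : eta \in unitmx) (mu_unit : mu \in unitmx).

Let Z : 'I_N -> R := fun=> 0.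
Let dl (a : 'I_N) : 'I_N -> R := fun i => (i == a)%:R.
Let Zn : 'I_L -> R := fun=> 0.

Lemma sum_delta (I : finType) (a : I) (F : I -> R) : \sum_i (i == a)%:R * F i = F a.
Proof.
rewrite (bigD1 a) //= eqxx mul1r big1 ?addr0 // => i /negbTE ->.
by rewrite mul0r.
Qed.

Lemma unitmx_inj (K : nat) (A : 'M[R]_K) (F : 'I_K -> R) : A \in unitmx ->
  (forall i, \sum_j A i j * F j = 0) -> forall j, F j = 0.
Proof.
move=> uA H j; have E : A *m (\col_j F j) = 0.
  by apply/colP => i; rewrite !mxE -[RHS](H i); apply: eq_bigr => k _; rewrite mxE.
have := congr1 (mulmx (invmx A)) E; rewrite mulKmx // mulmx0 => /colP/(_ j).
by rewrite !mxE.
Qed.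

(** A column of the inverse of [mu]: prescribing it as the nonlocal values b_n singles out the
    affinor with index m. *)
Let dual m : 'I_L -> R := fun n => invmx mu n m.

Lemma sum_dual m0 m : \sum_n mu m n * dual m0 n = (m == m0)%:R.
Proof. by have := congr1 (fun A : 'M[R]_L => A m m0) (mulmxV mu_unit); rewrite !mxE. Qed.

Lemma sum2_dual m0 (X : 'I_L -> R) : \sum_m \sum_n mu m n * (dual m0 n * X m) = X m0.
Proof.
rewrite -(sum_delta m0 X); apply: eq_bigr => m _; rewrite -sum_dual mulr_suml.
by apply: eq_bigr => n _; rewrite mulrA.
Qed.

Lemma bil_delta A a e r : bil A (dl a) (fun k => e * (k == r)%:R) = e * A a r.
Proof.
rewrite /bil; under eq_bigr do under eq_bigr do rewrite -mulrA.
under eq_bigr do rewrite -mulr_sumr.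
rewrite sum_delta -(sum_delta r (fun k => e * A a k)); apply: eq_bigr => k _; ring.
Qed.

Hypothesis J0 : forall r, exists2 e : R, e != 0 &
  forall b b2 bn c c2 cn i,
    jetJ eta mu W D (fun k => e * (k == r)%:R) b b2 bn c c2 cn i = 0.

Lemma sumM0 (I : finType) (F G : I -> R) : (forall i, G i = 0) -> \sum_i F i * G i = 0.
Proof. by move=> G0; apply: big1 => i _; rewrite G0 mulr0. Qed.


Lemma jetS_hess Y b2 m i : jetS eta mu W Y b2 Zn m i =
  \sum_k W m i k * (\sum_j eta k j * b2 j).
Proof.
apply: eq_bigr => k _; rewrite [X in _ + X]big1 ?addr0 // => p _; apply: sumM0 => q.
by rewrite mulr0.
Qed.

Lemma jetS_dual e r m i p : jetS eta mu W (fun k => e * (k == r)%:R) Z (dual p) m i =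
  e * (W m *m W p) i r.
Proof.
rewrite mxE mulr_sumr; apply: eq_bigr => k _; rewrite sumM0 // add0r mulrCA; congr (_ * _).
transitivity (\sum_p' \sum_q mu p' q * (dual p q * (\sum_l W p' k l * (e * (l == r)%:R)))).
  by apply: eq_bigr => p' _; apply: eq_bigr => q _; rewrite [_ * dual p q]mulrC.
rewrite sum2_dual -(sum_delta r (fun l => e * W p k l)); apply: eq_bigr => l _; ring.
Qed.

(** Jets with b, b'', c, c'' zero and with b_n, c_n dual to m and p leave only e times the
    commutator. *)
Lemma jet_commute m p : W m *m W p = W p *m W m.
Proof.
apply/matrixP => i r; have [e e0 /(_ Z Z (dual m) Z Z (dual p) i)] := J0 r.
rewrite /jetJ; under eq_bigr do under eq_bigr do rewrite jetS_dual.
under [X in _ - X - _]eq_bigr do under eq_bigr do rewrite jetS_dual.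
rewrite (sum2_dual m (fun m' => e * (W m' *m W p) i r)).
rewrite (sum2_dual p (fun m' => e * (W m' *m W m) i r)).
rewrite [X in _ - X](_ : _ = 0) ?subr0; last first.
  apply: sumM0 => j; apply: big1 => m' _; apply: sumM0 => n.
  rewrite big1; last by move=> s _; rewrite /jetG !mul0r subr0 mul0r.
  by rewrite sub0r big1 ?oppr0 // => s _; rewrite /jetG2 !mul0r addr0 subr0 mul0r.
by move/eqP; rewrite -mulrBr mulf_eq0 (negbTE e0) subr_eq0 => /eqP.
Qed.

Lemma jetN_dual Y m c c2 j : jetN mu W D Y Z Z (dual m) c c2 Zn j =
  \sum_s c2 s * W m s j - \sum_s c s * (\sum_k D m s k j * Y k).
Proof.
have bil0 A v : bil A Z v = 0.
  by apply: big1 => a _; apply: big1 => k _; rewrite !mul0r.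
rewrite -(sum2_dual m (fun m => \sum_s c2 s * W m s j -
   \sum_s c s * (\sum_k D m s k j * Y k))).
apply: eq_bigr => m' _; apply: eq_bigr => n _; congr (_ * _).
rewrite mulrBr addrC !mulr_sumr -!sumrN; congr (_ + _); apply: eq_bigr => s _.
  by rewrite /jetG2 bil0 mulr0 mul0r !mulr0 add0r sub0r addr0; ring.
by rewrite /jetG mulr0 sub0r; ring.
Qed.

(** With b and b'' zero, b_n dual to m and c_n zero, an identity linear in c and c'' remains; its
    two coefficients give closedness and symmetry. *)
Lemma jetJ_dual r e m c c2 i :
  (forall b b2 bn c c2 cn i,
    jetJ eta mu W D (fun k => e * (k == r)%:R) b b2 bn c c2 cn i = 0) ->
  \sum_k W m i k * (\sum_j eta k j * c2 j) =
  \sum_j eta i j * (\sum_s c2 s * W m s j -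
     \sum_s c s * (\sum_k D m s k j * (e * (k == r)%:R))).
Proof.
move=> /(_ Z Z (dual m) c c2 Zn i); rewrite /jetJ.
under eq_bigr do under eq_bigr do rewrite jetS_hess.
rewrite (sum2_dual m (fun m => \sum_k W m i k * (\sum_j eta k j * c2 j))).
rewrite [X in _ - X - _](_ : _ = 0) ?subr0; last first.
  by apply: big1 => m' _; apply: sumM0 => n; rewrite mul0r.
under [X in _ - X]eq_bigr do rewrite jetN_dual.
by move/eqP; rewrite subr_eq0 => /eqP.
Qed.

(** Coefficient of c'': take c = 0 and c'' = e_a. *)
Lemma jet_sym m : (W m *m eta)^T = W m *m eta.
Proof.
apply/matrixP => a i; have [e _ H] := J0 a.
have E := @jetJ_dual a e m Z (dl a) i H.
rewrite !mxE; transitivity (\sum_k W m i k * (\sum_j eta k j * dl a j)).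
  apply: eq_bigr => k _; congr (_ * _).
  by rewrite -(sum_delta a (fun j => eta k j)); apply: eq_bigr => j _; rewrite mulrC.
rewrite E; apply: eq_bigr => j _; rewrite sum_delta [X in _ - X]big1 ?subr0; last first.
  by move=> s _; rewrite mul0r.
by rewrite mulrC -[in LHS]eta_sym mxE.
Qed.

(** Coefficient of c: take c = e_a and c'' = 0; [eta] and the factor e are then cancelled. *)
Lemma jet_closed m a r j : D m a r j = 0.
Proof.
have [e e0 H] := J0 r.
suff /(_ j)/eqP : forall j, e * D m a r j = 0 by rewrite mulf_eq0 (negbTE e0) => /eqP.
apply: (unitmx_inj eta_unit) => i; have E := @jetJ_dual r e m (dl a) Z i H.
apply/eqP; rewrite -oppr_eq0 -sumrN; apply/eqP.
transitivity (\sum_k W m i k * (\sum_j eta k j * Z j)); last first.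
  by apply: sumM0 => k; apply: sumM0.
rewrite E; apply: eq_bigr => l _; rewrite big1; last by move=> s _; rewrite mul0r.
rewrite sub0r sum_delta mulrN; congr (- (_ * _)).
by rewrite -(sum_delta r (fun k => e * D m a k l)); apply: eq_bigr => k _; ring.
Qed.

(** Here b = e_a and c = e_c while all second derivatives and nonlocal values are 0; only the terms
    from b_n'' and c_n'' are left. *)
Lemma jet_gauss a c j r : \sum_m \sum_n mu m n *
  (W m a j * W n c r - W m c j * W n a r) = 0.
Proof.
have [e e0 H] := J0 r.
suff /(_ j)/eqP : forall j, e * \sum_m \sum_n mu m n *
    (W m a j * W n c r - W m c j * W n a r) = 0 by rewrite mulf_eq0 (negbTE e0) => /eqP.
apply: (unitmx_inj eta_unit) => i; have := H (dl a) Z Zn (dl c) Z Zn i.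
rewrite /jetJ [X in X - _ - _](_ : _ = 0); last first.
  by apply: big1 => m' _; apply: sumM0 => n; rewrite mul0r.
rewrite [X in _ - X - _](_ : _ = 0); last first.
  by apply: big1 => m' _; apply: sumM0 => n; rewrite mul0r.
rewrite sub0r oppr0 sub0r => /eqP; rewrite oppr_eq0 => /eqP E.
apply/eqP; rewrite -oppr_eq0 -sumrN; apply/eqP; apply: etrans E; apply: eq_bigr => l _.
rewrite -mulrN; congr (_ * _); rewrite mulr_sumr -sumrN; apply: eq_bigr => m _.
rewrite mulr_sumr -sumrN; apply: eq_bigr => n _.
rewrite big1; last by move=> s _; rewrite /jetG !mulr0 subr0 mul0r.
rewrite sub0r.
transitivity (- (mu m n * (\sum_s (s == a)%:R * (e * W n c r * W m s l) -
   \sum_s (s == c)%:R * (e * W n a r * W m s l)))).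
  by rewrite !sum_delta; ring.
rewrite -mulrN -sumrB; congr (_ * - _); apply: eq_bigr => s _.
rewrite /jetG2 !bil_delta !mulr0 !add0r /dl; ring.
Qed.

End JetAlgebra.

(** * Necessity *)

Section Hump.
Context {R : realType}.

Definition plateau (x : R) : R := step (x + 2) * step (2 - x).
(** Equal to x^2/2 near 0: value and first derivative 0, second derivative 1 there. Where the cutoff
    is nonzero |x| < 2, which gives the bound 2. *)
Definition hump (x : R) : R := 2^-1 * (x * x) * plateau x.

Lemma plateau1 x : -1 < x < 1 -> plateau x = 1.
Proof. by move=> /andP[h1 h2]; rewrite /plateau !step1 ?mulr1 //; lra. Qed.

Lemma plateau_out x : 2 <= `|x| -> plateau x = 0.
Proof.
rewrite /plateau ler_normr => /orP[h|h].
  by rewrite (@step0 _ (2 - x)) ?mulr0 //; lra.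
by rewrite (@step0 _ (x + 2)) ?mul0r //; lra.
Qed.

Lemma plateau_ge0 x : 0 <= plateau x.
Proof. by rewrite mulr_ge0 ?step_ge0. Qed.

Lemma plateau_le1 x : plateau x <= 1.
Proof. by rewrite -[leRHS]mulr1 ler_pM ?step_ge0 ?step_le1. Qed.

Lemma plateau_tst : tst plateau.
Proof.
split; last by exists 2 => x; exact: plateau_out.
apply: smM; first by apply: sm_shift; exact: step_sm.
have := smooth_affine 2 (-1) (@step_sm R); congr sm; apply/funext => x.
by congr step; ring.
Qed.

Lemma square_sm : sm (fun x : R => 2^-1 * (x * x)).
Proof. by apply: smM; [exact: sm_cst | apply: smM; exact: sm_id]. Qed.

Lemma hump_tst : tst hump.
Proof. by apply: tstMl; [exact: square_sm | exact: plateau_tst]. Qed.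

Lemma hump_out x : 2 <= `|x| -> hump x = 0.
Proof. by move=> hx; rewrite /hump plateau_out // mulr0. Qed.

Lemma hump_le2 x : `|hump x| <= 2.
Proof.
have [/hump_out->|/ltW hx] := leP 2 `|x|; first by rewrite normr0.
have h : `|x * x| <= 4.
  by rewrite normrM; have := ler_pM (normr_ge0 x) (normr_ge0 x) hx hx; lra.
have -> : `|hump x| = 2^-1 * (`|x * x| * plateau x).
  by rewrite /hump normrM (ger0_norm (plateau_ge0 x)) normrM (@ger0_norm _ 2^-1) ?mulrA ?invr_ge0.
have := ler_pM (normr_ge0 _) (plateau_ge0 x) h (plateau_le1 x); lra.
Qed.

Lemma derive1_central (f g : R -> R) x : (forall y, -1 < y < 1 -> f y = g y) ->
  -1 < x < 1 -> derive1 f x = derive1 g x.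
Proof.
move=> fg hx; rewrite !derive1E.
apply: (@eq_on_derive _ _ ([set y : R | -1 < y] `&` [set y : R | y < 1])).
- by apply: openI; [exact: open_gt | exact: open_lt].
- by case/andP: hx.
- by move=> y [/= y1 y2]; apply: fg; rewrite y1.
Qed.

Lemma derive2_central (f g : R -> R) x : (forall y, -1 < y < 1 -> f y = g y) ->
  -1 < x < 1 -> derive2 f x = derive2 g x.
Proof. by move=> fg; apply: derive1_central => y; exact: derive1_central. Qed.

Lemma derive1_square (x : R) : derive1 (fun x : R => 2^-1 * (x * x)) x = x.
Proof.
have d1 y : derive1 (fun x : R => x) y = 1 by rewrite derive1E derive_id.
rewrite (derive1M _ (sm_cst _) (smM sm_id sm_id)) (derive1_cst (2^-1 : R)) mul0r add0r.
by rewrite (derive1M _ sm_id sm_id) d1; field.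
Qed.

Lemma central0 : -1 < (0 : R) < 1.
Proof. by apply/andP; split; lra. Qed.

Lemma hump_square y : -1 < y < 1 -> hump y = 2^-1 * (y * y).
Proof. by move=> hy; rewrite /hump plateau1 // mulr1. Qed.

Lemma derive1_hump0 : derive1 hump 0 = 0.
Proof. by rewrite (derive1_central hump_square central0) derive1_square. Qed.

Lemma derive2_hump0 : derive2 hump 0 = 1.
Proof.
rewrite (derive2_central hump_square central0) /derive2.
have -> : derive1 (fun x : R => 2^-1 * (x * x)) = (fun x => x).
  by apply/funext => x; exact: derive1_square.
by rewrite derive1E derive_id.
Qed.

Lemma derive2_jet (a b : R) : derive2 (fun x => plateau x * a + hump x * b) 0 = b.
Proof.
have h y : -1 < y < 1 -> plateau y * a + hump y * b = a + hump y * b.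
  by move=> hy; rewrite plateau1 // mul1r.
have [sh _] := hump_tst; have s1 := sm_cst a; have s2 := sm_cst b.
rewrite (derive2_central h central0) derive2D //; last exact: smM.
rewrite derive2M // derive2_hump0.
have c1 (c : R) : derive1 (fun _ : R => c) = (fun=> 0).
  by apply/funext => y; exact: (derive1_cst c y).
by rewrite /derive2 !c1 !mulr0 mul1r add0r !addr0.
Qed.

(** The integral over the right half-line is 0, and the factor one half comes from sgn(x)/2. *)
Lemma dinv_half (f : R -> R) : tst f -> (forall x, 0 <= x -> f x = 0) ->
  Defs.dinv f 0 = 2^-1 * lint f.
Proof.
move=> tf f0; have [A [F [A0 sA dF]]] := tstP tf; have [sf _] := tf.
rewrite (dinv_antiderivative sf A0 sA dF) (lint_antiderivative sf A0 sA dF).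
have <- : F 0 = F A.
  apply/esym/eqP; rewrite -subr_eq0 -(segint_antiderivative sf dF (ltW A0)).
  rewrite (@segint_ext _ _ _ _ (fun=> 0 * 0)); last first.
    by move=> t /andP[t0 _]; rewrite mulr0 f0.
  by rewrite segintZ ?mul0r //; exact: contin_cst.
by field.
Qed.

End Hump.

(** * Finitely many points that detect all affinors *)

Section Spanning.
Context {R : realType} {N L : nat}.
Variables (U : set 'rV[R]_N) (w : 'I_L -> 'rV[R]_N -> 'M[R]_N).

(** A descent on dimension: the rows of [K] span the coefficient vectors not yet excluded, and each
    new pair (q, k) lowers the rank. Columns are recorded because a field crossing q with velocity
    along e_k sees exactly column k of the w_n(q). *)
Lemma independent_finite : affinors_independent U w ->
  exists2 l : seq ('rV[R]_N * 'I_N), (forall a, a \in l -> U a.1) &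
  forall th : 'I_L -> R, (forall a, a \in l -> forall i, \sum_n th n * w n a.1 i a.2 = 0) ->
    forall n, th n = 0.
Proof.
move=> ind.
have H d (K : 'M[R]_L) : (\rank K <= d)%N ->
    exists2 l : seq ('rV[R]_N * 'I_N), (forall a, a \in l -> U a.1) &
    forall th : 'rV[R]_L, (th <= K)%MS ->
      (forall a, a \in l -> forall i, \sum_n th 0 n * w n a.1 i a.2 = 0) -> th = 0.
  elim: d K => [|d ih] K rK.
    exists [::] => // th; move: rK; rewrite leqn0 mxrank_eq0 => /eqP ->.
    by rewrite submx0 => /eqP.
  have [->|K0] := eqVneq K 0.
    by exists [::] => // th; rewrite submx0 => /eqP.
  pose v := nz_row K; have v0 : v != 0 by rewrite nz_row_eq0.
  (* Independence applied to a nonzero row of [K]: its combination of affinors has a nonzero entry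
     (i, k) at some q. *)
  have [q [i [k [Uq qik]]]] : exists q i k, U q /\ \sum_n v 0 n * w n q i k != 0.
    apply: contrapT => nex; case/negP: v0; apply/eqP/rowP => n; rewrite [RHS]mxE.
    apply: (ind (fun n => v 0 n)) => q Uq; apply/matrixP => i k.
    rewrite [RHS]mxE summxE; apply: contrapT => qik; apply: nex.
    exists q, i, k; split=> //; apply/eqP => E; apply: qik; rewrite -[RHS]E.
    by apply: eq_bigr => m _; rewrite mxE.
  pose c : 'cV[R]_L := \col_n w n q i k.
  have cE (th : 'rV[R]_L) : th *m c = 0 <-> \sum_n th 0 n * w n q i k = 0.
    have E : (th *m c) 0 0 = \sum_n th 0 n * w n q i k.
      by rewrite mxE; apply: eq_bigr => m _; rewrite mxE.
    split=> [h|h]; first by rewrite -E h mxE.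
    by apply/matrixP => a b; rewrite !ord1 E h mxE.
  have [|l Ul Hl] := ih (K :&: kermx c)%MS.
    rewrite -ltnS; apply: leq_trans rK; apply: rank_ltmx.
    rewrite ltmxE capmxSl /=; apply/negP => /(submx_trans (nz_row_sub K)).
    rewrite sub_capmx => /andP[_ /sub_kermxP/cE E].
    by move: qik; rewrite E eqxx.
  exists ((q, k) :: l) => [a|th thK Hth].
    by rewrite inE => /predU1P[->|/Ul].
  apply: Hl => [|a al]; last by apply: Hth; rewrite inE al orbT.
  rewrite sub_capmx thK; apply/sub_kermxP/cE.
  by apply: (Hth (q, k)); rewrite mem_head.
have [l Ul Hl] := H L 1%:M (rank_leq_row _).
exists l => // th Hth n.
have -> : th n = (\row_n th n) 0 n by rewrite mxE.
rewrite (Hl (\row_n th n)) ?mxE ?submx1 // => a al i.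
by rewrite -[RHS](Hth a al i); apply: eq_bigr => m _; rewrite mxE.
Qed.

End Spanning.

(** * Test functions with prescribed jet and nonlocal values *)

Section Interpolation.
Context {R : realType} {N L : nat}.
Variables (U : set 'rV[R]_N) (w : 'I_L -> 'rV[R]_N -> 'M[R]_N).
Hypothesis w_smooth : forall n i j, smooth_on U (fun u => w n u i j).
Variable u : R -> 'rV[R]_N.
Hypothesis fu : is_field U u.
Hypothesis u_span : forall th : 'I_L -> R,
  (forall x i, x < -2 -> \sum_n th n * vel w n u x i = 0) -> forall n, th n = 0.

(** A cutoff that is 1 for x <= -2, where the visits occur, and 0 for x >= -1, so that it does not
    disturb the jet at 0. *)
Let chi (x : R) : R := step (-1 - x).

Let chi_sm : sm chi.
Proof.
have := smooth_affine (-1) (-1) (@step_sm R); congr sm; apply/funext => x.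
by rewrite /chi mulN1r.
Qed.

Let chi_out x : -1 <= x -> chi x = 0.
Proof. by move=> hx; rewrite /chi step0 //; lra. Qed.

(** W_m cut off: pairing it with W_n gives, up to one half, the entry of a Gram matrix. *)
Let far m x : 'rV[R]_N := \row_i (chi x * vel w m u x i).

Let vtst_far m : vtst (far m).
Proof.
move=> i; apply: (eq_tst _ (tstMl chi_sm (tst_vel w_smooth fu m i))) => x.
by rewrite mxE.
Qed.

Let pvel_far n m x : pvel w n u (far m) x = chi x * \sum_j vel w n u x j * vel w m u x j.
Proof. by rewrite mulr_sumr; apply: eq_bigr => j _; rewrite mxE mulrCA. Qed.

Let scaleE (c : R) (v : 'rV[R]_N) j : (c *: v) 0 j = c * v 0 j.
Proof. by rewrite mxE. Qed.

Let dinv_far (th : 'I_L -> R) n :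
  Defs.dinv (pvel w n u (fun x => \sum_m th m *: far m x)) 0 =
  2^-1 * lint (fun x => \sum_m th m * pvel w n u (far m) x).
Proof.
have E : pvel w n u (fun x => \sum_m th m *: far m x) =
    (fun x => \sum_m th m * pvel w n u (far m) x).
  apply/funext => x; rewrite /pvel.
  under eq_bigr do rewrite summxE mulr_sumr.
  rewrite exchange_big; apply: eq_bigr => m _; rewrite mulr_sumr.
  by apply: eq_bigr => j _; rewrite scaleE mulrCA.
rewrite E dinv_half //.
  apply: tst_sum => m _; apply: tstMl; first exact: sm_cst.
  exact: (tst_pvel w_smooth fu).
move=> x x0; apply: big1 => m _; rewrite pvel_far chi_out ?mul0r ?mulr0 //; lra.
Qed.

(* The Gram matrix of the fields vel m u for the weight chi, up to a factor. *)
Let G : 'M[R]_L := \matrix_(m, n) (2^-1 * lint (pvel w n u (far m))).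

(** For v in the kernel, v G v^T is half the integral of chi |sum_n v_n W_n|^2. Its vanishing forces
    sum_n v_n W_n = 0 for x < -2, and [u_span] gives v = 0. *)
Let G_unit : G \in unitmx.
Proof.
rewrite -row_free_unit; apply: inj_row_free => v vG.
have tW n i := tst_vel w_smooth fu n i.
have tp n m := tst_pvel w_smooth fu n (vtst_far m).
pose Q x i := \sum_n v 0 n * vel w n u x i.
have tQ i : tst (Q ^~ i) by apply: tst_sum => n _; apply: tstMl => //; exact: sm_cst.
have t1 : tst (fun x => \sum_i Q x i * Q x i).
  by apply: tst_sum => i _; apply: tstMl => //; have [] := tQ i.
have t2 : tst (fun x => chi x * \sum_i Q x i * Q x i) by exact: tstMl.
have t3 n m := tstMl (sm_cst (v 0 n * v 0 m)) (tp n m).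
have I0 : lint (fun x => chi x * \sum_i Q x i * Q x i) = 0.
  (* The factor 2 undoes the one half in [G]. *)
  transitivity (\sum_n v 0 n * (2 * (v *m G) 0 n)); last first.
    by rewrite vG; apply: big1 => n _; rewrite mxE !mulr0.
  transitivity (lint (fun x => \sum_n \sum_m v 0 n * v 0 m * pvel w n u (far m) x)).
    congr lint; apply/funext => x.
    under [RHS]eq_bigr do under eq_bigr do rewrite pvel_far !mulr_sumr.
    rewrite mulr_sumr; under [RHS]eq_bigr do rewrite exchange_big.
    rewrite [RHS]exchange_big; apply: eq_bigr => i _ /=.
    rewrite /Q mulr_suml mulr_sumr; apply: eq_bigr => n _.
    by rewrite 2!mulr_sumr; apply: eq_bigr => m _; ring.
  rewrite lint_sum; last by move=> n _; apply: tst_sum.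
  apply: eq_bigr => n _; rewrite (lint_sum _ (fun m _ => t3 n m)) mxE !mulr_sumr.
  apply: eq_bigr => m _; rewrite lintZ // mxE; by field.
have pos x : 0 <= chi x * \sum_i Q x i * Q x i.
  rewrite mulr_ge0 ?step_ge0 //; apply: sumr_ge0 => i _.
  by rewrite -expr2 sqr_ge0.
have chiQ := lint_eq0 t2 pos I0.
apply/rowP => n; rewrite [RHS]mxE; apply: (u_span (th := fun n => v 0 n)) => x i hx.
have /eqP := chiQ x; rewrite /chi step1 ?mul1r; last by lra.
rewrite psumr_eq0; last by move=> j _; rewrite -expr2 sqr_ge0.
by move=> /allP/(_ i (mem_index_enum i)); rewrite implyTb mulf_eq0 orbb => /eqP.
Qed.

(** The local part takes care of the value and second derivative at 0; a combination of the [far m],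
    which vanish for x > -1, then corrects the nonlocal values. *)
Lemma jet_interpolation (b0 b2 : 'I_N -> R) (be : 'I_L -> R) :
  exists b, [/\ vtst b, forall i, b 0 0 i = b0 i,
    forall i, derive2 (fun x => b x 0 i) 0 = b2 i
    & forall n, Defs.dinv (pvel w n u b) 0 = be n].
Proof.
pose loc x : 'rV[R]_N := \row_i (plateau x * b0 i + hump x * b2 i).
have tl : vtst loc.
  move=> i; apply: (eq_tst (f := fun x => plateau x * b0 i + hump x * b2 i)).
    by move=> x; rewrite mxE.
  apply: tstD; apply: tstMr => //; by [exact: plateau_tst|exact: hump_tst|exact: sm_cst].
(* The local part already produces nonlocal values; only the difference has to be supplied from
   afar. *)
pose de : 'rV[R]_L := \row_n (be n - Defs.dinv (pvel w n u loc) 0).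
pose th := de *m invmx G.
pose fr x := \sum_m th 0 m *: far m x.
have tf : vtst fr.
  move=> i; apply: (eq_tst (f := fun x => \sum_m th 0 m * far m x 0 i)).
    by move=> x; rewrite summxE; apply: eq_bigr => m _; rewrite scaleE.
  by apply: tst_sum => m _; apply: tstMl; [exact: sm_cst | exact: vtst_far].
have f0 x i : -1 < x -> fr x 0 i = 0.
  move=> hx; rewrite summxE; apply: big1 => m _.
  by rewrite !mxE chi_out ?mul0r ?mulr0 // ltW.
have bE x i : -1 < x -> (loc x + fr x) 0 i = plateau x * b0 i + hump x * b2 i.
  by move=> hx; rewrite mxE f0 // mxE addr0.
exists (fun x => loc x + fr x); split.
- exact: vtstD.
- move=> i; have /andP[h0 _] := @central0 R; rewrite bE // plateau1 ?central0 //.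
  by rewrite /hump !mulr0 !mul0r addr0 mul1r.
- move=> i; rewrite -(derive2_jet (b0 i) (b2 i)); apply: derive2_central.
    by move=> y /andP[hy _]; exact: bE.
  exact: central0.
- move=> n; have E : pvel w n u (fun x => loc x + fr x) =
      (fun x => pvel w n u loc x + pvel w n u fr x).
    apply/funext => x; rewrite /pvel -big_split; apply: eq_bigr => j _.
    by rewrite mxE mulrDr.
  rewrite E dinvD; [|exact: (tst_pvel w_smooth fu)|exact: (tst_pvel w_smooth fu)].
  rewrite (dinv_far (fun m => th 0 m) n) lint_sum; last first.
    by move=> m _; apply: tstMl; [exact: sm_cst|exact: (tst_pvel w_smooth fu)].
  have := congr1 (fun v : 'rV[R]_L => v 0 n) (mulmxKV G_unit de).
  rewrite -/th mxE [in X in _ = X -> _]mxE => H.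
  suff -> : 2^-1 * \sum_m lint (fun x => th 0 m * pvel w n u (far m) x) =
      be n - Defs.dinv (pvel w n u loc) 0 by rewrite addrC subrK.
  rewrite -H mulr_sumr; apply: eq_bigr => m _; rewrite [G m n]mxE.
  by rewrite (lintZ _ (tst_pvel w_smooth fu n (vtst_far m))) mulrCA.
Qed.

End Interpolation.

Section Necessity.
Context {R : realType} {N L : nat}.
Variables (U : set 'rV[R]_N) (eta : 'M[R]_N) (mu : 'M[R]_L).
Variable w : 'I_L -> 'rV[R]_N -> 'M[R]_N.
Hypotheses (openU : open U) (connectedU : connected U).
Hypotheses (eta_sym : eta^T = eta) (mu_sym : mu^T = mu).
Hypotheses (eta_unit : eta \in unitmx) (mu_unit : mu \in unitmx).
Hypothesis w_smooth : forall n i j, smooth_on U (fun u => w n u i j).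
Hypothesis ind : affinors_independent U w.

(** The path through the detecting points rests at p from -2 on, and a multiple of [hump] along e_r
    is added there; this leaves the visits before -2 untouched. *)
Lemma probing_field p r : U p -> exists u (e : R), [/\ is_field U u, u 0 = p,
  forall k, dx u k 0 = 0,
  e != 0 /\ forall k, derive1 (dx u k) 0 = e * (k == r)%:R
  & forall th : 'I_L -> R,
    (forall x i, x < -2 -> \sum_n th n * vel w n u x i = 0) -> forall n, th n = 0].
Proof.
move=> Up; have [l Ul Hl] := independent_finite ind.
have [v [cv Uv vp vl]] := path_exists openU connectedU Ul Up.
have /nbhs_ballP[rho /= rho0 BU] := open_near openU Up.
pose d : 'rV[R]_N := delta_mx 0 r.
have nd : 0 < 2 * (1 + `|d|) by rewrite mulr_gt0 // ltr_pwDl.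
(* As |hump| <= 2, the added term has norm at most 2 e |d| < rho, so the field stays in the ball
   around p. *)
pose e := rho / (2 * (1 + `|d|)).
have e0 : 0 < e by rewrite divr_gt0.
have [sh _] := @hump_tst R.
pose g x := e * hump x.
have sg : sm g by apply: smM; [exact: sm_cst | exact: sh].
have tg : tst (derive1 g) by apply: tst_derive1; apply: tstMl; [exact: sm_cst|exact: hump_tst].
have dg x : derive1 g x = e * derive1 hump x.
  by rewrite (derive1M _ (sm_cst e) sh) (derive1_cst e x) mul0r add0r.
pose z x := g x *: d.
have cz : curve z by exact: curve_scaled.
have z_out x : 2 <= `|x| -> z x = 0.
  by move=> hx; rewrite /z /g hump_out // mulr0 scale0r.
pose u x := v x + z x.
have dxu k x : dx u k x = dx v k x + derive1 g x * (k == r)%:R.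
  by rewrite (dxD _ _ cv cz) dx_scaled // mxE.
have dv0 k x : -2 < x -> dx v k x = 0.
  by apply: (@dx_gt _ _ v p (-2)) => y /ltW; exact: vp.
exists u, e; split.
- apply: (curve_field (curveD cv cz)) => x; rewrite /u.
  have [hx|/ltW hx] := leP 2 `|x|; first by rewrite z_out ?addr0.
  rewrite vp; last by move: hx; rewrite ler_norml => /andP[].
  apply: BU; rewrite -ball_normE /= opprD addrA subrr add0r normrN /z normrZ.
  have : `|g x| <= 2 * e.
    by rewrite normrM (gtr0_norm e0) mulrC ler_pM2r ?hump_le2.
  move=> /(ler_wpM2r (normr_ge0 d))/le_lt_trans; apply.
  rewrite [ltRHS](_ : rho = 2 * e * (1 + `|d|)); last first.
    by rewrite /e; field; rewrite gt_eqF // ltr_pwDl.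
  by rewrite ltr_pM2l ?mulr_gt0 // ltrDr.
- rewrite /u vp; last by lra.
  by rewrite /z /g /hump !mulr0 mul0r mulr0 scale0r addr0.
- move=> k; rewrite dxu dv0; last by lra.
  by rewrite dg derive1_hump0 mulr0 mul0r addr0.
- split=> [|k]; first by rewrite gt_eqF.
  transitivity (derive1 (fun x => derive1 g x * (k == r)%:R) 0).
    apply: derive1_central central0 => y /andP[hy _].
    by rewrite dxu dv0 ?add0r //; apply: le_lt_trans hy; lra.
  rewrite (derive1_scaled _ _ (sm_derive1 sg)); congr (_ * _).
  have -> : derive1 g = (fun x => e * derive1 hump x) by apply/funext.
  rewrite (derive1M _ (sm_cst e) (sm_derive1 sh)) (derive1_cst e 0) mul0r add0r.
  by rewrite -[X in _ * X]/(derive2 hump 0) derive2_hump0 mulr1.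
- move=> th Hth; apply: Hl => a /vl[x [hx vx [s s0 ds]]] i.
  have := Hth x i hx; have nx : 2 <= `|x| by rewrite ler_normr; apply/orP; right; lra.
  have ux : u x = a.1 by rewrite /u z_out // addr0.
  have du k : dx u k x = s * (k == a.2)%:R.
    rewrite -ds (dxD _ _ cv cz) (@dx_lt _ _ z 0 (-2)) ?addr0 // => y hy.
    by apply: z_out; rewrite ler_normr; apply/orP; right; lra.
  have WE n : vel w n u x i = s * w n a.1 i a.2.
    rewrite -(sum_delta a.2 (fun k => s * w n a.1 i k)); apply: eq_bigr => k _.
    by rewrite ux du; ring.
  under eq_bigr do rewrite WE mulrCA.
  by rewrite -mulr_sumr => /eqP; rewrite mulf_eq0 (negbTE s0) => /eqP.
Qed.

(** On a probing field every choice of jets and nonlocal values is attained by test functions, so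
    the vanishing of F(b, c) at x = 0 becomes that of [jetJ] for arbitrary arguments. *)
Lemma jacobi_flat : (forall u a b c, is_field U u -> vtst a -> vtst b -> vtst c ->
  jacobiator eta mu w u a b c = 0) -> forall p, U p -> flat_at eta mu w p.
Proof.
move=> T0 p Up.
have J0 r : exists2 e : R, e != 0 & forall b b2 bn c c2 cn i,
    jetJ eta mu (fun n => w n p) (curl w p) (fun k => e * (k == r)%:R)
      b b2 bn c c2 cn i = 0.
  have [u [e [fu u0 du0 [e0 Yu] su]]] := probing_field r Up.
  exists e => // b b2 bn c c2 cn i.
  have [B [tB B0 B2 Bn]] := jet_interpolation w_smooth fu su b b2 bn.
  have [C [tC C0 C2 Cn]] := jet_interpolation w_smooth fu su c c2 cn.
  have := jcov_eq0 eta_sym mu_sym w_smooth fu tB tC (fun a ta => T0 u a B C fu ta tB tC) 0.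
  move=> /rowP/(_ i); rewrite [RHS]mxE => J; rewrite -u0; apply: etrans J.
  exact: (esym (crit_jcov_jet eta mu w_smooth fu du0 i tB tC Yu B0 B2 Bn C0 C2 Cn)).
split.
- exact: (jet_sym eta_sym mu_unit J0).
- move=> n i k l; apply/eqP; rewrite -subr_eq0; apply/eqP.
  exact: (jet_closed eta_unit mu_unit J0 n i k l).
- exact: (jet_commute mu_unit J0).
- by move=> i j k l; have := jet_gauss eta_unit J0 i j k l.
Qed.

End Necessity.

Theorem theorem11p1 (R : realType) (N L : nat) (U : set 'rV[R]_N)
    (eta : 'M[R]_N) (mu : 'M[R]_L) (w : 'I_L -> 'rV[R]_N -> 'M[R]_N)
    (openU : open U) (connectedU : connected U)
    (eta_sym : eta^T = eta) (eta_nondeg : eta \in unitmx)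
    (mu_sym : mu^T = mu) (mu_nondeg : mu \in unitmx)
    (w_smooth : forall n i j, smooth_on U (fun u => w n u i j)) :
  (locally_potential_flat eta mu U w -> hamiltonian U (nonlocal_op eta mu w))
  /\
  (affinors_independent U w ->
   hamiltonian U (nonlocal_op eta mu w) -> locally_potential_flat eta mu U w).
Proof.
have hP := hamiltonianP openU eta_sym mu_sym w_smooth.
split=> [pf|ind /hP H].
  apply/hP => u a b c fu ta tb tc; apply: (jacobiator_eq0 w_smooth fu) => //.
  exact: (potential_flat eta_sym mu_sym pf).
exact/(flat_potential)/jacobi_flat.
Qed.
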